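(* Let $f\not\equiv 0$ be a meromorphic function in $\mathbb{C}$ of order $\sigma(f)=\sigma<1$, and let $\eta$ be a fixed non-zero complex number. Then for any $\varepsilon>0$ and any positive integer $k$, there exists a set $E\subset(1,\infty)$ that depends on $f$ and has finite logarithmic measure, such that for all $z$ satisfying $|z|=r\notin E\cup[0,1]$, $$\frac{\Delta^k f(z)}{f(z)}=\eta^k\,\frac{f^{(k)}(z)}{f(z)}+O\big(r^{(k+1)(\sigma-1)+\varepsilon}\big).$$
   Context: For the fixed non-zero complex number $\eta$, $\Delta f(z)=f(z+\eta)-f(z)$ and $\Delta^n f=\Delta(\Delta^{n-1}f)$ for integers $n\ge 2$. The order $\sigma(f)$ is the Nevanlinna order $\limsup_{r\to\infty}\log^+ T(r,f)/\log r$, with $T(r,f)$ the Nevanlinna characteristic. A set $E\subset(1,\infty)$ has finite logarithmic measure if $\int_E dr/r<\infty$. The notation $g(z)=O(\psi(r))$ for $|z|=r\notin E\cup[0,1]$ means: there are $r_0>0$ and $K>0$ such that $|g(z)|\le K\psi(r)$ for all $z$ with $|z|=r>r_0$ and $r\notin E\cup[0,1]$. *)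

(* Defs.v *)
From HB Require Import structures.
From mathcomp Require Import all_boot all_order all_algebra.
From mathcomp Require Import all_classical all_reals all_analysis.
From mathcomp Require Export complex.
Import Order.TTheory GRing.Theory Num.Theory numFieldNormedType.Exports.

Set Implicit Arguments.
Unset Strict Implicit.
Unset Printing Implicit Defensive.

Local Open Scope classical_set_scope.
Local Open Scope ring_scope.
Local Open Scope complex_scope.

(* Bundling R[i] as a numFieldType gives it the topology and the normed-module
   structure over itself from numFieldNormedType, so that [derivable f z 1] and
   [f^`(k)] mean complex differentiability and complex derivatives. *)
Definition Cplx (R : realType) : numFieldType := R[i].

(* The library norm on R[i] takes its values in R[i]; this one is real. *)
Definition cmod (R : realType) (z : Cplx R) : R := complex.Re `|z|.

Definition circle_pt (R : realType) (r t : R) : Cplx R :=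
  (r * cos t) +i* (r * sin t).

Section Meromorphic.
Variable R : realType.
Implicit Types (f g : Cplx R -> Cplx R) (z : Cplx R) (m : nat).

Definition holomorphic_at f z := \forall w \near z, derivable f w 1.

Definition pole_of_order f z m :=
  (0 < m)%N /\
  exists g, [/\ holomorphic_at g z, g z != 0 &
    \forall w \near z^', f w = g w / (w - z) ^+ m].

Definition pole f z := exists m, pole_of_order f z m.

(* A meromorphic function is represented by a total function; its value at a
   pole is arbitrary. *)
Definition meromorphic f := forall z, holomorphic_at f z \/ pole f z.

(* 0 when z is not a pole of f *)
Definition pole_mult f z : nat := xget 0%N [set m | pole_of_order f z m].

End Meromorphic.

Section Nevanlinna.
Variable R : realType.
Implicit Types (f : Cplx R -> Cplx R) (r t : R).
Local Open Scope ereal_scope.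

(* log^+; as lne x = -oo for x <= 0, this is 0 on ]-oo, 1] *)
Definition logp (x : \bar R) : \bar R := maxe 0 (lne x).

(* n(t, f): poles in the closed disc of radius t, counted with multiplicity *)
Definition pole_count f t : \bar R :=
  (\esum_(z in [set z : Cplx R | (cmod z <= t)%R]) ((pole_mult f z)%:R)%:E)%R.

Definition nev_counting f r : \bar R :=
  \int[lebesgue_measure]_(t in `]0%R, r])
     ((pole_count f t - pole_count f 0) * (t^-1)%:E)
  + pole_count f 0 * (ln r)%:E.

Definition nev_proximity f r : \bar R :=
  ((2 * pi)^-1)%:E *
  \int[lebesgue_measure]_(t in `[0%R, (2 * pi)%R])
     logp (cmod (f (circle_pt r t)))%:E.

Definition nev_char f r : \bar R := nev_proximity f r + nev_counting f r.

Definition nev_order f : \bar R :=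
  limf_esup (fun r : R => logp (nev_char f r) * ((ln r)^-1)%:E) +oo%R.

End Nevanlinna.

Definition fdiff (R : realType) (eta : Cplx R) (f : Cplx R -> Cplx R) :
  Cplx R -> Cplx R := fun z => f (z + eta) - f z.

Definition fdiffn (R : realType) (eta : Cplx R) (k : nat)
  (f : Cplx R -> Cplx R) : Cplx R -> Cplx R := iter k (fdiff eta) f.

Definition finite_log_measure (R : realType) (E : set R) : Prop :=
  measurable (E : set (measurableTypeR R)) /\
  (\int[lebesgue_measure]_(r in E) (r^-1)%:E < +oo)%E.

(* g(z) = O(psi(r)) for |z| = r outside E and [0, 1] *)
Definition bigO_off (R : realType) (E : set R) (g : Cplx R -> Cplx R)
  (psi : R -> R) : Prop :=
  exists r0 K : R, [/\ 0 < r0, 0 < K &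
    forall z : Cplx R, r0 < cmod z -> ~ (E `|` `[0, 1]) (cmod z) ->
      cmod (g z) <= K * psi (cmod z)].

(* Every value of f occurring in (Delta^k f)(z) / f(z) and f^(k)(z) / f(z) is
   finite, and the denominator is not 0: at such z the values assigned to f at
   its poles and the convention x / 0 = 0 play no role. *)
Definition quotients_defined (R : realType) (eta : Cplx R) (k : nat)
  (f : Cplx R -> Cplx R) (z : Cplx R) : Prop :=
  f z != 0 /\ forall j : nat, (j <= k)%N -> ~ pole f (z + eta *+ j).

(* Main.v *)
Require Import Defs.
From HB Require Import structures.
From mathcomp Require Import all_boot all_order all_algebra.
From mathcomp Require Import all_classical all_reals all_analysis.
From mathcomp Require Import measurable_realfun ring lra.
Import Order.TTheory GRing.Theory Num.Theory numFieldNormedType.Exports.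
Set Implicit Arguments.
Unset Strict Implicit.
Unset Printing Implicit Defensive.
Local Open Scope classical_set_scope.
Local Open Scope ring_scope.

(** Since sigma < 1, the zeros and poles of f are so sparse that, off a set of
    finite logarithmic measure, a point z with |z| = r has none of them within
    rho = r^(1 - sigma - delta) / C.  On such a disc f is holomorphic and
    zero-free, and log |f(w)| differs from log |f(z)| by a bounded amount, so
    Taylor's formula there bounds Delta^k f(z) - eta^k f^(k)(z) by
    O(|f(z)| rho^-(k+1)).

    The variation of log |f| comes from f = G prod (w - a) / prod (w - b) on a
    disc of radius comparable to r, with G zero-free.  Jensen's formula bounds
    the number of factors and the mean of |log |G|| on a circle by the
    characteristic T, hence G'/G by r^(sigma - 1 + delta).  The sums of 1/|z - a|
    have the same bound off the exceptional set, by Markov's inequality applied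
    to the sum of the functions 1/(1 + |r - |a||) on each dyadic interval. *)

(** * Modulus of a complex number and real integrals *)

(** A Taylor polynomial of degree k contributes exactly eta^k f^(k)(z) to Delta^k f(z), so all k are
    treated at once and log |f| is the only quantity to control: no iteration over the quotients
    f^(j)/f occurs.

    The origin may be a zero or a pole of f, and G changes with r, so Jensen's formula cannot be
    normalised at 0. It is used as a difference of two circles, which cancels log |G(0)|: the inner
    circle has a fixed radius in [1, 2] and misses all zeros and poles, and its mean of log |f| is a
    constant of f.

    The exponents balance as follows, with theta = delta / 4 and X = 2^n. The characteristic is
    O(X^(sigma + theta)) and each logarithm costs X^theta, so there are O(X^(sigma + 2 theta)) zeros
    and poles. Discarding the radii where the sum of 1/(1 + |r - |a||) reaches X^(sigma - 1 + delta)
    removes logarithmic measure O(X^(sigma + 3 theta) / X^(sigma + delta)) = O(X^(-theta)), a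
    geometric sequence in n. Elsewhere G'/G is O(X^(sigma - 1 + 3 theta)), which is below that
    level. *)

Section ComplexModulus.
Variable R : realType.
Implicit Types (z w : Cplx R) (x : R).

Definition rc (x : R) : Cplx R := real_complex R x.
Definition cre z : R := complex.Re z.
Definition cim z : R := complex.Im z.
Definition cconj z : Cplx R := conjc z.
Definition ci : Cplx R := Complex 0 1.

Lemma cplx_ext z w : cre z = cre w -> cim z = cim w -> z = w.
Proof. by case: z => a b; case: w => c d; rewrite /cre /cim /= => -> ->. Qed.

Lemma creD z w : cre (z + w) = cre z + cre w. Proof. by case: z; case: w. Qed.
Lemma cimD z w : cim (z + w) = cim z + cim w. Proof. by case: z; case: w. Qed.
Lemma creN z : cre (- z) = - cre z. Proof. by case: z. Qed.
Lemma cimN z : cim (- z) = - cim z. Proof. by case: z. Qed.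
Lemma creM z w : cre (z * w) = cre z * cre w - cim z * cim w.
Proof. by case: z; case: w. Qed.
Lemma cimM z w : cim (z * w) = cre z * cim w + cim z * cre w.
Proof. by case: z; case: w => *; rewrite /cre/cim/=. Qed.
Lemma creJ z : cre (cconj z) = cre z. Proof. by case: z. Qed.
Lemma cimJ z : cim (cconj z) = - cim z. Proof. by case: z. Qed.
Lemma cre_rc x : cre (rc x) = x. Proof. by []. Qed.
Lemma cim_rc x : cim (rc x) = 0. Proof. by []. Qed.
Lemma cre_ci : cre ci = 0. Proof. by []. Qed.
Lemma cim_ci : cim ci = 1. Proof. by []. Qed.
Lemma cre0 : cre 0 = 0. Proof. by []. Qed.
Lemma cim0 : cim 0 = 0. Proof. by []. Qed.
Lemma cre1 : cre 1 = 1. Proof. by []. Qed.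
Lemma cim1 : cim 1 = 0. Proof. by []. Qed.
(** Identities that mix [cconj], [rc] and [ci] become [ring] identities between real and imaginary
    parts under these rules. *)
Definition cpartsE := (creD, cimD, creN, cimN, creM, cimM, creJ, cimJ, cre_rc,
  cim_rc, cre_ci, cim_ci, cre0, cim0, cre1, cim1).

Lemma rcD x y : rc (x + y) = rc x + rc y. Proof. exact: rmorphD. Qed.
Lemma rcB x y : rc (x - y) = rc x - rc y. Proof. exact: rmorphB. Qed.
Lemma rcM x y : rc (x * y) = rc x * rc y. Proof. exact: rmorphM. Qed.
Lemma rcV x : rc x^-1 = (rc x)^-1. Proof. exact: fmorphV. Qed.
Lemma rc0 : rc 0 = 0. Proof. by []. Qed.
Lemma rc1 : rc 1 = 1. Proof. by []. Qed.
Lemma rc_eq0 x : (rc x == 0) = (x == 0).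
Proof. exact: fmorph_eq0. Qed.

Lemma normE z : `|z| = rc (cmod z).
Proof. by rewrite /rc /cmod (@normc_def R z). Qed.
Lemma cmodE z : cmod z = Num.sqrt (cre z ^+ 2 + cim z ^+ 2).
Proof. by rewrite /cmod (@normc_def R z). Qed.
Lemma cmod_sqr z : cmod z ^+ 2 = cre z ^+ 2 + cim z ^+ 2.
Proof. by rewrite cmodE sqr_sqrtr // addr_ge0 // sqr_ge0. Qed.
Lemma cmod_ge0 z : 0 <= cmod z. Proof. by rewrite cmodE sqrtr_ge0. Qed.
Lemma rc_inj x y : rc x = rc y -> x = y. Proof. by case. Qed.
Lemma cmodM z w : cmod (z * w) = cmod z * cmod w.
Proof. by apply: rc_inj; rewrite rcM -!normE normrM. Qed.
Lemma cmodD z w : cmod (z + w) <= cmod z + cmod w.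
Proof. have := ler_normD z w; rewrite !normE -rcD. by rewrite /rc (@lecR R). Qed.
Lemma cmodN z : cmod (- z) = cmod z.
Proof. by apply: rc_inj; rewrite -!normE normrN. Qed.
Lemma cmod_eq0 z : (cmod z == 0) = (z == 0).
Proof. by rewrite -rc_eq0 -normE normr_eq0. Qed.
Lemma cmod0 : cmod (0 : Cplx R) = 0. Proof. by apply/eqP; rewrite cmod_eq0. Qed.
Lemma cmod_gt0 z : (0 < cmod z) = (z != 0).
Proof. by rewrite lt_neqAle eq_sym cmod_eq0 cmod_ge0 andbT. Qed.
Lemma cmodV z : cmod (z^-1) = (cmod z)^-1.
Proof. by apply: rc_inj; rewrite rcV -!normE normfV. Qed.
Lemma cmod1 : cmod (1 : Cplx R) = 1.
Proof. by apply: rc_inj; rewrite -normE normr1. Qed.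
Lemma cmodX z n : cmod (z ^+ n) = cmod z ^+ n.
Proof. by elim: n => [|n IH]; rewrite ?expr0 ?cmod1 // !exprS cmodM IH. Qed.
Lemma cmod_rc x : cmod (rc x) = `|x|.
Proof. by rewrite cmodE cre_rc cim_rc expr0n addr0 sqrtr_sqr. Qed.
Lemma cmodB z w : cmod (z - w) <= cmod z + cmod w.
Proof. by rewrite (le_trans (cmodD _ _)) // cmodN. Qed.
Lemma cmodBC z w : cmod (z - w) = cmod (w - z).
Proof. by rewrite -cmodN opprB. Qed.
Lemma cmod_lerB z w : cmod z - cmod w <= cmod (z - w).
Proof. rewrite lerBlDr; have := cmodD (z - w) w; by rewrite subrK. Qed.
Lemma cmodJ z : cmod (cconj z) = cmod z.
Proof. by rewrite !cmodE creJ cimJ sqrrN. Qed.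
Lemma cmod_ci : cmod ci = 1.
Proof. by rewrite cmodE cre_ci cim_ci expr0n expr1n add0r sqrtr1. Qed.
Lemma cmod_re z : `|cre z| <= cmod z.
Proof. rewrite cmodE -sqrtr_sqr ler_wsqrtr // lerDl sqr_ge0 //. Qed.
Lemma cmod_im z : `|cim z| <= cmod z.
Proof. rewrite cmodE -sqrtr_sqr ler_wsqrtr // lerDr sqr_ge0 //. Qed.
Lemma cplxE z : z = rc (cre z) + ci * rc (cim z).
Proof. by apply: cplx_ext; rewrite !cpartsE; ring. Qed.
Lemma cmod_le z : cmod z <= `|cre z| + `|cim z|.
Proof.
rewrite {1}(cplxE z); apply: (le_trans (cmodD _ _)).
by rewrite cmodM cmod_ci mul1r !cmod_rc.
Qed.
Lemma cconjM z w : cconj (z * w) = cconj z * cconj w.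
Proof. by apply: cplx_ext; rewrite !cpartsE; ring. Qed.
Lemma cconjD z w : cconj (z + w) = cconj z + cconj w.
Proof. by apply: cplx_ext; rewrite !cpartsE; ring. Qed.
Lemma cconjN z : cconj (- z) = - cconj z.
Proof. by apply: cplx_ext; rewrite !cpartsE; ring. Qed.
Lemma cconjK z : cconj (cconj z) = z.
Proof. by apply: cplx_ext; rewrite !cpartsE; ring. Qed.
Lemma mulcconj z : z * cconj z = rc (cmod z ^+ 2).
Proof. by rewrite cmod_sqr; apply: cplx_ext; rewrite !cpartsE; ring. Qed.
Lemma cconjV z : cconj (z^-1) = (cconj z)^-1.
Proof. exact: conjc_inv. Qed.
Lemma cmod_prod (I : Type) (r : seq I) (P : pred I) (F : I -> Cplx R) :
  cmod (\prod_(i <- r | P i) F i) = \prod_(i <- r | P i) cmod (F i).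
Proof. by elim/big_ind2 : _ => //; rewrite ?cmod1 // => a b c d <- <-; rewrite cmodM. Qed.
End ComplexModulus.

Section RealIntegral.
Variable R : realType.
Implicit Types (f g : R -> R) (a b c M : R).

(** There is no orientation: for b < a the segment is empty and the value is 0, hence the hypotheses
    a <= b below. *)
Definition rint f a b : R := \int[lebesgue_measure]_(x in `[a, b]) f x.

(** Continuity is required on the whole line, which makes integrability on every segment automatic;
    integrands known only on [0, 1] are extended by clamping the variable. *)
Definition rcont f := continuous (f : R^o -> R^o).

Lemma rcont_integrable f a b : rcont f ->
  (@lebesgue_measure R).-integrable `[a, b] (EFin \o f).
Proof.
move=> cf; apply: continuous_compact_integrable; first exact: segment_compact.
exact: continuous_subspaceT.
Qed.

Lemma rint_cat f a b c : rcont f -> a <= b -> b <= c ->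
  rint f a c = rint f a b + rint f b c.
Proof.
move=> cf ab bc; rewrite /rint.
have := @Rintegral_itvB R f (BLeft a) (BRight c) b (rcont_integrable _ _ cf).
rewrite !bnd_simp => /(_ ab bc) H.
rewrite -(@Rintegral_itv_obnd_cbnd R b (BRight c) f); last first.
  apply: integrableS (rcont_integrable b c cf) => //.
  exact: subset_itv_oc_cc.
by rewrite -H addrC subrK.
Qed.

Lemma rintD f g a b : rcont f -> rcont g ->
  rint (fun x => f x + g x) a b = rint f a b + rint g a b.
Proof. by move=> cf cg; rewrite /rint RintegralD //; exact: rcont_integrable. Qed.

Lemma rintB f g a b : rcont f -> rcont g ->
  rint (fun x => f x - g x) a b = rint f a b - rint g a b.
Proof. by move=> cf cg; rewrite /rint RintegralB //; exact: rcont_integrable. Qed.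

Lemma rintZ f a b c : rcont f ->
  rint (fun x => c * f x) a b = c * rint f a b.
Proof. by move=> cf; rewrite /rint RintegralZl //; exact: rcont_integrable. Qed.

Lemma rint_cst c a b : a <= b -> rint (fun=> c) a b = c * (b - a).
Proof.
move=> ab; rewrite /rint Rintegral_cst //= lebesgue_measure_itv /= lte_fin.
case: ltrP => // ba; have -> : a = b by apply/eqP; rewrite eq_le ab ba.
by rewrite subrr.
Qed.

Lemma rint_eq f g a b : (forall x, a <= x <= b -> f x = g x) ->
  rint f a b = rint g a b.
Proof.
by move=> fg; apply: eq_Rintegral => x /set_mem /=; rewrite in_itv /=; exact: fg.
Qed.

Lemma rint_le f g a b : rcont f -> rcont g ->
  (forall x, a <= x <= b -> f x <= g x) -> rint f a b <= rint g a b.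
Proof.
move=> cf cg fg; apply: le_Rintegral => //; do ?exact: rcont_integrable.
Qed.

Lemma rint_norm f a b : rcont f -> `|rint f a b| <= rint (fun x => `|f x|) a b.
Proof. by move=> cf; apply: le_normr_Rintegral => //; exact: rcont_integrable. Qed.

Lemma rint_FTC (F f : R -> R) a b : a <= b -> rcont f ->
  (forall x : R, is_derive x (1 : R) F (f x)) -> rint f a b = F b - F a.
Proof.
move=> ab cf dF; have [<-|ne] := eqVneq a b.
  by rewrite /rint set_itv1 Rintegral_set1 subrr.
have altb : a < b by rewrite lt_neqAle ne ab.
have cF : rcont F.
  by move=> x; apply: differentiable_continuous; apply/derivable1_diffP; case: (dF x).
rewrite /rint /Rintegral (@continuous_FTC2 R f F a b altb) //.
- exact: continuous_subspaceT.
- split.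
  + by move=> x _; case: (dF x).
  + by apply: cvg_at_right_filter; apply: cF.
  + by apply: cvg_at_left_filter; apply: cF.
- by move=> x _; rewrite derive1E; case: (dF x).
Qed.

Lemma rcontD f g : rcont f -> rcont g -> rcont (fun x => f x + g x).
Proof. by move=> cf cg x; apply: continuousD; [exact: cf|exact: cg]. Qed.
Lemma rcontN f : rcont f -> rcont (fun x => - f x).
Proof. by move=> cf x; apply: continuousN; exact: cf. Qed.
Lemma rcontB f g : rcont f -> rcont g -> rcont (fun x => f x - g x).
Proof. by move=> cf cg; apply: rcontD => //; exact: rcontN. Qed.
Lemma rcontM f g : rcont f -> rcont g -> rcont (fun x => f x * g x).
Proof. by move=> cf cg x; apply: continuousM; [exact: cf|exact: cg]. Qed.
Lemma rcont_cst c : rcont (fun=> c).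
Proof. by move=> x; exact: cst_continuous. Qed.
Lemma rcont_comp f g : rcont f -> rcont g -> rcont (fun x => f (g x)).
Proof. by move=> cf cg x; apply: continuous_comp; [exact: cg|exact: cf]. Qed.
Lemma rcont_norm f : rcont f -> rcont (fun x => `|f x|).
Proof. by move=> cf; apply: (rcont_comp (f := Num.norm)) => // x; exact: norm_continuous. Qed.
Lemma rcont_id : rcont id. Proof. by move=> x. Qed.

Lemma rcontP f : (forall x e, 0 < e -> exists2 d, 0 < d &
    forall y, `|y - x| < d -> `|f y - f x| < e) <-> rcont f.
Proof.
split=> [H x|cf x e e0].
  apply/cvgrPdist_lt => e e0; have [d d0 Hd] := H x e e0.
  apply/nbhs_normP; exists d => // y /= yx.
  by rewrite distrC; apply: Hd; rewrite distrC.
have /cvgrPdist_lt/(_ e e0) := cf x.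
move=> /nbhs_normP[d /= d0 Hd]; exists d => // y yx.
by rewrite distrC; apply: Hd => /=; rewrite /ball_ /= distrC.
Qed.

Lemma rint_bound f a b M : rcont f -> a <= b ->
  (forall x, a <= x <= b -> `|f x| <= M) -> `|rint f a b| <= M * (b - a).
Proof.
move=> cf ab fM; apply: le_trans (rint_norm _ _ cf) _; rewrite -rint_cst //.
by apply: rint_le => //; [exact: rcont_norm|exact: rcont_cst].
Qed.

End RealIntegral.

(** * Complex derivatives and integrals of complex-valued functions *)

(** Multiplying the difference quotient by h removes both the division and the puncture at h = 0.
    The field is kept general because the real and the complex derivative both use this form. *)
Lemma is_derive_epsP (K : numFieldType) (f : K -> K) (z d : K) :
  is_derive z 1 f d <-> (forall e : K, 0 < e -> exists2 r : K, 0 < r &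
    forall h, `|h| < r -> `|f (z + h) - f z - d * h| <= e * `|h|).
Proof.
have key : is_derive z 1 f d <->
  (fun h => h^-1 *: ((f \o shift z) (h *: 1) - f z)) @ 0^' --> d.
  split=> [[df <-]|cf]; first exact: df.
  by split; [apply/cvg_ex; exists d|apply: cvg_lim].
have E h : h != 0 -> `|d - h^-1 *: ((f \o shift z) (h *: 1) - f z)| * `|h| =
    `|f (z + h) - f z - d * h|.
  move=> h0; rewrite -normrM -normrN; congr (`|_|).
  rewrite /GRing.scale /= mulr1 mulrBl mulrAC mulVf // mul1r opprB.
  by rewrite (addrC h).
rewrite key; split=> [/cvgrPdist_le H|H].
  move=> e e0; have /nbhs_normP[r /= r0 Hr] := H e e0.
  exists r => // h hr; have [->|h0] := eqVneq h 0.
    by rewrite addr0 subrr mulr0 subr0 normr0 mulr0.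
  rewrite -E //; apply: ler_wpM2r => //.
  by apply: Hr => //=; rewrite sub0r normrN.
apply/cvgrPdist_le => e e0; have [r r0 Hr] := H e e0.
apply/nbhs_normP; exists r => // h /=; rewrite sub0r normrN => hr h0.
by rewrite -(ler_pM2r (_ : 0 < `|h|)) ?normr_gt0 // E //; exact: Hr.
Qed.

Section ComplexDerivative.
Variable R : realType.
Local Notation C := (Cplx R).
Implicit Types (f g : C -> C) (z d : C).

(** The library norm on C is C-valued, with a partial order on its values; here every epsilon and
    radius is real. *)
Definition cdiff f z d := forall e : R, 0 < e -> exists2 r : R, 0 < r &
  forall h : C, cmod h < r -> cmod (f (z + h) - f z - d * h) <= e * cmod h.

Lemma ltC_rc (x y : R) : (rc x < rc y) = (x < y).
Proof. exact: (@ltcR R). Qed.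
Lemma leC_rc (x y : R) : (rc x <= rc y) = (x <= y).
Proof. exact: (@lecR R). Qed.

Lemma posC (e : C) : 0 < e -> exists2 x : R, 0 < x & e = rc x.
Proof.
move=> e0; have : `|e| = e by apply: ger0_norm; exact: ltW.
rewrite normE => <-; exists (cmod e) => //.
by rewrite cmod_gt0 gt_eqF.
Qed.

Lemma cdiffP f z d : is_derive z (1 : C) f d <-> cdiff f z d.
Proof.
rewrite is_derive_epsP; split=> H e e0.
  have [|r r0 Hr] := H (rc e); first by rewrite -rc0 ltC_rc.
  have [x x0 rx] := posC r0; exists x => // h hx.
  have := Hr h; rewrite !normE rx ltC_rc -rcM leC_rc; exact.
have [x x0 ex] := posC e0; have [r r0 Hr] := H x x0.
exists (rc r); first by rewrite -rc0 ltC_rc.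
move=> h; rewrite !normE ltC_rc ex -rcM leC_rc; exact: Hr.
Qed.

Lemma near_cplxP (P : C -> Prop) z : (\forall w \near z, P w) <->
  exists2 r : R, 0 < r & forall w, cmod (w - z) < r -> P w.
Proof.
rewrite nbhs_normP; split=> [[e /= e0 H]|[r r0 H]].
  have [x x0 ex] := posC e0; exists x => // w wx; apply: H.
  by rewrite /= normE ex ltC_rc cmodBC.
exists (rc r) => /=; first by rewrite -rc0 ltC_rc.
by move=> w /=; rewrite normE ltC_rc cmodBC; exact: H.
Qed.

Lemma cdiff_cst (c : C) z : cdiff (fun=> c) z 0.
Proof. by apply/cdiffP; exact: is_derive_cst. Qed.
Lemma cdiff_id z : cdiff id z 1.
Proof. by apply/cdiffP; exact: is_derive_id. Qed.
Lemma cdiffD f g z a b : cdiff f z a -> cdiff g z b ->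
  cdiff (fun w => f w + g w) z (a + b).
Proof. by move=> /cdiffP df /cdiffP dg; apply/cdiffP; exact: is_deriveD. Qed.
Lemma cdiffB f g z a b : cdiff f z a -> cdiff g z b ->
  cdiff (fun w => f w - g w) z (a - b).
Proof. by move=> /cdiffP df /cdiffP dg; apply/cdiffP; exact: is_deriveB. Qed.
Lemma cdiffM f g z a b : cdiff f z a -> cdiff g z b ->
  cdiff (fun w => f w * g w) z (f z * b + g z * a).
Proof. by move=> /cdiffP df /cdiffP dg; apply/cdiffP; exact: is_deriveM. Qed.
Lemma cdiffV f z a : f z != 0 -> cdiff f z a ->
  cdiff (fun w => (f w)^-1) z (- a / f z ^+ 2).
Proof.
move=> fz /cdiffP[fd fE]; apply/cdiffP; split; first exact: derivableV.
by rewrite deriveV // fE /GRing.scale /= !mulNr mulrC.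
Qed.
Lemma cdiff_ext f g z d r : 0 < r ->
  (forall w, cmod (w - z) < r -> f w = g w) -> cdiff f z d -> cdiff g z d.
Proof.
move=> r0 fg df e e0; have [s s0 Hs] := df e e0.
exists (Num.min r s); first by rewrite lt_min r0.
move=> h; rewrite lt_min => /andP[hr hs]; rewrite -!fg //; first exact: Hs.
- by rewrite subrr cmod0.
- by rewrite addrC addKr.
Qed.
Lemma cdiff_eq f z a b : a = b -> cdiff f z a -> cdiff f z b.
Proof. by move=> ->. Qed.

Definition ccont_at f z := forall e : R, 0 < e -> exists2 r : R, 0 < r &
  forall w, cmod (w - z) < r -> cmod (f w - f z) < e.

Lemma cdiff_cont f z d : cdiff f z d -> ccont_at f z.
Proof.
move=> df e e0; have [r r0 Hr] := df 1 ltr01.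
have D0 : 0 < 1 + cmod d by rewrite ltr_wpDr // cmod_ge0.
exists (Num.min r (e / (1 + cmod d))).
  by rewrite lt_min r0 divr_gt0.
move=> w; rewrite lt_min => /andP[wr we].
have := Hr (w - z) wr; rewrite mul1r (addrC z) subrK => H.
have -> : f w - f z = (f w - f z - d * (w - z)) + d * (w - z) by rewrite subrK.
apply: le_lt_trans (cmodD _ _) _; rewrite cmodM.
apply: (@le_lt_trans _ _ ((1 + cmod d) * cmod (w - z))).
  by rewrite mulrDl mul1r lerD2r.
by rewrite mulrC -ltr_pdivlMr.
Qed.

Lemma cdiff_shift f z a d : cdiff f (z + a) d -> cdiff (fun w => f (w + a)) z d.
Proof.
move=> df e e0; have [r r0 Hr] := df e e0; exists r => // h hr.
by rewrite (addrAC z h a); exact: Hr.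
Qed.

Definition cderivable f z := exists d, cdiff f z d.
Lemma cderivableP f z : cderivable f z <-> derivable f z 1.
Proof.
split=> [[d /cdiffP[]//]|df]; exists ('D_1 f z); apply/cdiffP.
exact: derivableP.
Qed.
Lemma derive1_cdiff f z d : cdiff f z d -> derive1 f z = d.
Proof. by move=> /cdiffP[_ <-]; rewrite derive1E. Qed.

Lemma holomorphic_atP f z : holomorphic_at f z <->
  exists2 r : R, 0 < r & forall w, cmod (w - z) < r -> cderivable f w.
Proof.
rewrite /holomorphic_at near_cplxP; split=> -[r r0 H]; exists r => // w wr;
  by apply/cderivableP; exact: H.
Qed.

End ComplexDerivative.

Section ComplexIntegral.
Variable R : realType.
Local Notation C := (Cplx R).
Implicit Types (f g : R -> C) (a b : R).

Definition ccont f := rcont (fun t => cre (f t)) /\ rcont (fun t => cim (f t)).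

Lemma ccontP f : (forall x (e : R), 0 < e -> exists2 d : R, 0 < d &
  forall y, `|y - x| < d -> cmod (f y - f x) < e) <-> ccont f.
Proof.
split=> [H|[Hr Hi] x e e0].
  split; apply/rcontP => x e e0; have [d d0 Hd] := H x e e0; exists d => // y yx.
    by have := cmod_re (f y - f x); rewrite !cpartsE => /le_lt_trans; apply; exact: Hd.
  by have := cmod_im (f y - f x); rewrite !cpartsE => /le_lt_trans; apply; exact: Hd.
have e2 : 0 < e / 2 by rewrite divr_gt0.
have [d d0 Hd] := (rcontP _).2 Hr x _ e2.
have [s s0 Hs] := (rcontP _).2 Hi x _ e2.
exists (Num.min d s); first by rewrite lt_min d0.
move=> y; rewrite lt_min => /andP[yd ys].
apply: le_lt_trans (cmod_le _) _; rewrite !cpartsE [ltRHS](splitr e).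
by apply: ltrD; [exact: Hd|exact: Hs].
Qed.

Lemma ccontD f g : ccont f -> ccont g -> ccont (fun t => f t + g t).
Proof.
move=> [f1 f2] [g1 g2]; split.
  by under eq_fun do rewrite creD; exact: rcontD.
by under eq_fun do rewrite cimD; exact: rcontD.
Qed.
Lemma ccontN f : ccont f -> ccont (fun t => - f t).
Proof.
move=> [f1 f2]; split.
  by under eq_fun do rewrite creN; exact: rcontN.
by under eq_fun do rewrite cimN; exact: rcontN.
Qed.
Lemma ccontB f g : ccont f -> ccont g -> ccont (fun t => f t - g t).
Proof. by move=> cf cg; apply: ccontD => //; exact: ccontN. Qed.
Lemma ccontM f g : ccont f -> ccont g -> ccont (fun t => f t * g t).
Proof.
move=> [f1 f2] [g1 g2]; split.
  by under eq_fun do rewrite creM; apply: rcontB; exact: rcontM.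
by under eq_fun do rewrite cimM; apply: rcontD; exact: rcontM.
Qed.
Lemma ccont_cst (c : C) : ccont (fun=> c).
Proof. by split; exact: rcont_cst. Qed.
Lemma ccont_conj f : ccont f -> ccont (fun t => cconj (f t)).
Proof.
move=> [f1 f2]; split; first by under eq_fun do rewrite creJ.
by under eq_fun do rewrite cimJ; exact: rcontN.
Qed.
Lemma ccont_rc (u : R -> R) : rcont u -> ccont (fun t => rc (u t)).
Proof. by move=> cu; split => //; exact: rcont_cst. Qed.
Lemma ccont_cmod f : ccont f -> rcont (fun t => cmod (f t)).
Proof.
move=> /ccontP cf; apply/rcontP => x e e0; have [d d0 Hd] := cf x e e0.
exists d => // y yx; apply: le_lt_trans (Hd y yx).
have := cmod_lerB (f y) (f x); have := cmod_lerB (f x) (f y).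
by rewrite (cmodBC (f x)) ler_norml lerNl opprB => -> ->.
Qed.
Lemma ccont_comp (F : C -> C) f : ccont f -> (forall t, ccont_at F (f t)) ->
  ccont (fun t => F (f t)).
Proof.
move=> /ccontP cf cF; apply/ccontP => x e e0.
have [r r0 Hr] := cF x e e0; have [d d0 Hd] := cf x r r0.
by exists d => // y yx; apply: Hr; exact: Hd.
Qed.
Lemma ccontX f n : ccont f -> ccont (fun t => f t ^+ n).
Proof.
move=> cf; elim: n => [|n IH]; first by under eq_fun do rewrite expr0; exact: ccont_cst.
by under eq_fun do rewrite exprS; exact: ccontM.
Qed.
Lemma ccontV f : ccont f -> (forall t, f t != 0) -> ccont (fun t => (f t)^-1).
Proof.
move=> cf f0; apply: (ccont_comp (F := fun z => z^-1)) => // t.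
exact: cdiff_cont (cdiffV (f := id) (f0 t) (cdiff_id _)).
Qed.
Lemma ccont_reparam f (u : R -> R) : ccont f -> rcont u -> ccont (fun t => f (u t)).
Proof. by move=> [f1 f2] cu; split; [exact: (rcont_comp f1)|exact: (rcont_comp f2)]. Qed.

Definition cint f a b : C :=
  Complex (rint (fun t => cre (f t)) a b) (rint (fun t => cim (f t)) a b).

Lemma cre_cint f a b : cre (cint f a b) = rint (fun t => cre (f t)) a b.
Proof. by []. Qed.
Lemma cim_cint f a b : cim (cint f a b) = rint (fun t => cim (f t)) a b.
Proof. by []. Qed.

Lemma cint_cat f a b c : ccont f -> a <= b -> b <= c ->
  cint f a c = cint f a b + cint f b c.
Proof.
by move=> [f1 f2] ab bc; apply: cplx_ext; rewrite !cpartsE !(cre_cint, cim_cint);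
  exact: rint_cat.
Qed.
Lemma cintD f g a b : ccont f -> ccont g ->
  cint (fun t => f t + g t) a b = cint f a b + cint g a b.
Proof.
move=> [f1 f2] [g1 g2]; apply: cplx_ext;
  rewrite !cpartsE !(cre_cint, cim_cint) -rintD //.
  by congr rint; apply/funext => t; rewrite creD.
by congr rint; apply/funext => t; rewrite cimD.
Qed.
Lemma cintZ f a b (c : C) : ccont f ->
  cint (fun t => c * f t) a b = c * cint f a b.
Proof.
move=> [f1 f2]; apply: cplx_ext; rewrite !cpartsE !(cre_cint, cim_cint) -!rintZ //.
  rewrite -rintB //; try by apply: rcontM => //; exact: rcont_cst.
  by congr rint; apply/funext => t; rewrite creM.
rewrite -rintD //; try by apply: rcontM => //; exact: rcont_cst.
by congr rint; apply/funext => t; rewrite cimM.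
Qed.
Lemma cintB f g a b : ccont f -> ccont g ->
  cint (fun t => f t - g t) a b = cint f a b - cint g a b.
Proof.
move=> cf cg; rewrite cintD //; last exact: ccontN.
congr (_ + _); rewrite -mulN1r -cintZ //; congr cint.
by apply/funext => t; rewrite mulN1r.
Qed.
Lemma cint_eq f g a b : (forall t, a <= t <= b -> f t = g t) ->
  cint f a b = cint g a b.
Proof. by move=> fg; apply: cplx_ext; apply: rint_eq => t /fg ->. Qed.
Lemma cint_conj f a b : ccont f ->
  cint (fun t => cconj (f t)) a b = cconj (cint f a b).
Proof.
move=> [f1 f2]; apply: cplx_ext; rewrite !cpartsE !(cre_cint, cim_cint).
  by congr rint; apply/funext => t; rewrite creJ.
rewrite -mulN1r -rintZ //; congr rint.
by apply/funext => t; rewrite cimJ mulN1r.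
Qed.
Lemma cint_cst (c : C) a b : a <= b -> cint (fun=> c) a b = c * rc (b - a).
Proof.
by move=> ab; apply: cplx_ext; rewrite !cpartsE !(cre_cint, cim_cint) rint_cst //; ring.
Qed.

(* Rotating the integral onto the positive real axis avoids a factor 2. *)
Lemma cmod_cint f a b : ccont f ->
  cmod (cint f a b) <= rint (fun t => cmod (f t)) a b.
Proof.
move=> cf; set c := cint f a b.
have [c0|c0] := eqVneq c 0.
  by rewrite c0 cmod0; apply: Rintegral_ge0 => t _; exact: cmod_ge0.
have mc : 0 < cmod c by rewrite cmod_gt0.
pose u := cconj c / rc (cmod c).
have uE : u * c = rc (cmod c).
  rewrite /u mulrAC (mulrC (cconj c)) mulcconj -rcV -rcM; congr rc.
  by rewrite expr2 mulfK // gt_eqF.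
have cu : cmod u = 1.
  by rewrite /u cmodM -rcV cmod_rc cmodJ ger0_norm ?invr_ge0 ?cmod_ge0 // divff ?gt_eqF.
have -> : cmod c = cre (cint (fun t => u * f t) a b) by rewrite cintZ // uE.
rewrite cre_cint; apply: rint_le.
- by case: (ccontM (ccont_cst u) cf).
- exact: ccont_cmod.
- move=> t _; apply: le_trans (ler_norm _) _; apply: le_trans (cmod_re _) _.
  by rewrite cmodM cu mul1r.
Qed.

Lemma cint_bound f a b (M : R) : ccont f -> a <= b ->
  (forall t, a <= t <= b -> cmod (f t) <= M) -> cmod (cint f a b) <= M * (b - a).
Proof.
move=> cf ab fM; apply: le_trans (cmod_cint _ _ cf) _; rewrite -rint_cst //.
by apply: rint_le => //; [exact: ccont_cmod|exact: rcont_cst].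
Qed.

(** Velocity of a curve in C. The error form matches [cdiff], so that the chain rule for a
    holomorphic function along a curve is a direct estimate. *)
Definition rcdiff f t (v : C) := forall e : R, 0 < e -> exists2 r : R, 0 < r &
  forall h, `|h| < r -> cmod (f (t + h) - f t - v * rc h) <= e * `|h|.

Lemma rcdiffP f t v : rcdiff f t v <->
  is_derive t (1 : R) (fun x => cre (f x)) (cre v) /\
  is_derive t (1 : R) (fun x => cim (f x)) (cim v).
Proof.
rewrite !is_derive_epsP; split=> [H|[H1 H2] e e0].
  split=> e e0; have [r r0 Hr] := H e e0; exists r => // h hr.
    apply: le_trans (Hr h hr); apply: le_trans (cmod_re _); rewrite !cpartsE.
    by rewrite mulr0 subr0.
  apply: le_trans (Hr h hr); apply: le_trans (cmod_im _); rewrite !cpartsE.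
  by rewrite mulr0 add0r.
have e2 : 0 < e / 2 by rewrite divr_gt0.
have [r r0 Hr] := H1 _ e2; have [s s0 Hs] := H2 _ e2.
exists (Num.min r s); first by rewrite lt_min r0.
move=> h; rewrite lt_min => /andP[hr hs].
apply: le_trans (cmod_le _) _; rewrite !cpartsE mulr0 subr0 mulr0 add0r.
by rewrite [e in leRHS]splitr mulrDl; apply: lerD; [exact: Hr|exact: Hs].
Qed.

Lemma rcdiff_cont f : (forall t, exists v, rcdiff f t v) -> ccont f.
Proof.
move=> df; split=> t; have [v /rcdiffP[d1 d2]] := df t.
  by apply: differentiable_continuous; apply/derivable1_diffP; case: d1.
by apply: differentiable_continuous; apply/derivable1_diffP; case: d2.
Qed.

Lemma cint_FTC (F f : R -> C) a b : a <= b -> ccont f ->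
  (forall t, rcdiff F t (f t)) -> cint f a b = F b - F a.
Proof.
move=> ab [c1 c2] dF; apply: cplx_ext; rewrite !cpartsE !(cre_cint, cim_cint).
  by apply: (rint_FTC (F := fun t => cre (F t))) => // t; case/rcdiffP: (dF t).
by apply: (rint_FTC (F := fun t => cim (F t))) => // t; case/rcdiffP: (dF t).
Qed.

Lemma rcdiff_comp (F : C -> C) f t v d : cdiff F (f t) d -> rcdiff f t v ->
  rcdiff (fun x => F (f x)) t (d * v).
Proof.
move=> dF df e e0.
have D0 : 0 < cmod v + 1 by rewrite ltr_wpDl // cmod_ge0.
have E0 : 0 < cmod d + 1 by rewrite ltr_wpDl // cmod_ge0.
have e1 : 0 < e / 2 / (cmod v + 1) by rewrite !divr_gt0.
(* The cap 1 also yields |k| <= (|v| + 1) |h| for the increment k of f, which is what the expansion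
   of F needs; each of the two errors then receives e / 2. *)
have e2 : 0 < Num.min 1 (e / 2 / (cmod d + 1)) by rewrite lt_min ltr01 !divr_gt0.
have [r r0 Hr] := dF _ e1; have [s s0 Hs] := df _ e2.
exists (Num.min s (r / (cmod v + 1))); first by rewrite lt_min s0 divr_gt0.
move=> h; rewrite lt_min => /andP[hs hr].
pose k := f (t + h) - f t.
have Hk := Hs h hs; rewrite -/k in Hk.
have kb : cmod k <= (cmod v + 1) * `|h|.
  have -> : k = (k - v * rc h) + v * rc h by rewrite subrK.
  apply: le_trans (cmodD _ _) _; rewrite cmodM cmod_rc mulrDl mul1r addrC lerD2l.
  apply: le_trans Hk _; rewrite -[leRHS]mul1r; apply: ler_wpM2r => //.
  by rewrite ge_min lexx.
have kr : cmod k < r.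
  by apply: le_lt_trans kb _; rewrite mulrC -ltr_pdivlMr.
have := Hr k kr; rewrite {1}/k (addrC (f t)) subrK => H1.
have -> : F (f (t + h)) - F (f t) - d * v * rc h =
  (F (f (t + h)) - F (f t) - d * k) + d * (k - v * rc h) by ring.
apply: le_trans (cmodD _ _) _; rewrite cmodM [e in leRHS]splitr mulrDl; apply: lerD.
  apply: le_trans H1 _; apply: (@le_trans _ _ (e / 2 / (cmod v + 1) * ((cmod v + 1) * `|h|))).
    by apply: ler_wpM2l => //; exact: ltW.
  by rewrite mulrA divfK // gt_eqF.
apply: (@le_trans _ _ ((cmod d + 1) * (e / 2 / (cmod d + 1) * `|h|))).
  apply: ler_pM; rewrite ?cmod_ge0 //; first by rewrite lerDl.
  apply: le_trans Hk _; apply: ler_wpM2r => //.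
  by rewrite ge_min lexx orbT.
by rewrite mulrA (mulrC (cmod d + 1)) divfK // gt_eqF.
Qed.

Lemma rcdiff_cst (c : C) t : rcdiff (fun=> c) t 0.
Proof. by apply/rcdiffP; split; exact: is_derive_cst. Qed.
Lemma rcdiff_rc (u : R -> R) t d : is_derive t (1 : R) u d -> rcdiff (fun x => rc (u x)) t (rc d).
Proof. by move=> du; apply/rcdiffP; split => //; exact: is_derive_cst. Qed.
Lemma rcdiffD f g t v w : rcdiff f t v -> rcdiff g t w ->
  rcdiff (fun x => f x + g x) t (v + w).
Proof.
move=> /rcdiffP[f1 f2] /rcdiffP[g1 g2]; apply/rcdiffP; rewrite !cpartsE; split.
  by under eq_fun do rewrite creD; exact: is_deriveD.
by under eq_fun do rewrite cimD; exact: is_deriveD.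
Qed.
Lemma rcdiffM f g t v w : rcdiff f t v -> rcdiff g t w ->
  rcdiff (fun x => f x * g x) t (f t * w + g t * v).
Proof.
move=> /rcdiffP[f1 f2] /rcdiffP[g1 g2]; apply/rcdiffP; rewrite !cpartsE; split.
  under eq_fun do rewrite creM.
  have := is_deriveB (is_deriveM f1 g1) (is_deriveM f2 g2).
  by move=> /is_derive_eq; apply; rewrite /GRing.scale /=; ring.
under eq_fun do rewrite cimM.
have := is_deriveD (is_deriveM f1 g2) (is_deriveM f2 g1).
by move=> /is_derive_eq; apply; rewrite /GRing.scale /=; ring.
Qed.
Lemma rcdiff_eq f t v w : v = w -> rcdiff f t v -> rcdiff f t w.
Proof. by move=> ->. Qed.

Definition cis (t : R) : C := Complex (cos t) (sin t).
Lemma rcdiff_cis t : rcdiff cis t (ci R * cis t).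
Proof.
apply/rcdiffP; rewrite !cpartsE /cis /cre /cim /= !mul0r !mul1r sub0r add0r.
by split; [exact: is_derive_cos|exact: is_derive_sin].
Qed.
Lemma cmod_cis t : cmod (cis t) = 1.
Proof. by rewrite cmodE /cis /cre /cim /= cos2Dsin2 sqrtr1. Qed.
Lemma cis_2pi : cis (2 * pi) = cis 0.
Proof. by rewrite /cis mulr_natl cos2pi sin2pi cos0 sin0. Qed.
Lemma circle_ptE (r t : R) : circle_pt r t = rc r * cis t.
Proof. by apply: cplx_ext; rewrite !cpartsE /cre /cim /=; ring. Qed.
End ComplexIntegral.

(** * Invariance of integrals along a homotopy of circles *)

Section Dyadic.
Variable R : realType.
Implicit Types (n : nat) (x y a b : R).

Local Notation dy n := ((2 : R)^-1 ^+ n).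

Lemma dyS n : dy n = dy n.+1 + dy n.+1.
Proof. rewrite exprS; lra. Qed.
Lemma dy_gt0 n : 0 < dy n.
Proof. by rewrite exprn_gt0 // invr_gt0. Qed.
Lemma dy_small e : 0 < e -> exists N, forall n, (N <= n)%N -> dy n < e.
Proof.
move=> e0; have := @cvg_expr R 2^-1.
have -> : `|2^-1 : R| < 1 by rewrite ger0_norm ?invr_ge0 // invf_lt1 // ltr1n.
move=> /(_ isT) /cvgrPdist_lt/(_ e e0)[N _ HN]; exists N => n Nn.
by have := HN n Nn; rewrite /= sub0r normrN ger0_norm // ltW // dy_gt0.
Qed.

Section Induction.
Variable P : nat -> R -> R -> Prop.
Let inside n x := 0 <= x /\ x + dy n <= 1.
Hypothesis merge : forall n x y, inside n x -> inside n y ->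
  P n.+1 x y -> P n.+1 (x + dy n.+1) y -> P n.+1 x (y + dy n.+1) ->
  P n.+1 (x + dy n.+1) (y + dy n.+1) -> P n x y.
Hypothesis loc : forall a b, 0 <= a <= 1 -> 0 <= b <= 1 ->
  exists N, forall n x y, (N <= n)%N -> inside n x -> inside n y ->
    x <= a <= x + dy n -> y <= b <= y + dy n -> P n x y.

(** Passes to the first quarter of the square q on which P fails. In the last branch the failure
    follows from [merge], the other three quarters being good. *)
Let step n (q : R * R) : R * R :=
  let h := dy n.+1 in
  if ~~ `[< P n.+1 q.1 q.2 >] then q
  else if ~~ `[< P n.+1 (q.1 + h) q.2 >] then (q.1 + h, q.2)
  else if ~~ `[< P n.+1 q.1 (q.2 + h) >] then (q.1, q.2 + h)
  else (q.1 + h, q.2 + h).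

Fixpoint bad_square n : R * R :=
  if n is m.+1 then step m (bad_square m) else (0, 0).

(** Nested intervals: the left ends increase and the right ends decrease, so the supremum of the
    left ends lies in all of them. It is applied to each coordinate of the squares separately. *)
Lemma dyadic_limit (u : nat -> R) : u 0%N = 0 ->
  (forall n, u n.+1 = u n \/ u n.+1 = u n + dy n.+1) ->
  (forall n, inside n (u n)) /\
  exists2 a, 0 <= a <= 1 & forall n, u n <= a <= u n + dy n.
Proof.
move=> u0 uS.
have um n m : (n <= m)%N -> u n <= u m /\ u m + dy m <= u n + dy n.
  elim: m => [|m IH]; first by rewrite leqn0 => /eqP ->.
  rewrite leq_eqVlt => /predU1P[->//|nm]; have [h1 h2] := IH nm.
  have := dy_gt0 m.+1; rewrite (dyS m) in h2; case: (uS m) => ->; move: h1 h2.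
    by move=> *; split; lra.
  by move=> *; split; lra.
have ui n : inside n (u n).
  have [] := um 0%N n (leq0n n); rewrite u0 expr0 add0r => *; by split.
split => //.
have ub N : ubound (range u) (u N + dy N).
  move=> _ [m _ <-]; have [Nm|mN] := leqP N m.
    by have [_ h] := um _ _ Nm; apply: le_trans h; rewrite lerDl ltW // dy_gt0.
  have [h _] := um _ _ (ltnW mN); apply: (le_trans h).
  by rewrite lerDl ltW // dy_gt0.
have hs : has_sup (range u) by split; [exists (u 0%N); exists 0%N|exists (u 0%N + dy 0); exact: ub].
have key n : u n <= sup (range u) <= u n + dy n.
  apply/andP; split; first by apply: sup_upper_bound => //; exists n.
  by apply: sup_le_ub; [case: hs|exact: ub].
exists (sup (range u)) => //.
by have := key 0%N; rewrite u0 add0r expr0.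
Qed.

(** Goursat's bisection as an induction principle, P n x y being a property of the square of side
    2^-n with lower left corner (x, y). If the unit square were bad, nested bad squares would shrink
    to a point (a, b), around which [loc] makes all small squares good. *)
Lemma dyadic_ind : P 0%N 0 0.
Proof.
apply: contrapT => nP.
have stepx n : (bad_square n.+1).1 = (bad_square n).1 \/
    (bad_square n.+1).1 = (bad_square n).1 + dy n.+1.
  by rewrite /= /step; do ![case: ifP => _ /=]; [left|right|left|right].
have stepy n : (bad_square n.+1).2 = (bad_square n).2 \/
    (bad_square n.+1).2 = (bad_square n).2 + dy n.+1.
  by rewrite /= /step; do ![case: ifP => _ /=]; [left|left|right|right].
have [ux [a a01 ha]] := dyadic_limit (u := fun n => (bad_square n).1) erefl stepx.
have [uy [b b01 hb]] := dyadic_limit (u := fun n => (bad_square n).2) erefl stepy.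
have bad n : ~ P n (bad_square n).1 (bad_square n).2.
  elim: n => [//|n IH] /=; rewrite /step.
  case: asboolP => //= P1; case: asboolP => //= P2; case: asboolP => //= P3 P4.
  exact: IH (merge (ux n) (uy n) P1 P2 P3 P4).
have [N HN] := loc a01 b01.
by apply: (bad N); apply: HN.
Qed.
End Induction.
End Dyadic.

Section FourTerms.
Variable R : realType.
(** The four inner half-edges k1, k2, m1, m2 of a subdivided square are each traversed twice, in
    opposite directions. *)
Lemma four_squares (a1 a2 b1 b2 c1 c2 d1 d2 k1 k2 m1 m2 : Cplx R) :
  (a1 + a2) + (b1 + b2) - (c1 + c2) - (d1 + d2) =
  (a1 + m1 - k1 - d1) + (a2 + b1 - k2 - m1) + (k1 + m2 - c1 - d2)
  + (k2 + b2 - c2 - m2).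
Proof. ring. Qed.
Lemma cmod_add4 (a b c d : Cplx R) (K : R) : cmod a <= K -> cmod b <= K ->
  cmod c <= K -> cmod d <= K -> cmod (a + b + c + d) <= 4 * K.
Proof.
move=> ha hb hc hd; have := cmodD (a + b + c) d; have := cmodD (a + b) c.
have := cmodD a b; lra.
Qed.
End FourTerms.

Section Goursat.
Variable R : realType.
Local Notation C := (Cplx R).
Local Notation dy n := ((2 : R)^-1 ^+ n).

(** With the unit circle parametrised by [0, 1], means over circles are integrals without a factor 1
    / (2 pi). *)
Definition cic (y : R) : C := cis (2 * pi * y).
Lemma rcdiff_cic y : rcdiff cic y (ci R * rc (2 * pi) * cic y).
Proof.
have D : is_derive y (1 : R) (fun t : R => 2 * pi * t) (2 * pi).
  have := is_deriveZ (2 * pi : R) (is_derive_id y (1 : R)).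
  by rewrite /GRing.scale /= mulr1.
have /rcdiffP[d1 d2] := rcdiff_cis (2 * pi * y : R).
apply/rcdiffP; rewrite /cic; split.
  have := @is_derive1_comp R _ _ _ _ _ d1 D; move=> /is_derive_eq; apply.
  by rewrite !cpartsE; ring.
have := @is_derive1_comp R _ _ _ _ _ d2 D; move=> /is_derive_eq; apply.
by rewrite !cpartsE; ring.
Qed.
Lemma ccont_cic : ccont cic.
Proof. by apply: rcdiff_cont => y; eexists; exact: rcdiff_cic. Qed.
Lemma cmod_cic y : cmod (cic y) = 1. Proof. exact: cmod_cis. Qed.
Lemma cic1 : cic 1 = cic 0.
Proof. by rewrite /cic mulr1 mulr0 cis_2pi. Qed.
Lemma cic_lip x y : cmod (cic x - cic y) <= 2 * pi * `|x - y|.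
Proof.
wlog xy : x y / y <= x => [H|].
  have [/H //|/ltW/H] := leP y x.
  by rewrite cmodBC (distrC x).
have c : ccont (fun t => ci R * rc (2 * pi) * cic t).
  by apply: ccontM; [exact: ccont_cst|exact: ccont_cic].
rewrite -(cint_FTC xy c rcdiff_cic) (ger0_norm (_ : 0 <= x - y)) ?subr_ge0 //.
apply: cint_bound => // t _.
rewrite !cmodM cmod_ci cmod_cic cmod_rc mul1r mulr1 ger0_norm //.
by rewrite mulr_ge0 // pi_ge0.
Qed.

Variables (F : C -> C) (w : C) (rho eps : R).
(** Linear homotopy from the circle |z| = rho (x = 0) to the circle of radius eps about w (x = 1);
    every intermediate curve is a circle with centre x w. The functions [gx] and [gy] are its two
    partial derivatives. *)
Definition homot (x y : R) : C := rc x * w + rc (rho + x * (eps - rho)) * cic y.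
Let gx (y : R) : C := w + rc (eps - rho) * cic y.
Let gy (x y : R) : C := rc (rho + x * (eps - rho)) * (ci R * rc (2 * pi) * cic y).
Hypothesis dF : forall x y : R, 0 <= x <= 1 -> cderivable F (homot x y).

(** Projection of the line onto [0, 1]. F is differentiable only along the homotopy with 0 <= x <=
    1, whereas integrands must be continuous for all x. *)
Let cl (x : R) : R := (`|x| - `|x - 1| + 1) / 2.
Let cl01 x : 0 <= cl x <= 1.
Proof.
have := ler_dist_dist x (x - 1); have -> : x - (x - 1) = 1 by ring.
rewrite normr1 ler_norml /cl => /andP[? ?].
by apply/andP; split; lra.
Qed.
Let cl_id (x : R) : 0 <= x <= 1 -> cl x = x.
Proof.
move=> /andP[? ?]; rewrite /cl distrC !ger0_norm ?subr_ge0 //; lra.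
Qed.
Let rcont_cl : rcont cl.
Proof.
apply: rcontM; last exact: rcont_cst.
apply: rcontD; last exact: rcont_cst.
apply: rcontB; apply: rcont_norm => //; first exact: rcont_id.
by apply: rcontB; [exact: rcont_id|exact: rcont_cst].
Qed.

Let dgx x y : rcdiff (fun t => homot t y) x (gx y).
Proof.
have D1 : is_derive x (1 : R) (fun t : R => rho + t * (eps - rho)) (eps - rho).
  have := is_deriveD (is_derive_cst rho x (1:R))
    (is_deriveM (is_derive_id x (1:R)) (is_derive_cst (eps - rho) x (1:R))).
  move=> /is_derive_eq; apply; rewrite /GRing.scale /=; ring.
have := rcdiffD (rcdiffM (rcdiff_rc (is_derive_id x (1:R))) (rcdiff_cst w x))
  (rcdiffM (rcdiff_rc D1) (rcdiff_cst (cic y) x)).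
apply: rcdiff_eq; rewrite /gx rc1; ring.
Qed.
Let dgy x y : rcdiff (fun t => homot x t) y (gy x y).
Proof.
have := rcdiffD (rcdiff_cst (rc x * w) y)
  (rcdiffM (rcdiff_cst (rc (rho + x * (eps - rho))) y) (rcdiff_cic y)).
apply: rcdiff_eq; rewrite /gy; ring.
Qed.
Let ccont_homotx y : ccont (fun x => homot x y).
Proof. by apply: rcdiff_cont => x; eexists; exact: dgx. Qed.
Let ccont_homoty x : ccont (fun y => homot x y).
Proof. by apply: rcdiff_cont => y; eexists; exact: dgy. Qed.
Let ccont_gy x : ccont (gy x).
Proof.
apply: ccontM; first exact: ccont_cst.
by apply: ccontM; [exact: ccont_cst|exact: ccont_cic].
Qed.

(** [Hs] and [Vs] integrate G dz along the images of a horizontal and a vertical side; [J] is the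
    integral along the positively oriented image of the boundary of a dyadic square. *)
Let Hs (G : C -> C) y x0 x1 := cint (fun x => G (homot (cl x) y) * gx y) x0 x1.
Let Vs (G : C -> C) x y0 y1 := cint (fun y => G (homot (cl x) y) * gy (cl x) y) y0 y1.
Let J G n x y := Hs G y x (x + dy n) + Vs G (x + dy n) y (y + dy n)
  - Hs G (y + dy n) x (x + dy n) - Vs G x y (y + dy n).

Let good (G : C -> C) := forall x y : R, 0 <= x <= 1 -> ccont_at G (homot x y).
Let cH G y : good G -> ccont (fun x => G (homot (cl x) y) * gx y).
Proof.
move=> gG; apply: ccontM; last exact: ccont_cst.
apply: (ccont_comp (F := G)) => [|t]; last exact: gG.
exact: (ccont_reparam (ccont_homotx y)).
Qed.
Let cV G x : good G -> ccont (fun y => G (homot (cl x) y) * gy (cl x) y).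
Proof.
move=> gG; apply: ccontM; last exact: ccont_gy.
by apply: (ccont_comp (F := G)) => [|t]; [exact: ccont_homoty|exact: gG].
Qed.

Let J_split G n x y : good G -> J G n x y = J G n.+1 x y + J G n.+1 (x + dy n.+1) y
  + J G n.+1 x (y + dy n.+1) + J G n.+1 (x + dy n.+1) (y + dy n.+1).
Proof.
move=> gG; rewrite /J (dyS R n); set h := dy n.+1.
have h0 : 0 < h by exact: dy_gt0.
rewrite (addrA x) (addrA y).
have HH z : Hs G z x (x + h + h) = Hs G z x (x + h) + Hs G z (x + h) (x + h + h).
  by apply: cint_cat; [exact: cH|lra|lra].
have VV z : Vs G z y (y + h + h) = Vs G z y (y + h) + Vs G z (y + h) (y + h + h).
  by apply: cint_cat; [exact: cV|lra|lra].
rewrite !HH !VV; exact: four_squares.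
Qed.

Let JD G1 G2 n x y : good G1 -> good G2 ->
  J (fun z => G1 z + G2 z) n x y = J G1 n x y + J G2 n x y.
Proof.
move=> g1 g2; rewrite /J.
have HD a b c : Hs (fun z => G1 z + G2 z) a b c = Hs G1 a b c + Hs G2 a b c.
  rewrite /Hs -cintD; try exact: cH.
  by congr cint; apply/funext => t; rewrite mulrDl.
have VD a b c : Vs (fun z => G1 z + G2 z) a b c = Vs G1 a b c + Vs G2 a b c.
  rewrite /Vs -cintD; try exact: cV.
  by congr cint; apply/funext => t; rewrite mulrDl.
rewrite !HD !VD; clear HD VD.
move: (Hs G1) (Vs G1) (Hs G2) (Vs G2) => HG1 VG1 HG2 VG2; ring.
Qed.

(** An affine function has the primitive [Phi], so each side contributes a difference of corner
    values and these telescope. *)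
Let J_affine (al be : C) n (x y : R) : 0 <= x -> x + dy n <= 1 ->
  J (fun z => al + be * z) n x y = 0.
Proof.
move=> x0 x1; have h0 : 0 < dy n by exact: dy_gt0.
pose Phi (z : C) := al * z + be / 2 * z * z.
have dPhi z : cdiff Phi z (al + be * z).
  have := cdiffD (cdiffM (cdiff_cst al z) (cdiff_id z))
    (cdiffM (cdiffM (cdiff_cst (be / 2) z) (cdiff_id z)) (cdiff_id z)).
  apply: cdiff_eq; rewrite /=; field => //.
have HE u : Hs (fun z => al + be * z) u x (x + dy n) = Phi (homot (x + dy n) u) - Phi (homot x u).
  rewrite -(@cint_FTC R (fun t => Phi (homot t u)) (fun t => (al + be * homot t u) * gx u)).
  - by apply: cint_eq => t tx; rewrite cl_id //; lra.
  - lra.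
  - apply: ccontM; last exact: ccont_cst.
    apply: ccontD; first exact: ccont_cst.
    by apply: ccontM; [exact: ccont_cst|exact: ccont_homotx].
  - by move=> t; apply: (rcdiff_comp (F := Phi)); [exact: dPhi|exact: dgx].
have VE (u : R) : 0 <= u <= 1 -> Vs (fun z => al + be * z) u y (y + dy n) =
    Phi (homot u (y + dy n)) - Phi (homot u y).
  move=> u01; rewrite /Vs cl_id //.
  rewrite -(@cint_FTC R (fun t => Phi (homot u t)) (fun t => (al + be * homot u t) * gy u t)) //.
  - lra.
  - apply: ccontM; last exact: ccont_gy.
    apply: ccontD; first exact: ccont_cst.
    by apply: ccontM; [exact: ccont_cst|exact: ccont_homoty].
  - by move=> t; apply: (rcdiff_comp (F := Phi)); [exact: dPhi|exact: dgy].
rewrite /J !HE (VE x) ?(VE (x + dy n)); [ring|lra|lra].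
Qed.

(** One constant that bounds both partial derivatives and serves as a Lipschitz constant for
    [homot]; the final 1 makes it positive. *)
Let L := cmod w + `|rho| + `|eps - rho| + 2 * pi * (`|rho| + `|eps - rho|) + 1.
Let L0 : 0 < L.
Proof.
have h1 := cmod_ge0 w; have h2 := normr_ge0 rho; have h3 := normr_ge0 (eps - rho).
have h4 : 0 <= 2 * pi * (`|rho| + `|eps - rho|).
  by rewrite mulr_ge0 ?addr_ge0 // mulr_ge0 // pi_ge0.
rewrite /L; lra.
Qed.
Let gx_le y : cmod (gx y) <= L.
Proof.
apply: le_trans (cmodD _ _) _; rewrite cmodM cmod_cic cmod_rc mulr1.
have h2 := normr_ge0 rho; have h3 := normr_ge0 (eps - rho).
have h4 : 0 <= 2 * pi * (`|rho| + `|eps - rho|).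
  by rewrite mulr_ge0 ?addr_ge0 // mulr_ge0 // pi_ge0.
rewrite /L; lra.
Qed.
Let rad_le (x : R) : 0 <= x <= 1 -> `|rho + x * (eps - rho)| <= `|rho| + `|eps - rho|.
Proof.
move=> /andP[x0 x1]; apply: le_trans (ler_normD _ _) _; rewrite lerD2l normrM.
by rewrite ger0_norm // ler_piMl.
Qed.
Let gy_le (x y : R) : 0 <= x <= 1 -> cmod (gy x y) <= L.
Proof.
move=> x01; rewrite /gy !cmodM cmod_cic cmod_ci mul1r mulr1 !cmod_rc.
rewrite (ger0_norm (_ : 0 <= 2 * pi)) ?mulr_ge0 ?pi_ge0 // mulrC.
apply: (@le_trans _ _ (2 * pi * (`|rho| + `|eps - rho|))).
  by apply: ler_wpM2l; rewrite ?mulr_ge0 ?pi_ge0 ?rad_le.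
have h1 := cmod_ge0 w; have h2 := normr_ge0 rho; have h3 := normr_ge0 (eps - rho).
rewrite /L; lra.
Qed.
Let homot_lip (a b x y : R) : 0 <= a <= 1 -> 0 <= x <= 1 ->
  cmod (homot x y - homot a b) <= L * (`|x - a| + `|y - b|).
Proof.
move=> a01 x01.
have -> : homot x y - homot a b = rc (x - a) * gx y +
    rc (rho + a * (eps - rho)) * (cic y - cic b).
  rewrite /homot /gx; apply: cplx_ext; rewrite !cpartsE; ring.
apply: le_trans (cmodD _ _) _; rewrite !cmodM !cmod_rc [leRHS]mulrDr; apply: lerD.
  by rewrite mulrC; apply: ler_wpM2r; rewrite ?gx_le.
apply: (@le_trans _ _ ((`|rho| + `|eps - rho|) * (2 * pi * `|y - b|))).
  by apply: ler_pM; rewrite ?cmod_ge0 ?rad_le ?cic_lip.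
rewrite mulrA; apply: ler_wpM2r => //.
rewrite (mulrC (_ + _)).
have h1 := cmod_ge0 w; have h2 := normr_ge0 rho; have h3 := normr_ge0 (eps - rho).
rewrite /L; lra.
Qed.

Let J_bound G n (x y M : R) : good G -> 0 <= x -> x + dy n <= 1 -> 0 <= M ->
  (forall u v, x <= u <= x + dy n -> y <= v <= y + dy n -> cmod (G (homot u v)) <= M) ->
  cmod (J G n x y) <= 4 * (M * L * dy n).
Proof.
move=> gG x0 x1 M0 GM; have h0 : 0 < dy n by exact: dy_gt0.
have HB v : y <= v <= y + dy n -> cmod (Hs G v x (x + dy n)) <= M * L * dy n.
  move=> vy; have {2}-> : dy n = x + dy n - x by ring.
  apply: cint_bound; [exact: cH|lra|] => t tx.
  rewrite cmodM; apply: ler_pM; rewrite ?cmod_ge0 // cl_id; last by lra.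
  exact: GM.
have VB u : x <= u <= x + dy n -> cmod (Vs G u y (y + dy n)) <= M * L * dy n.
  move=> ux; have {2}-> : dy n = y + dy n - y by ring.
  apply: cint_bound; [exact: cV|lra|] => t ty.
  rewrite cmodM; apply: ler_pM; rewrite ?cmod_ge0 ?gy_le // cl_id; last by lra.
  exact: GM.
have hy0 : y <= y <= y + dy n by rewrite lexx lerDl ltW.
have hy1 : y <= y + dy n <= y + dy n by rewrite lexx lerDl ltW.
have hx0 : x <= x <= x + dy n by rewrite lexx lerDl ltW.
have hx1 : x <= x + dy n <= x + dy n by rewrite lexx lerDl ltW.
have B1 := HB y hy0; have B2 := VB (x + dy n) hx1.
have B3 := HB (y + dy n) hy1; have B4 := VB x hx0.
rewrite -cmodN in B3; rewrite -cmodN in B4.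
exact: cmod_add4.
Qed.

Let goodF : good F.
Proof. by move=> x y x01; have [d /cdiff_cont] := dF y x01. Qed.

(** A bound by e times the area adds up exactly over four quarters, so [dyadic_ind] reduces it to
    small squares. Near p, F differs from an affine function, whose boundary integral is 0, by a
    small multiple of |z - p|. *)
Lemma goursat_small (e : R) : 0 < e -> cmod (J F 0 0 0) <= e * dy 0 ^+ 2.
Proof.
move=> e0; apply: (@dyadic_ind _ (fun n x y => cmod (J F n x y) <= e * dy n ^+ 2)).
  move=> n x y _ _ h1 h2 h3 h4; rewrite J_split // (dyS R n).
  apply: le_trans (cmod_add4 h1 h2 h3 h4) _.
  by rewrite le_eqVlt; apply/orP; left; apply/eqP; ring.
move=> a b a01 b01; have [d dFp] := dF b a01; set p := homot a b in dFp.
(* The image of the square lies within 2 L 2^-n of p and each of its sides has length at most L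
   2^-n: 4 e1 (2 L 2^-n) (L 2^-n) = e 4^-n. *)
have e1 : 0 < e / (8 * L ^+ 2) by rewrite divr_gt0 // mulr_gt0 // exprn_gt0.
have [r r0 Hr] := dFp _ e1.
have [N HN] := @dy_small R (r / (2 * L)) ltac:(by rewrite divr_gt0 // mulr_gt0).
exists N => n x y Nn [x0 x1] [y0 y1] ax bY.
have h0 : 0 < dy n by exact: dy_gt0.
have hr : 2 * L * dy n < r.
  by have := HN n Nn; rewrite ltr_pdivlMr ?mulr_gt0 // mulrC.
pose G1 (z : C) := (F p - d * p) + d * z; pose G2 (z : C) := F z - G1 z.
have g1 : good G1.
  move=> u v _; apply: (@cdiff_cont _ _ _ d).
  have := cdiffD (cdiff_cst (F p - d * p) (homot u v))
    (cdiffM (cdiff_cst d (homot u v)) (cdiff_id (homot u v))).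
  apply: cdiff_eq; rewrite /=; ring.
have g2 : good G2.
  move=> u v u01; have [d' dF'] := dF v u01.
  have dG1 : cdiff G1 (homot u v) d.
    have := cdiffD (cdiff_cst (F p - d * p) (homot u v))
      (cdiffM (cdiff_cst d (homot u v)) (cdiff_id (homot u v))).
    apply: cdiff_eq; rewrite /=; ring.
  exact: cdiff_cont (cdiffB dF' dG1).
have -> : J F n x y = J (fun z => G1 z + G2 z) n x y.
  by congr (J _ n x y); apply/funext => z; rewrite /G2 addrC subrK.
rewrite JD // /G1 J_affine // add0r.
have M0 : 0 <= e / (8 * L ^+ 2) * (2 * L * dy n).
  by apply: mulr_ge0; [exact: ltW|rewrite !mulr_ge0 // ltW].
apply: le_trans (J_bound g2 x0 x1 M0 _) _.
  move=> u v ux vy; have u01 : 0 <= u <= 1 by lra.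
  have := homot_lip b v a01 u01; rewrite -/p => Hl.
  have Hb : cmod (homot u v - p) <= 2 * L * dy n.
    apply: le_trans Hl _; rewrite (mulrC 2) -mulrA; apply: ler_wpM2l; first exact: ltW.
    have : `|u - a| <= dy n by rewrite ler_norml; lra.
    have : `|v - b| <= dy n by rewrite ler_norml; lra.
    lra.
  have := Hr (homot u v - p) (le_lt_trans Hb hr); rewrite (addrC p) subrK => H.
  apply: (@le_trans _ _ (e / (8 * L ^+ 2) * cmod (homot u v - p))).
    rewrite /G2 /G1; apply: le_trans H; rewrite le_eqVlt; apply/orP; left; apply/eqP.
    congr cmod; ring.
  by apply: ler_wpM2l => //; exact: ltW.
rewrite le_eqVlt; apply/orP; left; apply/eqP; field.
exact: lt0r_neq0.
Qed.

(** The boundary integral over the unit square vanishes, being smaller than every e > 0. Its sides y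
    = 0 and y = 1 cancel because the curves are closed; the other two sides are 2 pi i times the two
    members. *)
Lemma homotopy_invariance :
  cint (fun y => F (homot 1 y) * (rc eps * cic y)) 0 1 =
  cint (fun y => F (homot 0 y) * (rc rho * cic y)) 0 1.
Proof.
have J0 : J F 0 0 0 = 0.
  apply/eqP; rewrite -cmod_eq0 eq_le cmod_ge0 andbT.
  apply/ler_addgt0Pr => e e0; rewrite add0r.
  by have := goursat_small e0; rewrite expr0 expr1n mulr1.
move: J0; rewrite /J expr0 !add0r.
have -> : Hs F 1 0 1 = Hs F 0 0 1.
  by apply: cint_eq => t _; rewrite /homot /gx cic1.
have E x : 0 <= x <= 1 -> Vs F x 0 1 = ci R * rc (2 * pi) *
   cint (fun y => F (homot x y) * (rc (rho + x * (eps - rho)) * cic y)) 0 1.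
  move=> x01; rewrite -cintZ.
    by apply: cint_eq => t _; rewrite cl_id // /gy; ring.
  apply: ccontM; last by apply: ccontM; [exact: ccont_cst|exact: ccont_cic].
  by apply: (ccont_comp (F := F)) => [|t]; [exact: ccont_homoty|exact: goodF].
rewrite !E ?lexx ?ler01 // mul0r addr0 mul1r (addrC rho) subrK.
set X := cint _ 0 1; set Y := cint _ 0 1 => H.
have K : ci R * rc (2 * pi) != 0.
  rewrite -cmod_eq0 cmodM cmod_ci mul1r cmod_rc normr_eq0 mulf_neq0 ?pnatr_eq0 //.
  by rewrite gt_eqF // pi_gt0.
apply: (mulfI K); apply/eqP; rewrite -subr_eq0; apply/eqP; rewrite -[RHS]H; ring.
Qed.
End Goursat.

(** * Cauchy formula, Taylor expansion, removable singularities *)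

Section Cauchy.
Variable R : realType.
Local Notation C := (Cplx R).
Implicit Types (f g : C -> C) (z w : C) (r rho M B e : R).

Definition circ (rho y : R) : C := rc rho * cic y.
Lemma cmod_circ rho y : 0 <= rho -> cmod (circ rho y) = rho.
Proof. by move=> r0; rewrite cmodM cmod_rc cmod_cic mulr1 ger0_norm. Qed.
Lemma ccont_circ rho : ccont (circ rho).
Proof. by apply: ccontM; [exact: ccont_cst|exact: ccont_cic]. Qed.
Lemma rcdiff_circ rho y : rcdiff (circ rho) y (ci R * rc (2 * pi) * circ rho y).
Proof.
have := rcdiffM (rcdiff_cst (rc rho) y) (rcdiff_cic y).
apply: rcdiff_eq; rewrite /circ; ring.
Qed.
Lemma circ_neq rho y w : cmod w < rho -> circ rho y - w != 0.
Proof.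
move=> wr; rewrite subr_eq0; apply/eqP => E.
have r0 : 0 <= rho by apply: le_trans (ltW wr); exact: cmod_ge0.
by move: wr; rewrite -E cmod_circ // ltxx.
Qed.

Lemma ccont_bounded (f : R -> C) a b : ccont f -> a <= b ->
  exists2 M, 0 <= M & forall t, a <= t <= b -> cmod (f t) <= M.
Proof.
move=> /ccont_cmod cf ab.
have [c _ Hc] := @EVT_max R (fun t => cmod (f t)) a b ab (continuous_subspaceT cf).
by exists (cmod (f c)); [exact: cmod_ge0|move=> t tab; apply: Hc; rewrite in_itv].
Qed.

Lemma ccont_on_circ f rho : 0 <= rho ->
  (forall z, cmod z <= rho -> cderivable f z) -> ccont (fun y => f (circ rho y)).
Proof.
move=> r0 df; apply: (ccont_comp (F := f)); first exact: ccont_circ.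
by move=> t; have [|d /cdiff_cont] := df (circ rho t); rewrite ?cmod_circ.
Qed.

(** The circle is deformed into a circle of radius t about w inside the punctured disc. There the
    kernel is 1 and the integral is the mean of f near w, within e of f(w) by continuity. *)
Lemma cauchy_formula f rho w : cmod w < rho ->
  (forall z, cmod z <= rho -> cderivable f z) ->
  cint (fun y => f (circ rho y) * (circ rho y / (circ rho y - w))) 0 1 = f w.
Proof.
move=> wr df; have r0 : 0 < rho by apply: le_lt_trans wr; exact: cmod_ge0.
apply/eqP; rewrite -subr_eq0 -cmod_eq0 eq_le cmod_ge0 andbT.
apply/ler_addgt0Pr => e e0; rewrite add0r.
have [dw dfw] := df w (ltW wr).
have [s s0 Hs] := cdiff_cont dfw e0.
pose t : R := Num.min (s / 2) (rho - cmod w).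
have t0 : 0 < t by rewrite lt_min divr_gt0 // subr_gt0.
have ts : t < s.
  by apply: (@le_lt_trans _ _ (s / 2)); [rewrite ge_min lexx|lra].
have tr : t <= rho - cmod w by rewrite ge_min lexx orbT.
(* The first bound is |w| + t <= rho multiplied by x; for the second, the distance to w is at least
   (1 - x) (rho - |w|) + x t. *)
have inD x y : 0 <= x <= 1 -> cmod (homot w rho t x y) <= rho /\ homot w rho t x y - w != 0.
  move=> /andP[x0 x1]; have c0 := cmod_ge0 w.
  have rp : 0 < rho + x * (t - rho) by nra.
  split.
    apply: le_trans (cmodD _ _) _; rewrite !cmodM !cmod_rc cmod_cic mulr1.
    rewrite !ger0_norm //; last exact: ltW.
    nra.
  rewrite -cmod_gt0.
  have -> : homot w rho t x y - w = rc (rho + x * (t - rho)) * cic y - rc (1 - x) * w.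
    by rewrite /homot (rcB 1) rc1; ring.
  apply: lt_le_trans (cmod_lerB _ _).
  rewrite !cmodM !cmod_rc cmod_cic mulr1 (ger0_norm (ltW rp)) ger0_norm ?subr_ge0 //.
  nra.
pose F z := f z / (z - w).
have dF x y : 0 <= x <= 1 -> cderivable F (homot w rho t x y).
  move=> x01; have [h1 h2] := inD x y x01; have [d fd] := df _ h1.
  eexists; apply: cdiffM fd (cdiffV (f := fun z => z - w) h2 _).
  exact: cdiffB (cdiff_id _) (cdiff_cst _ _).
have := homotopy_invariance dF; rewrite /F.
have -> : cint (fun y => f (homot w rho t 0 y) / (homot w rho t 0 y - w) * (rc rho * cic y)) 0 1
  = cint (fun y => f (circ rho y) * (circ rho y / (circ rho y - w))) 0 1.
  apply: cint_eq => y _; rewrite /homot mul0r mul0r add0r addr0 -/(circ rho y).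
  by rewrite mulrAC mulrA.
move=> <-.
have E y : f (homot w rho t 1 y) / (homot w rho t 1 y - w) * (rc t * cic y) = f (w + circ t y).
  rewrite /homot !mul1r (addrC rho) subrK -/(circ t y) (addrC w) addrK divfK //.
  rewrite -cmod_eq0 cmod_circ ?gt_eqF //; exact: ltW.
under eq_fun do rewrite E.
have -> : f w = cint (fun=> f w) 0 1 by rewrite cint_cst // subr0 mulr1.
have cfc : ccont (fun y => f (w + circ t y)).
  apply: (ccont_comp (F := f)).
    by apply: ccontD; [exact: ccont_cst|exact: ccont_circ].
  move=> y; have [|d /cdiff_cont //] := df (w + circ t y).
  by apply: le_trans (cmodD _ _) _; rewrite cmod_circ; lra.
rewrite -cintB //; last exact: ccont_cst.
rewrite -[e]mulr1 -[X in _ * X](subr0 1); apply: cint_bound => //.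
  by apply: ccontB => //; exact: ccont_cst.
move=> y _; apply: ltW; apply: Hs; rewrite addrC addKr cmod_circ //; exact: ltW.
Qed.

Lemma kernel_le rho y w : cmod w <= rho / 2 -> 0 < rho ->
  cmod (circ rho y / (circ rho y - w)) <= 2.
Proof.
move=> wr r0; have wr' : cmod w < rho by lra.
rewrite cmodM cmodV cmod_circ ?(ltW r0) // ler_pdivrMr; last first.
  by rewrite cmod_gt0 circ_neq.
have := cmod_lerB (circ rho y) w; rewrite cmod_circ ?(ltW r0) //; lra.
Qed.

(** The coefficients are Cauchy integrals, and the remainder is kept as an exact integral with the
    factor (w / c)^n in the kernel. The conclusion hides the coefficients: they are recovered from
    the estimate in [derive1n_expansion]. *)
Lemma taylor0 f rho M n : 0 < rho -> (forall z, cmod z <= rho -> cderivable f z) ->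
  (forall y, 0 <= y <= 1 -> cmod (f (circ rho y)) <= M) ->
  exists2 p : {poly C}, (size p <= n)%N & forall w, cmod w <= rho / 2 ->
    cmod (f w - p.[w]) <= 2 * M * (cmod w / rho) ^+ n.
Proof.
move=> r0 df fM; pose c j := cint (fun y => f (circ rho y) / circ rho y ^+ j) 0 1.
have cf := ccont_on_circ (ltW r0) df.
have ci0 y : circ rho y != 0 by rewrite -cmod_eq0 cmod_circ ?gt_eqF // ltW.
have cV j : ccont (fun y => (circ rho y ^+ j)^-1).
  apply: ccontV => [|t]; first by apply: ccontX; exact: ccont_circ.
  by rewrite expf_neq0.
have cK w : cmod w < rho -> ccont (fun y => circ rho y / (circ rho y - w)).
  move=> wr; apply: ccontM; first exact: ccont_circ.
  apply: ccontV => [|t]; last exact: circ_neq.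
  by apply: ccontB; [exact: ccont_circ|exact: ccont_cst].
pose I w j := cint (fun y => f (circ rho y) * ((w ^+ j / circ rho y ^+ j) *
   (circ rho y / (circ rho y - w)))) 0 1.
have cI w j : cmod w < rho -> ccont (fun y => f (circ rho y) *
   ((w ^+ j / circ rho y ^+ j) * (circ rho y / (circ rho y - w)))).
  move=> wr; apply: ccontM cf _; apply: ccontM; last exact: cK.
  by apply: ccontM; [exact: ccont_cst|exact: cV].
exists (\poly_(j < n) c j); first exact: size_poly.
move=> w wr2; have wr : cmod w < rho by lra.
have -> : f w - (\poly_(j < n) c j).[w] = I w n.
  rewrite horner_poly; elim: n => [|n IH].
    rewrite big_ord0 subr0 -(cauchy_formula wr df); apply: cint_eq => y _.
    by rewrite !expr0 divr1 mul1r.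
  (* One coefficient is split off by c / (c - w) = 1 + (w / c) (c / (c - w)). *)
  rewrite big_ord_recr /= opprD addrA IH; apply/eqP; rewrite subr_eq; apply/eqP.
  rewrite mulrC -cintZ; last by apply: ccontM.
  rewrite /I -cintD; [|exact: cI|by apply: ccontM; [exact: ccont_cst|apply: ccontM]].
  apply: cint_eq => y _; have h := circ_neq y wr; have h0 := ci0 y.
  rewrite !exprS; field; rewrite h h0 expf_neq0 //.
have -> : 2 * M * (cmod w / rho) ^+ n = (M * ((cmod w / rho) ^+ n * 2)) * (1 - 0) by ring.
apply: cint_bound => //; first exact: cI.
move=> y y01; rewrite cmodM; apply: ler_pM; rewrite ?cmod_ge0 ?fM //.
rewrite cmodM; apply: ler_pM; rewrite ?cmod_ge0 ?kernel_le //.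
by rewrite cmodM cmodV !cmodX cmod_circ ?(ltW r0) // -exprVn -exprMn.
Qed.

Lemma taylor f z0 rho M n : 0 < rho ->
  (forall z, cmod (z - z0) <= rho -> cderivable f z) ->
  (forall z, cmod (z - z0) <= rho -> cmod (f z) <= M) ->
  exists2 p : {poly C}, (size p <= n)%N & forall w, cmod w <= rho / 2 ->
    cmod (f (z0 + w) - p.[w]) <= 2 * M * (cmod w / rho) ^+ n.
Proof.
move=> r0 df fM; have [||p sp Hp] := @taylor0 (fun w => f (w + z0)) rho M n r0.
- move=> z zr; have [|d fd] := df (z + z0); first by rewrite addrK.
  by exists d; exact: cdiff_shift.
- by move=> y _; apply: fM; rewrite addrK cmod_circ // ltW.
- by exists p => // w wr; rewrite (addrC z0); exact: Hp.
Qed.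

Lemma taylor_ex f z0 rho n : 0 < rho ->
  (forall z, cmod (z - z0) <= rho -> cderivable f z) ->
  exists2 p : {poly C}, (size p <= n)%N & exists2 B, 0 <= B & forall w, cmod w <= rho / 2 ->
    cmod (f (z0 + w) - p.[w]) <= B * cmod w ^+ n.
Proof.
move=> r0 df; pose g w := f (w + z0).
have dg z : cmod z <= rho -> cderivable g z.
  move=> zr; have [|d fd] := df (z + z0); first by rewrite addrK.
  by exists d; exact: cdiff_shift.
have [M M0 HM] := ccont_bounded (ccont_on_circ (ltW r0) dg) ler01.
have [p sp Hp] := taylor0 n r0 dg HM.
exists p => //; exists (2 * M / rho ^+ n).
  by rewrite divr_ge0 ?mulr_ge0 // exprn_ge0 // ltW.
move=> w wr; rewrite (addrC z0); apply: le_trans (Hp w wr) _.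
by rewrite exprMn exprVn mulrA mulrAC.
Qed.

Lemma cdiff_bound f z d r B : 0 < r ->
  (forall h, cmod h <= r -> cmod (f (z + h) - f z) <= B * cmod h) ->
  cdiff f z d -> cmod d <= B.
Proof.
move=> r0 fB df; apply/ler_addgt0Pr => e e0; have [s s0 Hs] := df e e0.
pose t : R := Num.min r (s / 2).
have t0 : 0 < t by rewrite lt_min r0 divr_gt0.
have ts : t < s by apply: (@le_lt_trans _ _ (s / 2)); [rewrite ge_min lexx orbT|lra].
have ct : cmod (rc t) = t by rewrite cmod_rc ger0_norm // ltW.
have := Hs (rc t); have := fB (rc t); rewrite ct => /(_ _) H1 /(_ ts) H2.
have {}H1 := H1 ltac:(by rewrite ge_min lexx).
rewrite -(ler_pM2r t0); apply: (@le_trans _ _ (cmod (d * rc t))).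
  by rewrite cmodM ct.
have -> : d * rc t = (f (z + rc t) - f z) - (f (z + rc t) - f z - d * rc t) by ring.
by apply: le_trans (cmodB _ _) _; rewrite mulrDl; exact: lerD.
Qed.

Lemma cauchy_estimate f z0 rho M d : 0 < rho ->
  (forall z, cmod (z - z0) <= rho -> cderivable f z) ->
  (forall z, cmod (z - z0) <= rho -> cmod (f z) <= M) ->
  cdiff f z0 d -> cmod d <= 2 * M / rho.
Proof.
move=> r0 df fM dz; have [p sp Hp] := taylor 1 r0 df fM.
apply: (cdiff_bound (r := rho / 2) _ _ dz); first by rewrite divr_gt0.
move=> h hr; have E : p.[h] = f z0.
  have pc := size1_polyC sp; have := Hp 0; rewrite pc !hornerC cmod0 addr0 mul0r expr1 mulr0.
  move=> /(_ ltac:(lra)) H.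
  by apply/esym/eqP; rewrite -subr_eq0 -cmod_eq0 eq_le H cmod_ge0.
by have := Hp h hr; rewrite E expr1 mulrA mulrAC.
Qed.

Lemma cdiff_horner (p : {poly C}) z : cdiff (horner p) z p^`().[z].
Proof.
elim/poly_ind: p => [|p c IH].
  rewrite deriv0 horner0; apply: (@cdiff_ext _ (fun=> 0) _ _ _ 1) => //.
    by move=> w _; rewrite horner0.
  exact: cdiff_cst.
apply: (@cdiff_ext _ (fun w => p.[w] * w + c) _ _ _ 1) => //.
  by move=> w _; rewrite hornerMXaddC.
have := cdiffD (cdiffM IH (cdiff_id z)) (cdiff_cst c z).
apply: cdiff_eq; rewrite derivD derivM derivX derivC mulr1 addr0 !hornerE /=; ring.
Qed.

(** An expansion may be differentiated term by term: Cauchy's estimate is applied to f(z0 + u) -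
    p(u) on the disc of radius |w| about w, where |u| <= 2 |w|, which gives 2 B (2 |w|)^(n+1) / |w|.
    At w = 0 this disc degenerates and difference quotients are used. *)
Lemma deriv_expansion f z0 r (p : {poly C}) B n w d : 0 < r -> 0 <= B ->
  (forall z, cmod (z - z0) <= r -> cderivable f z) ->
  (forall w, cmod w <= r -> cmod (f (z0 + w) - p.[w]) <= B * cmod w ^+ n.+1) ->
  cmod w <= r / 2 -> cdiff f (z0 + w) d ->
  cmod (d - p^`().[w]) <= 2 ^+ n.+2 * B * cmod w ^+ n.
Proof.
move=> r0 B0 df fp wr dw.
pose g u := f (u + z0) - p.[u].
have dg u : cmod u <= r -> cderivable g u.
  move=> ur; have [|d' fd] := df (u + z0); first by rewrite addrK.
  by eexists; apply: cdiffB (cdiff_shift fd) (cdiff_horner p u).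
have dgw : cdiff g w (d - p^`().[w]).
  by apply: cdiffB (cdiff_horner p w); apply: cdiff_shift; rewrite addrC.
have gB u : cmod u <= r -> cmod (g u) <= B * cmod u ^+ n.+1.
  by move=> ur; rewrite /g (addrC u); exact: fp.
have [w0|w0] := eqVneq w 0; last first.
  have c0 : 0 < cmod w by rewrite cmod_gt0.
  have ball z : cmod (z - w) <= cmod w -> cmod z <= 2 * cmod w.
    by move=> zw; have := cmod_lerB z w; lra.
  have := @cauchy_estimate g w (cmod w) (B * (2 * cmod w) ^+ n.+1) (d - p^`().[w]) c0.
  move=> /(_ _ _ dgw) H; apply: le_trans (H _ _) _.
  - by move=> z /ball zw; apply: dg; lra.
  - move=> z /ball zw; apply: le_trans (gB z _) _; first by lra.
    by apply: ler_wpM2l => //; apply: lerXn2r; rewrite ?nnegrE ?mulr_ge0 ?cmod_ge0.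
  rewrite le_eqVlt; apply/orP; left; apply/eqP.
  rewrite exprMn !exprS; field; exact: lt0r_neq0.
have {}gB u t : cmod u <= t -> t <= r -> cmod (g (w + u) - g w) <= B * t ^+ n * cmod u.
  have g0 : g 0 = 0.
    apply/eqP; rewrite -cmod_eq0 eq_le cmod_ge0 andbT; have := gB 0.
    by rewrite cmod0 expr0n mulr0; apply; exact: ltW.
  rewrite w0 g0 add0r subr0 => ut tr; apply: le_trans (gB u _) _; first exact: le_trans tr.
  rewrite exprSr mulrA; apply: ler_wpM2r; first exact: cmod_ge0.
  by apply: ler_wpM2l => //; apply: lerXn2r; rewrite ?nnegrE ?cmod_ge0 //;
    apply: le_trans ut; exact: cmod_ge0.
have Hd t : 0 < t -> t <= r -> cmod (d - p^`().[w]) <= B * t ^+ n.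
  move=> t0 tr; apply: (cdiff_bound (r := t) t0 _ dgw) => h ht; exact: gB.
(* Since 0^0 = 1, the case n = 0 asks only for a bound by a multiple of B; for larger n the
   right-hand side is 0 and t is made small. *)
case: n {fp} gB Hd => [|n] gB Hd; rewrite w0 cmod0.
  have := Hd r r0 (lexx _); rewrite w0 !expr0 expr2; lra.
rewrite expr0n /= mulr0; apply/ler_addgt0Pr => e e0; rewrite add0r.
pose t : R := Num.min (Num.min r 1) (e / (B + 1)).
have B1 : 0 < B + 1 by lra.
have t0 : 0 < t by rewrite !lt_min r0 ltr01 divr_gt0.
have tr : t <= r by rewrite !ge_min lexx.
have t1 : t <= 1 by rewrite !ge_min lexx orbT.
have te : t * (B + 1) <= e by rewrite -ler_pdivlMr // !ge_min lexx orbT.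
have := Hd t t0 tr; rewrite w0 => /le_trans; apply.
have tn : t ^+ n.+1 <= t.
  by rewrite exprS ler_piMr ?exprn_ile1 // ltW.
nra.
Qed.

(** Differentiability is a conclusion here, which is how f' and the quotient by a linear factor are
    shown to be holomorphic; at w = 0 the estimate also forces g(z0) = q(0). *)
Lemma cdiff_of_expansion g z0 r (q : {poly C}) B : 0 < r ->
  (forall w, cmod w <= r -> cmod (g (z0 + w) - q.[w]) <= B * cmod w ^+ 2) ->
  cdiff g z0 q^`().[0].
Proof.
move=> r0 H.
have g0 : g z0 = q.[0].
  apply/eqP; rewrite -subr_eq0 -cmod_eq0 eq_le cmod_ge0 andbT; have := H 0.
  by rewrite cmod0 addr0 expr0n mulr0; apply; exact: ltW.
move=> e e0; have e2 : 0 < e / 2 by rewrite divr_gt0.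
have [s s0 Hs] := cdiff_horner q 0 e2.
have B1 : 0 < `|B| + 1 by rewrite ltr_wpDl.
exists (Num.min (Num.min r s) (e / 2 / (`|B| + 1))).
  by rewrite !lt_min r0 s0 divr_gt0.
move=> h; rewrite !lt_min ltr_pdivlMr // => /andP[/andP[hr hs] he].
have := Hs h hs; rewrite add0r => H1.
have -> : g (z0 + h) - g z0 - q^`().[0] * h =
   (g (z0 + h) - q.[h]) + (q.[h] - q.[0] - q^`().[0] * h) by rewrite g0; ring.
apply: le_trans (cmodD _ _) _; have := H h (ltW hr); have := cmod_ge0 h.
have := ler_norm B; rewrite expr2; set c := cmod h in he H1 *.
set A := cmod _ in H1 *; set D := cmod _; nra.
Qed.

(** A third-order expansion of f differentiates to a second-order expansion of f', which implies
    differentiability. *)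
Lemma derive1_cderivable f z0 r : 0 < r ->
  (forall z, cmod (z - z0) < r -> cderivable f z) -> cderivable (derive1 f) z0.
Proof.
move=> r0 df; have r2 : 0 < r / 2 by rewrite divr_gt0.
have [|p _ [B B0 Hp]] := @taylor_ex f z0 (r / 2) 3 r2.
  by move=> z zr; apply: df; lra.
have r4 : 0 < r / 2 / 2 by rewrite divr_gt0.
exists p^`()^`().[0]; apply: (@cdiff_of_expansion _ _ (r / 2 / 2 / 2) _ (2 ^+ 4 * B)).
  by rewrite divr_gt0.
move=> w wr.
have [|d dw] := df (z0 + w); first by rewrite addrC addKr; lra.
rewrite (derive1_cdiff dw).
apply: (deriv_expansion r4 B0 _ Hp wr dw).
by move=> z zr; apply: df; lra.
Qed.

(** Identifies the hidden Taylor coefficient. The induction moves to f' and p', whose estimate is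
    the differentiated one, on a smaller disc and with a larger constant. *)
Lemma derive1n_expansion f z0 r s (p : {poly C}) B k : 0 < r -> 0 < s -> 0 <= B ->
  (forall z, cmod (z - z0) < r -> cderivable f z) ->
  (forall w, cmod w <= s -> cmod (f (z0 + w) - p.[w]) <= B * cmod w ^+ k.+1) ->
  derive1n k f z0 = k`!%:R * p`_k.
Proof.
elim: k f p B s => [|k IH] f p B s r0 s0 B0 df Hp.
  rewrite /derive1n /= mul1r -horner_coef0.
  apply/eqP; rewrite -subr_eq0 -cmod_eq0 eq_le cmod_ge0 andbT; have := Hp 0.
  by rewrite cmod0 addr0 expr0n mulr0; apply; exact: ltW.
rewrite /derive1n iterSr -/(derive1n k _).
pose t : R := Num.min s (r / 2).
have t0 : 0 < t by rewrite lt_min s0 divr_gt0.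
have ts : t <= s by rewrite ge_min lexx.
have tr : t <= r / 2 by rewrite ge_min lexx orbT.
have t2 : 0 < t / 2 by rewrite divr_gt0.
rewrite (IH (derive1 f) p^`() (2 ^+ k.+3 * B) (t / 2)) //.
- by rewrite coef_deriv factS natrM -mulr_natr; ring.
- by rewrite mulr_ge0 // exprn_ge0.
- move=> z zr; apply: (@derive1_cderivable f z (r - cmod (z - z0))); first by rewrite subr_gt0.
  move=> u ur; apply: df; have -> : u - z0 = (u - z) + (z - z0) by ring.
  by apply: le_lt_trans (cmodD _ _) _; lra.
- move=> w wt; have [|d dw] := df (z0 + w); first by rewrite addrC addKr; lra.
  rewrite (derive1_cdiff dw).
  apply: (deriv_expansion t0 B0 _ _ wt dw) => [z zt|u ut]; last by apply: Hp; lra.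
  by apply: df; lra.
Qed.

(** Removable singularity: the Taylor polynomial of g at a is X q, and the quotient receives the
    value q(0) at a. Differentiability passes on point by point, so the quotient keeps the whole
    domain of g. *)
Lemma divide_zero g a r : 0 < r -> (forall z, cmod (z - a) < r -> cderivable g z) ->
  g a = 0 -> exists2 g1, (forall z, g z = (z - a) * g1 z) &
    forall z, cderivable g z -> cderivable g1 z.
Proof.
move=> r0 dg ga; have r2 : 0 < r / 2 by rewrite divr_gt0.
have [|p _ [B B0 Hp]] := @taylor_ex g a (r / 2) 3 r2.
  by move=> z zr; apply: dg; lra.
have /factor_theorem[q pq] : root p 0.
  rewrite /root -cmod_eq0 eq_le cmod_ge0 andbT; have := Hp 0.
  rewrite cmod0 addr0 expr0n mulr0 ga sub0r cmodN; apply; lra.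
pose g1 z := if z == a then q.[0] else g z / (z - a).
exists g1 => z.
  rewrite /g1; case: eqVneq => [->|za]; first by rewrite subrr mul0r.
  by rewrite mulrC divfK // subr_eq0.
have [->|za] := eqVneq z a.
  move=> _; exists q^`().[0]; apply: (@cdiff_of_expansion _ _ (r / 2 / 2) _ B).
    by rewrite divr_gt0.
  move=> w wr; rewrite /g1 -{2}[a]addr0 (inj_eq (addrI a)).
  case: eqVneq => [->|w0]; first by rewrite subrr cmod0 mulr_ge0 // exprn_ge0.
  have wp : 0 < cmod w by rewrite cmod_gt0.
  rewrite (addrC a w) addrK (addrC w a) -(ler_pM2r wp) -cmodM -mulrA -exprSr.
  have -> : (g (a + w) / w - q.[w]) * w = g (a + w) - p.[w].
    by rewrite pq hornerM hornerXsubC subr0 mulrBl divfK.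
  exact: Hp.
move=> [d dgz]; have za0 : z - a != 0 by rewrite subr_eq0.
have dd := cdiffM dgz (cdiffV (f := fun z => z - a) za0 (cdiffB (cdiff_id z) (cdiff_cst a z))).
eexists; apply: (cdiff_ext (r := cmod (z - a))) dd; first by rewrite cmod_gt0.
move=> w wz; rewrite /g1; case: eqVneq => // wa.
by move: wz; rewrite wa cmodBC ltxx.
Qed.

(** Taylor's estimate of order 0, a substitute for the maximum principle on the half disc at the
    cost of a factor 2. *)
Lemma cauchy_sup f rho M w : cmod w <= rho / 2 -> 0 < rho ->
  (forall z, cmod z <= rho -> cderivable f z) ->
  (forall y, 0 <= y <= 1 -> cmod (f (circ rho y)) <= M) -> cmod (f w) <= 2 * M.
Proof.
move=> wr r0 df fM; have [p + Hp] := taylor0 0 r0 df fM.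
rewrite leqn0 size_poly_eq0 => /eqP p0.
by have := Hp w wr; rewrite p0 horner0 subr0 expr0 mulr1.
Qed.
End Cauchy.

(** * The logarithm of the modulus of a zero-free function *)

Section LogModulus.
Variable R : realType.
Local Notation C := (Cplx R).
Implicit Types (z w a : C) (r rho s : R).

Lemma rmvt (f df : R -> R) (a b : R) : a <= b ->
  (forall x, a <= x <= b -> is_derive x (1 : R) f (df x)) ->
  exists2 c, a <= c <= b & f b - f a = df c * (b - a).
Proof.
move=> ab fd; have [<-|ne] := eqVneq a b.
  by exists a; rewrite ?lexx // !subrr mulr0.
have lt : a < b by rewrite lt_neqAle ne.
have [||c] := @MVT R f df a b lt.
- by move=> x; rewrite in_itv /= => /andP[? ?]; apply: fd; rewrite !ltW.
- apply: derivable_within_continuous => x; rewrite in_itv /= => xab.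
  by case: (fd x xab).
- by rewrite in_itv /= => /andP[? ?] H; exists c => //; rewrite !ltW.
Qed.

Lemma cinvE z : z^-1 = cconj z * rc ((cmod z ^+ 2)^-1).
Proof.
have [->|z0] := eqVneq z 0.
  by rewrite invr0 cmod0 expr0n /= invr0 mulr0.
have c0 : cmod z ^+ 2 != 0 by rewrite expf_neq0 // cmod_eq0.
by apply: (mulfI z0); rewrite divff // mulrA mulcconj -rcM divff.
Qed.

(** Writing ln |h| as half the logarithm of |h|^2 leaves only real derivatives; no branch of the
    complex logarithm is involved. *)
Lemma is_derive_lnmod (h : R -> C) (t : R) v : rcdiff h t v -> h t != 0 ->
  is_derive t (1 : R) (fun x => ln (cmod (h x))) (cre (v / h t)).
Proof.
move=> /rcdiffP[d1 d2] h0.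
have c0 : 0 < cmod (h t) ^+ 2 by rewrite exprn_gt0 // cmod_gt0.
have -> : (fun x => ln (cmod (h x))) = (fun x => 2^-1 * ln (cre (h x) * cre (h x) + cim (h x) * cim (h x))).
  apply/funext => x; rewrite -!expr2 -cmod_sqr.
  (* The two functions must agree everywhere; at a zero of h the convention ln 0 = 0 makes both
     sides 0. *)
  have [->|hx] := eqVneq (h x) 0; first by rewrite cmod0 expr0n /= ln0 // mulr0.
  by rewrite lnXn ?cmod_gt0 // -(mulr_natl (ln _)) mulKf ?pnatr_eq0.
pose q x := cre (h x) * cre (h x) + cim (h x) * cim (h x).
have dq : is_derive t (1 : R) q (2 * (cre (h t) * cre v + cim (h t) * cim v)).
  have := is_deriveD (is_deriveM d1 d1) (is_deriveM d2 d2).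
  by move=> /is_derive_eq; apply; rewrite /GRing.scale /=; ring.
have qt : q t = cmod (h t) ^+ 2.
  by rewrite /q cmod_sqr !expr2.
have dl : is_derive (cmod (h t) ^+ 2) (1 : R) (@ln R) (cmod (h t) ^+ 2)^-1.
  exact: is_derive1_ln.
rewrite -qt in dl.
have := is_deriveZ (2^-1 : R) (@is_derive1_comp R (@ln R) q t _ _ dl dq).
move=> /is_derive_eq; apply.
rewrite qt /GRing.scale /= cinvE !cpartsE.
move: (_ ^- 2) (cre (h t)) (cre v) (cim (h t)) (cim v) => c *.
by field.
Qed.

Definition holo (r : R) (G : C -> C) := forall z, cmod z < r -> cderivable G z.

Section ZeroFree.
Variables (G : C -> C) (r1 rho : R).
Hypotheses (rho0 : 0 < rho) (rho1 : rho < r1) (hG : holo r1 G)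
  (G0 : forall z, cmod z < r1 -> G z != 0).

Local Ltac slra := have ? := rho0; have ? := rho1; lra.

(** This quotient stands for the derivative of log G; together with the real function ln |G| it
    replaces a holomorphic logarithm of G. *)
Definition logder z := derive1 G z / G z.
Let phi := logder.
Local Notation lnG z := (ln (cmod (G z))).

Lemma dG z : cmod z < r1 -> cdiff G z (derive1 G z).
Proof. by move=> zr; have [d dd] := hG zr; rewrite (derive1_cdiff dd). Qed.

Lemma holo_logder : holo r1 logder.
Proof.
move=> z zr; have [||d dd] := @derive1_cderivable R G z (r1 - cmod z) _ _.
- by rewrite subr_gt0.
- by move=> w wz; apply: hG; have := cmod_lerB w z; slra.
- by eexists; apply: cdiffM dd (cdiffV (G0 zr) (dG zr)).
Qed.

Lemma is_derive_lnG (p : R -> C) t v : rcdiff p t v -> cmod (p t) < r1 ->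
  is_derive t (1 : R) (fun x => lnG (p x)) (cre (logder (p t) * v)).
Proof.
move=> dp pr; have := is_derive_lnmod (rcdiff_comp (dG pr) dp) (G0 pr).
by rewrite mulrAC.
Qed.

Let u y := lnG (circ rho y).
Let zr y : cmod (circ rho y) < r1.
Proof. by rewrite cmod_circ // ltW. Qed.
Let du y : is_derive y (1 : R) u (cre (phi (circ rho y) * (ci R * rc (2 * pi) * circ rho y))).
Proof. by apply: is_derive_lnG => //; exact: rcdiff_circ. Qed.
Lemma rcont_lnG : rcont (fun y => ln (cmod (G (circ rho y)))).
Proof.
move=> y; apply: differentiable_continuous; apply/derivable1_diffP.
by case: (du y).
Qed.
Let inr z : cmod z <= rho -> cmod z < r1.
Proof. by move=> h; exact: le_lt_trans h rho1. Qed.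
Let cphi : ccont (fun y => phi (circ rho y)).
Proof.
by apply: ccont_on_circ => [|z zr']; [exact: ltW|apply: holo_logder; exact: inr].
Qed.
Let cK w : cmod w < rho -> ccont (fun y => (circ rho y - w)^-1).
Proof.
move=> wr; apply: ccontV => [|t]; last exact: circ_neq.
by apply: ccontB; [exact: ccont_circ|exact: ccont_cst].
Qed.

(** On |z| = rho the conjugate of z is rho^2 / z, so the conjugate of the integrand coincides with
    the function [F], which is holomorphic on the closed disc and vanishes at 0; the mean of [F] is
    F(0). *)
Lemma logder_anti w : cmod w < rho ->
  cint (fun y => cconj (circ rho y * phi (circ rho y)) / (circ rho y - w)) 0 1 = 0.
Proof.
move=> wr; pose F z := z * phi z * (z / (rc (rho ^+ 2) - cconj w * z)).
have den z : cmod z <= rho -> rc (rho ^+ 2) - cconj w * z != 0.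
  move=> zr'; rewrite -cmod_gt0; apply: lt_le_trans (cmod_lerB _ _).
  rewrite cmodM cmodJ cmod_rc ger0_norm ?exprn_ge0 ?ltW // subr_gt0 expr2.
  have := cmod_ge0 w; have := cmod_ge0 z; have ? := rho0; nra.
have F0 : F 0 = 0 by rewrite /F !mul0r.
have r0 : cmod (0 : C) < rho by rewrite cmod0.
have := @cauchy_formula R F rho 0 r0; rewrite F0 => H.
have cc0 y : circ rho y != 0 by have := circ_neq y r0; rewrite subr0.
rewrite -[RHS](cconjK 0).
have -> : cconj (0 : C) = 0 by apply: cplx_ext; rewrite !cpartsE ?oppr0.
rewrite -H.
  rewrite -cint_conj.
    apply: cint_eq => y _; rewrite /F subr0 divff // mulr1.
    rewrite (cconjM (circ rho y * _)); congr (_ * _).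
    have h := circ_neq y wr; have := cc0 y.
    have := mulcconj (circ rho y); rewrite cmod_circ ?(ltW rho0) //.
    move: (circ rho y) h => z h E z0.
    rewrite cconjM cconjV cconjD cconjN cconjM cconjK.
    have -> : cconj (rc (rho ^+ 2)) = rc (rho ^+ 2) by apply: cplx_ext; rewrite !cpartsE ?oppr0.
    have zc : cconj z != 0 by rewrite -cmod_eq0 cmodJ cmod_eq0.
    by rewrite -E -mulrBl; field; rewrite zc h.
  apply: ccontM; last first.
    apply: ccontM; first exact: ccont_circ.
    by apply: ccontV => [|t]; [apply: ccontB; [exact: ccont_circ|exact: ccont_cst]|exact: circ_neq].
  apply: ccontM; first by apply: ccontM; [exact: ccont_circ|exact: cphi].
  apply: ccontM; first exact: ccont_circ.
  apply: ccontV => [|t]; last by apply: den; rewrite cmod_circ // ltW.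
  apply: ccontB; first exact: ccont_cst.
  by apply: ccontM; [exact: ccont_cst|exact: ccont_circ].
move=> z zr'; have [d dd] : cderivable phi z by apply: holo_logder; exact: inr.
eexists; apply: cdiffM (cdiffM (cdiff_id z) dd) _.
apply: cdiffM (cdiff_id z) (cdiffV (f := fun z => rc (rho ^+ 2) - cconj w * z) (den _ zr') _).
exact: cdiffB (cdiff_cst _ z) (cdiffM (cdiff_cst (cconj w) z) (cdiff_id z)).
Qed.

(* Schwarz's formula, differentiated: the antiholomorphic part of the boundary
   integral vanishes, so only the tangential derivative of ln |G| survives, and
   it is integrated by parts. *)
Lemma logder_formula w : cmod w < rho ->
  logder w = 2 * cint (fun y => rc (ln (cmod (G (circ rho y)))) *
    (circ rho y / (circ rho y - w) ^+ 2)) 0 1.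
Proof.
move=> wr.
have hp z : cmod z <= rho -> cderivable phi z by move=> ?; apply: holo_logder; exact: inr.
have cu : ccont (fun y => rc (u y)) by apply: ccont_rc; exact: rcont_lnG.
pose u' y := cre (phi (circ rho y) * (ci R * rc (2 * pi) * circ rho y)).
have cu' : ccont (fun y => rc (u' y)).
  apply: ccont_rc.
  by case: (ccontM cphi (ccontM (ccont_cst (ci R * rc (2 * pi))) (ccont_circ rho))).
have cK2 : ccont (fun y => circ rho y / (circ rho y - w) ^+ 2).
  apply: ccontM; first exact: ccont_circ.
  apply: ccontV => [|t]; last by rewrite expf_neq0 // circ_neq.
  by apply: ccontX; apply: ccontB; [exact: ccont_circ|exact: ccont_cst].
have parts : cint (fun y => rc (u' y) / (circ rho y - w)) 0 1 =
    ci R * rc (2 * pi) * cint (fun y => rc (u y) * (circ rho y / (circ rho y - w) ^+ 2)) 0 1.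
  rewrite -cintZ; last by apply: ccontM.
  apply/eqP; rewrite -subr_eq0 -cintB; [|by apply: ccontM => //; exact: cK|].
    rewrite (@cint_FTC R (fun y => rc (u y) * (circ rho y - w)^-1)) ?ler01 //.
    - by rewrite /u /circ cic1 subrr.
    - apply: ccontB; first by apply: ccontM => //; exact: cK.
      by apply: ccontM; [exact: ccont_cst|apply: ccontM].
    - move=> y; have h := circ_neq y wr.
      have dc := rcdiffD (rcdiff_circ rho y) (rcdiff_cst (- w) y).
      have di := rcdiff_comp (cdiffV (f := id) h (cdiff_id _)) dc.
      have := rcdiffM (rcdiff_rc (du y)) di.
      by apply: rcdiff_eq; rewrite -/phi -/(u' y); field.
  by apply: ccontM; [exact: ccont_cst|apply: ccontM].
have cfm := cauchy_formula wr hp; rewrite -/phi.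
rewrite -[LHS]subr0 -(logder_anti wr) -cfm -cintB; last first.
- apply: ccontM; last exact: cK.
  by apply: ccont_conj; apply: ccontM; [exact: ccont_circ|exact: cphi].
- by apply: ccontM => //; apply: ccontM; [exact: ccont_circ|exact: cK].
have pi0 : rc (pi : R) != 0 by rewrite rc_eq0 gt_eqF // pi_gt0.
transitivity (- (ci R / rc pi) * cint (fun y => rc (u' y) / (circ rho y - w)) 0 1).
  rewrite -cintZ; last by apply: ccontM => //; exact: cK.
  apply: cint_eq => y _; rewrite /u'; move: (circ rho y) (phi _) => z p.
  (* Both sides are 2 i Im(p z), because Re(2 pi i p z) = -2 pi Im(p z). *)
  have K : p * z - cconj (z * p) = - (ci R / rc pi) * rc (cre (p * (ci R * rc (2 * pi) * z))).
    apply: (mulfI pi0); set X := rc (cre _).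
    have -> : rc pi * (- (ci R / rc pi) * X) = - (ci R * X).
      by rewrite mulNr mulrN mulrA mulrCA divff // mulr1.
    rewrite /X.
    apply: cplx_ext; rewrite !cpartsE; ring.
  by rewrite [in RHS]mulrA -K mulrA -mulrBl.
rewrite parts !mulrA; congr (_ * _).
have -> : rc (2 * pi) = 2 * rc (pi : R) by rewrite rcM; congr (_ * _); rewrite /rc rmorph_nat.
have -> : - (ci R / rc pi) * ci R * (2 * rc pi) = - (ci R * ci R) * 2 * (rc pi / rc pi) by ring.
rewrite divff // mulr1; have -> : ci R * ci R = -1 by apply: cplx_ext; rewrite !cpartsE; ring.
by rewrite opprK mul1r.
Qed.

(** For |w| <= rho / 2 the kernel of [logder_formula] is at most rho / (rho / 2)^2 = 4 / rho, and
    the formula carries a factor 2. *)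
Lemma logder_bound w : cmod w <= rho / 2 ->
  cmod (logder w) <= 8 / rho * rint (fun y => `|ln (cmod (G (circ rho y)))|) 0 1.
Proof.
move=> wr2; have wr : cmod w < rho by slra.
rewrite logder_formula //.
have c2 : ccont (fun y => rc (ln (cmod (G (circ rho y)))) * (circ rho y / (circ rho y - w) ^+ 2)).
  apply: ccontM; first by apply: ccont_rc; exact: rcont_lnG.
  apply: ccontM; first exact: ccont_circ.
  apply: ccontV => [|t]; last by rewrite expf_neq0 // circ_neq.
  by apply: ccontX; apply: ccontB; [exact: ccont_circ|exact: ccont_cst].
have -> : (2 : C) = rc 2 by rewrite /rc rmorph_nat.
rewrite cmodM cmod_rc ger0_norm // -rintZ; last by apply: rcont_norm; exact: rcont_lnG.
apply: (@le_trans _ _ (2 * rint (fun t => cmod (rc (ln (cmod (G (circ rho t)))) *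
  (circ rho t / (circ rho t - w) ^+ 2))) 0 1)).
  by apply: ler_wpM2l => //; exact: cmod_cint.
rewrite -rintZ; last exact: ccont_cmod.
apply: rint_le.
- by apply: rcontM; [exact: rcont_cst|exact: ccont_cmod].
- by apply: rcontM; [exact: rcont_cst|apply: rcont_norm; exact: rcont_lnG].
move=> y _; rewrite cmodM cmod_rc mulrCA [leRHS]mulrC; apply: ler_wpM2l => //.
rewrite cmodM cmodV cmodX cmod_circ ?(ltW rho0) //.
have := cmod_lerB (circ rho y) w; rewrite cmod_circ ?(ltW rho0) // => H.
have c0 : 0 < cmod (circ rho y - w) by rewrite cmod_gt0 circ_neq.
rewrite mulrA ler_pdivrMr ?exprn_gt0 // expr2.
have H' : rho / 2 <= cmod (circ rho y - w) by slra.
have -> : 2 * rho = 8 / rho * (rho / 2 * (rho / 2)) by field; exact: lt0r_neq0.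
apply: ler_wpM2l; first by rewrite divr_ge0 // ltW.
by apply: ler_pM => //; rewrite divr_ge0 // ltW.
Qed.

Lemma lnG_lip z w : cmod z <= rho / 2 -> cmod w <= rho / 2 ->
  `|lnG w - lnG z| <= 8 / rho * rint (fun y => `|lnG (circ rho y)|) 0 1 * cmod (w - z).
Proof.
move=> zr2 wr2; set B := 8 / rho * _.
pose p (t : R) := z + rc t * (w - z).
have pE t : 0 <= t <= 1 -> cmod (p t) <= rho / 2.
  move=> /andP[t0 t1].
  have -> : p t = rc (1 - t) * z + rc t * w by rewrite /p rcB rc1; ring.
  apply: le_trans (cmodD _ _) _; rewrite !cmodM !cmod_rc !ger0_norm ?subr_ge0 //; have ? := rho0; nra.
have dp t : rcdiff p t (w - z).
  have := rcdiffD (rcdiff_cst z t) (rcdiffM (rcdiff_rc (is_derive_id t (1:R))) (rcdiff_cst (w - z) t)).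
  by apply: rcdiff_eq; rewrite rc1; ring.
have [|t tI] := rmvt ler01 (f := fun t => lnG (p t))
   (df := fun t => cre (logder (p t) * (w - z))).
  move=> x /pE px; apply: is_derive_lnG => //; slra.
rewrite /p rc0 rc1 mul0r addr0 mul1r (addrC z) subrK subr0 mulr1 => ->.
apply: le_trans (cmod_re _) _; rewrite cmodM; apply: ler_wpM2r; first exact: cmod_ge0.
exact: logder_bound (pE t tI).
Qed.

(** Cauchy's formula on a circle of radius strictly between rho and r1 gives a Lipschitz constant up
    to |z| = rho. Only its existence matters, for [mean_lnG]. *)
Let r2 := (rho + r1) / 2.
Lemma logder_lip : exists2 K, 0 <= K & forall z w, cmod z <= rho -> cmod w <= rho ->
  cmod (logder z - logder w) <= K * cmod (z - w).
Proof.
have h1 : rho < r2 by rewrite /r2; slra.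
have h2 : r2 < r1 by rewrite /r2; slra.
have r20 : 0 < r2 by exact: lt_trans rho0 h1.
have hp z : cmod z <= r2 -> cderivable phi z by move=> ?; apply: holo_logder; slra.
have cp := ccont_on_circ (ltW r20) hp.
have [M M0 HM] := ccont_bounded cp ler01.
exists (M * (r2 / (r2 - rho) ^+ 2)).
  apply: mulr_ge0 => //; apply: divr_ge0; first exact: ltW.
  by apply: exprn_ge0; rewrite subr_ge0 ltW.
move=> z w zr' wr'.
have [zr2 wr2] : cmod z < r2 /\ cmod w < r2 by split; slra.
have ck v : cmod v < r2 -> ccont (fun y => phi (circ r2 y) * (circ r2 y / (circ r2 y - v))).
  move=> vr; apply: ccontM => //; apply: ccontM; first exact: ccont_circ.
  apply: ccontV => [|t]; last exact: circ_neq.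
  by apply: ccontB; [exact: ccont_circ|exact: ccont_cst].
rewrite -/phi -(cauchy_formula zr2 hp) -(cauchy_formula wr2 hp) -cintB; try exact: ck.
rewrite -[leRHS]mulr1 -[X in _ <= _ * X](subr0 1); apply: cint_bound => //.
  by apply: ccontB; exact: ck.
move=> y y01; set c := circ r2 y.
have hz : c - z != 0 by exact: circ_neq.
have hw : c - w != 0 by exact: circ_neq.
have -> : phi c * (c / (c - z)) - phi c * (c / (c - w)) =
   phi c * ((c / ((c - z) * (c - w))) * (z - w)) by field; rewrite hz hw.
have cr : cmod c = r2 by rewrite cmod_circ // ltW.
rewrite (cmodM (phi c)) (cmodM (c / _)) (cmodM c) -[leRHS]mulrA; apply: ler_pM; rewrite ?cmod_ge0 ?HM ?mulr_ge0 ?cmod_ge0 //.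
apply: ler_wpM2r; first exact: cmod_ge0.
rewrite cmodV cmodM cr; apply: ler_wpM2l; first exact: ltW.
have bz := cmod_lerB c z; have bw := cmod_lerB c w; rewrite cr in bz bw.
rewrite lef_pV2 ?posrE ?mulr_gt0 ?exprn_gt0 ?cmod_gt0 ?subr_gt0 // expr2.
by apply: ler_pM; slra.
Qed.

(** Cutting [0, rho] into n equal pieces bounds the total variation by n K (rho / n)^2, which tends
    to 0. This takes the place of differentiating the mean under the integral sign. *)
Lemma const_of_quadratic (M : R -> R) K : 0 <= K ->
  (forall s t, 0 <= s <= rho -> 0 <= t <= rho -> `|M s - M t| <= K * (s - t) ^+ 2) ->
  M rho = M 0.
Proof.
move=> K0 HM; apply/eqP; rewrite -subr_eq0 -normr_eq0 eq_le normr_ge0 andbT.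
apply/ler_addgt0Pr => e e0; rewrite add0r.
have key n k : (0 < n)%N -> (k <= n)%N ->
    `|M (rho * (k%:R / n%:R)) - M 0| <= k%:R * (K * (rho / n%:R) ^+ 2).
  move=> n0; have n0' : 0 < n%:R :> R by rewrite ltr0n.
  elim: k => [|k IH] kn; first by rewrite mul0r mulr0 subrr normr0 mul0r.
  have I j : (j <= n)%N -> 0 <= rho * (j%:R / n%:R) <= rho.
    move=> jn; rewrite mulr_ge0 ?divr_ge0 ?ler0n ?(ltW rho0) //=.
    by rewrite ler_piMr ?(ltW rho0) // ler_pdivrMr // mul1r ler_nat.
  have := HM _ _ (I _ kn) (I k (ltnW kn)); have := IH (ltnW kn).
  have -> : rho * (k.+1%:R / n%:R) - rho * (k%:R / n%:R) = rho / n%:R.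
    by rewrite -natr1; field; exact: lt0r_neq0.
  rewrite -natr1 => H1 H2.
  have := ler_normD (M (rho * ((k%:R + 1) / n%:R)) - M (rho * (k%:R / n%:R)))
    (M (rho * (k%:R / n%:R)) - M 0).
  rewrite addrA subrK; lra.
pose n := (Num.truncn (K * rho ^+ 2 / e)).+1.
have nb : K * rho ^+ 2 / e < n%:R by exact: truncnS_gt.
have n0 : 0 < n%:R :> R by rewrite ltr0n.
have := key n n isT (leqnn n); rewrite divff ?mulr1; last exact: lt0r_neq0.
move=> /le_trans; apply.
have -> : n%:R * (K * (rho / n%:R) ^+ 2) = K * rho ^+ 2 / n%:R by field; exact: lt0r_neq0.
by move: nb; rewrite ltr_pdivrMr // (mulrC n%:R) => /ltW; rewrite ler_pdivrMr.
Qed.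

(** The mean over the circle of radius s does not depend on s: the radial derivative of ln |G| is
    Re(cic y * G'/G), whose mean is 0, so only an error of second order remains by [logder_lip]. *)
Lemma mean_lnG : rint (fun y => lnG (circ rho y)) 0 1 = lnG 0.
Proof.
have [K K0 HK] := logder_lip.
pose M s := rint (fun y => lnG (circ s y)) 0 1.
have M0 : M 0 = lnG 0.
  rewrite -[RHS]mulr1 -[X in _ = _ * X](subr0 1) -rint_cst ?ler01 //.
  by apply: rint_eq => y _; rewrite /circ rc0 mul0r.
rewrite -M0; apply: (const_of_quadratic K0).
have key s t : 0 < s -> s <= rho -> 0 <= t <= rho -> `|M s - M t| <= K * (s - t) ^+ 2.
  move=> s0 sr /andP[t0 tr].
  have cl x : 0 <= x -> x <= rho -> rcont (fun y => lnG (circ x y)).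
    move=> x0 xr y; apply: differentiable_continuous; apply/derivable1_diffP.
    have := is_derive_lnG (rcdiff_circ x y); rewrite cmod_circ // => /(_ _).
    by case; first exact: le_lt_trans xr rho1.
  have cps : ccont (fun y => phi (circ s y)).
    by apply: ccont_on_circ => [|z zs]; [exact: ltW|apply: holo_logder; slra].
  pose D y := cic y * phi (circ s y).
  have cD : ccont D by apply: ccontM; [exact: ccont_cic|].
  (* Times s, the mean of [D] is the mean of z G'(z)/G(z) over the circle, hence its value 0 at the
     centre. *)
  have D0 : rint (fun y => (t - s) * cre (D y)) 0 1 = 0.
    rewrite rintZ; last by case: cD.
    rewrite -cre_cint.
    have [F0 hF] : (fun z => z * phi z) 0 = 0 /\
        forall z, cmod z <= s -> cderivable (fun z => z * phi z) z.
      split=> [|z zs]; first by rewrite mul0r.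
      have [d dd] : cderivable phi z by apply: holo_logder; slra.
      by eexists; exact: cdiffM (cdiff_id z) dd.
    have c0s : cmod (0 : C) < s by rewrite cmod0.
    have := cauchy_formula c0s hF; rewrite F0 => H.
    suff -> : cint D 0 1 = 0 by rewrite mulr0.
    have s0c : rc s != 0 by rewrite rc_eq0 gt_eqF.
    apply: (mulfI s0c); rewrite mulr0 -cintZ // -[RHS]H; apply: cint_eq => y _.
    have := circ_neq y c0s; rewrite subr0 => h.
    by rewrite divff // mulr1 /D /circ; ring.
  rewrite distrC -[X in `|X - _|]subr0 -D0 addrAC -opprB -/(M t) /M.
  have cls := cl s (ltW s0) sr; have clt := cl t t0 tr.
  rewrite opprB -rintB //.
  have cDr : rcont (fun y => (t - s) * cre (D y)).
    by apply: rcontM; [exact: rcont_cst|case: cD].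
  rewrite -rintB //; last exact: rcontB.
  rewrite -[leRHS]mulr1 -[X in _ <= _ * X](subr0 1); apply: rint_bound => //.
    by apply: rcontB => //; exact: rcontB.
  move=> y _.
  have dy x : 0 <= x <= rho -> is_derive x (1 : R) (fun x => lnG (circ x y)) (cre (phi (circ x y) * cic y)).
    move=> /andP[x0 xr]; apply: is_derive_lnG; last first.
      by rewrite cmod_circ //; exact: le_lt_trans xr rho1.
    have := rcdiffM (rcdiff_rc (is_derive_id x (1:R))) (rcdiff_cst (cic y) x).
    by apply: rcdiff_eq; rewrite rc1; ring.
  have [x [x0 xr] [xs xE]] : exists2 x, 0 <= x /\ x <= rho & `|x - s| <= `|t - s| /\
      lnG (circ t y) - lnG (circ s y) = cre (phi (circ x y) * cic y) * (t - s).
    have [st|ts] := leP s t.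
      have [x /andP[h1 h2] ->] := rmvt st (f := fun x => lnG (circ x y))
        (df := fun x => cre (phi (circ x y) * cic y)) (fun x H => dy x ltac:(slra)).
      by exists x; [split; slra|split => //; rewrite !ger0_norm ?subr_ge0 //; slra].
    have [x /andP[h1 h2] E] := rmvt (ltW ts) (f := fun x => lnG (circ x y))
        (df := fun x => cre (phi (circ x y) * cic y)) (fun x H => dy x ltac:(slra)).
    exists x; first by split; slra.
    split; first by rewrite !ler0_norm ?subr_le0 //; slra.
    by rewrite -opprB E -mulrN opprB.
  rewrite xE mulrC -mulrBr normrM /D (mulrC (cic y)).
  have -> : cre (phi (circ x y) * cic y) - cre (phi (circ s y) * cic y) =
      cre ((phi (circ x y) - phi (circ s y)) * cic y) by rewrite mulrBl [in RHS]creD creN.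
  rewrite -sqrrN opprB -[(t - s) ^+ 2]ger0_norm ?sqr_ge0 // expr2 normrM mulrCA.
  apply: ler_wpM2l => //; apply: le_trans (cmod_re _) _; rewrite cmodM cmod_cic mulr1.
  apply: le_trans (HK _ _ _ _) _; rewrite ?cmod_circ // ?(ltW s0) //.
  apply: ler_wpM2l => //; rewrite /circ -mulrBl cmodM cmod_cic mulr1 -rcB cmod_rc.
  exact: xs.
(* [key] expands around a positive radius; the claim is symmetric, so for a vanishing first radius
   the two are exchanged. *)
move=> a b /andP[s0 sr] tI; move: s0; rewrite le_eqVlt => /predU1P[s0|s0]; last exact: key.
move: tI => /andP[]; rewrite le_eqVlt => /predU1P[t0|t0] tr.
  by rewrite -s0 -t0 !subrr normr0 expr0n mulr0.
rewrite distrC -sqrrN opprB; apply: key => //.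
by rewrite -s0 lexx ltW.
Qed.
End ZeroFree.

(** If |a| > rho, then z - a is zero-free on the disc. If |a| < rho, then on the circle |z - a| =
    |rho - conj(a) z / rho|, and the only possible zero of the latter is the reflected point,
    outside the disc. The case |a| = rho, with its singular integrand, is avoided by the choice of
    radii. *)
Lemma mean_ln_linear a rho : 0 < rho -> cmod a != rho ->
  rint (fun y => ln (cmod (circ rho y - a))) 0 1 = ln (Num.max rho (cmod a)).
Proof.
move=> r0; rewrite neq_lt => /orP[ar|ra].
  rewrite max_l ?ltW //.
  have c0 := cmod_ge0 a.
  pose G z : C := rc rho - cconj a / rc rho * z.
  (* The harmonic mean of rho and rho^2 / |a|, the modulus of the reflected zero; in this form it
     makes sense for a = 0. *)
  pose r1 := 2 * rho ^+ 2 / (cmod a + rho).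
  have D0 : 0 < cmod a + rho by lra.
  have rr1 : rho < r1 by rewrite /r1 ltr_pdivlMr // expr2; nra.
  have hG : holo r1 G.
    move=> z _; eexists; apply: cdiffB (cdiff_cst _ z) (cdiffM (cdiff_cst _ z) (cdiff_id z)).
  have G0 z : cmod z < r1 -> G z != 0.
    rewrite /r1 ltr_pdivlMr // => zr.
    rewrite -cmod_gt0; apply: lt_le_trans (cmod_lerB _ _).
    rewrite !cmodM cmodJ cmodV !cmod_rc (ger0_norm (ltW r0)) subr_gt0.
    rewrite mulrAC ltr_pdivrMr //; have := cmod_ge0 z; rewrite expr2 in zr; nra.
  have E : rho = cmod (G 0) by rewrite /G mulr0 subr0 cmod_rc ger0_norm // ltW.
  rewrite [X in _ = ln X]E -(mean_lnG r0 rr1 hG G0); apply: rint_eq => y _.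
  congr ln; have rc0 : rc rho != 0 by rewrite rc_eq0 gt_eqF.
  rewrite /G /circ mulrA divfK // -[LHS]cmodJ cconjD cconjM cconjN.
  have -> : cconj (rc rho) = rc rho by apply: cplx_ext; rewrite !cpartsE ?oppr0.
  rewrite -[LHS]mulr1 -(cmod_cic y) -cmodM mulrBl -mulrA (mulrC (cconj (cic y))) mulcconj.
  by rewrite cmod_cic expr1n mulr1.
rewrite max_r ?ltW //; have hG : holo (cmod a) (fun z => z - a).
  by move=> z _; eexists; apply: cdiffB (cdiff_id z) (cdiff_cst _ z).
rewrite (mean_lnG r0 ra hG) ?sub0r ?cmodN // => z za.
by rewrite subr_eq0; apply/eqP => E; move: za; rewrite E ltxx.
Qed.
End LogModulus.

(** * Factoring out zeros and poles *)

(** Otherwise every duplicate-free list in P misses a point of P and can be prolonged beyond length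
    N. *)
Lemma complete_seq (T : eqType) (P : T -> Prop) (N : nat) :
  (forall s : seq T, uniq s -> (forall x, x \in s -> P x) -> (size s <= N)%N) ->
  exists s : seq T, [/\ uniq s, forall x, x \in s -> P x & forall x, P x -> x \in s].
Proof.
move=> H; apply: contrapT => nex.
have ext n : exists s : seq T, [/\ uniq s, forall x, x \in s -> P x & size s = n].
  elim: n => [|n [s [us Ps sn]]]; first by exists [::].
  have [x [Px xs]] : exists x, P x /\ x \notin s.
    apply: contrapT => nx; apply: nex; exists s; split => // x Px.
    by apply: contrapT => /negP xs; apply: nx; exists x.
  exists (x :: s); split; rewrite /= ?xs ?sn // => y.
  by rewrite inE => /predU1P[->|/Ps].
have [s [us Ps sn]] := ext N.+1.
by have := H s us Ps; rewrite sn ltnn.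
Qed.

Lemma prod_le_exp (R : realFieldType) (T : eqType) (s : seq T) (E : T -> R) (c : R) :
  (forall x, x \in s -> 0 <= E x <= c) -> \prod_(x <- s) E x <= c ^+ size s.
Proof.
elim: s => [|x s IH] H; first by rewrite big_nil.
have /andP[x0 xc] := H x (mem_head _ _).
have Hs y : y \in s -> 0 <= E y <= c by move=> ys; apply: H; rewrite inE ys orbT.
rewrite big_cons exprS; apply: ler_pM => //; last exact: IH.
by rewrite big_seq; apply: prodr_ge0 => y /Hs /andP[].
Qed.

Lemma exp_le_prod (R : realFieldType) (T : eqType) (s : seq T) (E : T -> R) (c : R) :
  0 <= c -> (forall x, x \in s -> c <= E x) -> c ^+ size s <= \prod_(x <- s) E x.
Proof.
move=> c0; elim: s => [|x s IH] H; first by rewrite big_nil.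
rewrite big_cons exprS; apply: ler_pM; rewrite ?exprn_ge0 ?H ?mem_head //.
by apply: IH => y ys; apply: H; rewrite inE ys orbT.
Qed.

Section Factorization.
Variable R : realType.
Local Notation C := (Cplx R).
Implicit Types (f F G g : C -> C) (z w a b : C) (r t : R) (m : nat).

Lemma pole_of_orderP f z m : pole_of_order f z m -> (0 < m)%N /\
  exists g, exists2 r, 0 < r & [/\ forall w, cmod (w - z) < r -> cderivable g w,
    g z != 0 & forall w, w != z -> cmod (w - z) < r -> f w = g w / (w - z) ^+ m].
Proof.
move=> [m0 [g [/holomorphic_atP[r r0 hr] gz]]].
rewrite near_withinE => /near_cplxP[s s0 hs]; split => //.
exists g; exists (Num.min r s); first by rewrite lt_min r0.
split => // [w|w wz]; rewrite lt_min => /andP[wr ws]; first exact: hr.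
exact: hs.
Qed.

Lemma pole_multP f z : pole f z -> pole_of_order f z (pole_mult f z).
Proof. by move=> [m pm]; rewrite /pole_mult; case: xgetP => [y -> //|/(_ m)]. Qed.

Lemma pole_mult_gt0 f z : pole f z -> (0 < pole_mult f z)%N.
Proof. by move=> /pole_multP[]. Qed.

Lemma near_avoid (s : seq C) z : exists2 r, 0 < r &
  forall w, cmod (w - z) < r -> w != z -> w \notin s.
Proof.
elim: s => [|x s [r r0 hr]]; first by exists 1.
have [->|xz] := eqVneq x z.
  by exists r => // w wr wz; rewrite inE negb_or wz; exact: hr.
exists (Num.min r (cmod (x - z))); first by rewrite lt_min r0 cmod_gt0 subr_eq0.
move=> w; rewrite lt_min => /andP[wr wx] wz; rewrite inE negb_or hr // andbT.
by apply: contraTneq wx => ->; rewrite ltxx.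
Qed.

Lemma cderivable_prod (I : Type) (s : seq I) (c : I -> C) (n : I -> nat) (P : pred I) z :
  cderivable (fun w => \prod_(i <- s | P i) (w - c i) ^+ n i) z.
Proof.
elim: s => [|i s [d IH]].
  exists 0; apply: (cdiff_ext (f := fun=> 1) (r := 1)) => // [w _|]; first by rewrite big_nil.
  exact: cdiff_cst.
have [e He] : cderivable (fun w => (w - c i) ^+ n i) z.
  elim: (n i) => [|k [e He]].
    by exists 0; apply: (cdiff_ext (f := fun=> 1) (r := 1)) => //; exact: cdiff_cst.
  eexists; apply: (cdiff_ext (r := 1)) (cdiffM (cdiffB (cdiff_id z) (cdiff_cst (c i) z)) He) => // w _.
  by rewrite exprS.
case Pi : (P i).
  eexists; apply: (cdiff_ext (r := 1)) (cdiffM He IH) => // w _.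
  by rewrite big_cons Pi.
by exists d; apply: (cdiff_ext (r := 1)) IH => // w _; rewrite big_cons Pi.
Qed.

(** The value of f at a pole b is arbitrary, so multiplying by the product does not suffice: at b, F
    is given the value of the local numerator times the remaining factors. *)
Lemma clear_poles f (bs : seq C) (D : set C) : meromorphic f -> uniq bs ->
  (forall b, b \in bs -> pole f b) -> (forall b, D b -> pole f b -> b \in bs) ->
  exists2 F, (forall w, D w -> cderivable F w) &
    forall w, w \notin bs -> F w = f w * \prod_(b <- bs) (w - b) ^+ pole_mult f b.
Proof.
move=> mf ubs bp Dp.
have /choice[g Hg] : forall b, exists g, pole f b -> exists2 r, 0 < r &
    [/\ forall w, cmod (w - b) < r -> cderivable g w,
    g b != 0 & forall w, w != b -> cmod (w - b) < r -> f w = g w / (w - b) ^+ pole_mult f b].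
  move=> b; have [/pole_multP/pole_of_orderP[_ [g H]]|np] := pselect (pole f b); first by exists g.
  by exists id.
pose Q w := \prod_(b <- bs) (w - b) ^+ pole_mult f b.
pose Q' a w := \prod_(b <- bs | b != a) (w - b) ^+ pole_mult f b.
have QE a w : a \in bs -> Q w = (w - a) ^+ pole_mult f a * Q' a w.
  by move=> abs; rewrite /Q (big_rem a) //= /Q' rem_filter // big_filter.
pose F w := if w \in bs then g w w * Q' w w else f w * Q w.
exists F => [w Dw|w /negbTE wb]; last by rewrite /F wb.
have [s s0 hs] := near_avoid bs w.
have [wb|wb] := boolP (w \in bs).
  have [r r0 [dg gw fg]] := Hg w (bp _ wb).
  have [|d dd] := dg w; first by rewrite subrr cmod0.
  have [e de] := cderivable_prod bs id (pole_mult f) (fun b => b != w) w.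
  eexists; apply: (cdiff_ext (r := Num.min r s)) (cdiffM dd de).
    by rewrite lt_min r0.
  move=> v; rewrite lt_min => /andP[vr vs]; rewrite /F.
  have [->|vw] := eqVneq v w; first by rewrite wb.
  rewrite (negbTE (hs v vs vw)) (QE w) // fg // mulrA divfK //.
  by rewrite expf_neq0 // subr_eq0.
have np : ~ pole f w by move=> pw; move: wb; rewrite (Dp w).
have [/holomorphic_atP[r r0 dr]|//] := mf w.
have [|d dd] := dr w; first by rewrite subrr cmod0.
have [e de] := cderivable_prod bs id (pole_mult f) xpredT w.
eexists; apply: (cdiff_ext (r := s)) (cdiffM dd de) => // v vs; rewrite /F.
have [->|vw] := eqVneq v w; first by rewrite (negbTE wb).
by rewrite (negbTE (hs v vs vw)).
Qed.

(** Extraction of zeros stops because each costs a factor 2/7: |z - x| >= 7 r on the circle |z| = 8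
    r, while |z0 - x| <= 2 r. After n steps |F(z0)| <= 2 M (2/7)^n, which F(z0) <> 0 forbids for
    large n. *)
Lemma factor_zeros F r z0 : 0 < r -> holo (9 * r) F -> cmod z0 < r -> F z0 != 0 ->
  exists a : seq C, exists G, [/\ forall x, x \in a -> cmod x < r, holo (9 * r) G,
    (forall w, F w = G w * \prod_(x <- a) (w - x)) &
    forall w, cmod w < r -> G w != 0].
Proof.
move=> r0 hF z0r Fz0.
pose ok (a : seq C) G := [/\ forall x, x \in a -> cmod x < r, holo (9 * r) G &
    (forall w, F w = G w * \prod_(x <- a) (w - x))].
have r8 : 0 < 8 * r by rewrite mulr_gt0.
have hF8 z : cmod z <= 8 * r -> cderivable F z by move=> zr; apply: hF; lra.
have [M M0 HM] := ccont_bounded (ccont_on_circ (ltW r8) hF8) ler01.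
have bnd (a : seq C) G : ok a G -> cmod (F z0) <= 2 * M * (2 / 7) ^+ size a.
  move=> [ar hG FG].
  have G8 z : cmod z <= 8 * r -> cderivable G z by move=> zr; apply: hG; lra.
  have GM y : 0 <= y <= 1 -> cmod (G (circ (8 * r) y)) <= M / (7 * r) ^+ size a.
    move=> y01; rewrite ler_pdivlMr ?exprn_gt0 ?mulr_gt0 //; apply: le_trans (HM y y01).
    rewrite FG cmodM; apply: ler_wpM2l; first exact: cmod_ge0.
    rewrite cmod_prod; apply: exp_le_prod => [|x xa]; first by rewrite mulr_ge0 // ltW.
    have := cmod_lerB (circ (8 * r) y) x.
    by rewrite cmod_circ ?(ltW r8) //; have := ar x xa; lra.
  have z04 : cmod z0 <= 8 * r / 2 by lra.
  have := cauchy_sup z04 r8 G8 GM => Gz0.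
  rewrite FG cmodM.
  have P : cmod (\prod_(x <- a) (z0 - x)) <= (2 * r) ^+ size a.
    rewrite cmod_prod; apply: prod_le_exp => x xa.
    by rewrite cmod_ge0 /=; have := cmodB z0 x; have := ar x xa; lra.
  apply: le_trans (ler_pM (cmod_ge0 _) (cmod_ge0 _) Gz0 P) _.
  rewrite le_eqVlt; apply/orP; left; apply/eqP.
  rewrite !exprMn exprVn; field.
  by rewrite !expf_neq0 // gt_eqF.
apply: contrapT => nex.
have ext n : exists (a : seq C) G, ok a G /\ size a = n.
  elim: n => [|n [a [G [okG sn]]]].
    exists [::]; exists F; split => //; split => // w; by rewrite big_nil mulr1.
  have [ar hG FG] := okG.
  have [x [xr Gx]] : exists x, cmod x < r /\ G x = 0.
    apply: contrapT => nx; apply: nex; exists a; exists G; split => // w wr.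
    by apply/eqP => Gw; apply: nx; exists w.
  have [|G1 GE dG1] := @divide_zero R G x (8 * r) r8 _ Gx.
    by move=> z zx; apply: hG; have := cmod_lerB z x; lra.
  exists (x :: a); exists G1; split; last by rewrite /= sn.
  split=> [y|z zr|w]; first by rewrite inE => /predU1P[->|/ar].
    by apply: dG1; exact: hG.
  by rewrite big_cons FG GE mulrA [G1 w * _]mulrC.
have q0 : (0 : R) < 2 / 7 by rewrite divr_gt0.
have M1 : 0 < 2 * M + 1 by lra.
have := @cvg_expr R (2 / 7).
rewrite ger0_norm ?(ltW q0) // => /(_ ltac:(lra)) /cvgrPdist_lt.
have e0 : 0 < cmod (F z0) / (2 * M + 1) by rewrite divr_gt0 ?cmod_gt0.
move=> /(_ _ e0)[N _ HN].
have [a [G [okG sn]]] := ext N.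
have := bnd a G okG; rewrite sn; have := HN N (leqnn N).
rewrite /= sub0r normrN ger0_norm ?exprn_ge0 ?(ltW q0) // ltr_pdivlMr //.
have : 0 <= (2 / 7 : R) ^+ N by rewrite exprn_ge0 // ltW.
move: ((2 / 7) ^+ N) => q; nra.
Qed.

Lemma pole_count_seq f t (s : seq C) : uniq s -> (forall x, x \in s -> cmod x <= t) ->
  ((\sum_(x <- s) (pole_mult f x))%:R%:E <= pole_count f t)%E.
Proof.
move=> us st; apply: esum_ge; exists [set` s].
  by split=> [|x /= /st]; [exact: finite_seq|].
by rewrite -fsbig_seq //= sumEFin natr_sum.
Qed.

Lemma poles_in_disc f t (n : R) : (pole_count f t <= n%:E)%E ->
  exists bs : seq C, [/\ uniq bs, forall b, b \in bs -> pole f b,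
    forall b, cmod b <= t -> pole f b -> b \in bs &
    (\sum_(b <- bs) pole_mult f b)%:R <= n].
Proof.
move=> cn.
have key (s : seq C) : uniq s -> (forall x, x \in s -> cmod x <= t /\ pole f x) ->
    (\sum_(b <- s) pole_mult f b)%:R <= n.
  move=> us sp; rewrite -lee_fin; apply: le_trans cn.
  by apply: pole_count_seq => // x /sp[].
have [|bs [ub bP Pb]] := @complete_seq C (fun x => cmod x <= t /\ pole f x) (Num.truncn n).
  move=> s us sp; have := key s us sp => H.
  have s1 : (size s <= \sum_(b <- s) pole_mult f b)%N.
    rewrite -sum1_size big_seq [leqRHS]big_seq; apply: leq_sum => x /sp[_].
    exact: pole_mult_gt0.
  have n0 : 0 <= n by exact: le_trans H.
  rewrite -(ler_nat R) in s1; have := le_trans s1 H.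
  by rewrite -truncn_ge_nat.
exists bs; split => // [b /bP[]//|b h1 h2|]; first exact: Pb.
exact: key.
Qed.

(** Poles are cleared on the disc of radius 9 r that [factor_zeros] requires, so b may contain poles
    of modulus r or more, whereas a stays inside the disc of radius r. Multiplicities are encoded by
    repetition in the lists. *)
Lemma factorization f r (n : R) z0 : meromorphic f -> 0 < r ->
  (pole_count f (9 * r) <= n%:E)%E -> cmod z0 < r -> ~ pole f z0 -> f z0 != 0 ->
  exists (a b : seq C) G, [/\ holo r G, (forall w, cmod w < r -> G w != 0),
    (forall w, w \notin b ->
      f w * \prod_(x <- b) (w - x) = G w * \prod_(x <- a) (w - x)),
    (forall x, x \in b -> pole f x) /\ (forall x, cmod x < r -> pole f x -> x \in b) &
    (size b)%:R <= n /\ (forall x, x \in a -> pole f x \/ f x = 0)].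
Proof.
move=> mf r0 cn z0r npz0 fz0.
have [bs [ubs bp pb bn]] := poles_in_disc cn.
have [F hF FE] := @clear_poles f bs [set w | cmod w <= 9 * r] mf ubs bp pb.
pose b := flatten [seq nseq (pole_mult f x) x | x <- bs].
have inb x : (x \in b) = (x \in bs).
  apply/flattenP/idP => [[s /mapP[y ys ->]]|xs].
    by rewrite mem_nseq => /andP[_ /eqP ->].
  exists (nseq (pole_mult f x) x); first by apply/mapP; exists x.
  by rewrite mem_nseq eqxx pole_mult_gt0 //; exact: bp.
have prodE w : \prod_(x <- b) (w - x) = \prod_(x <- bs) (w - x) ^+ pole_mult f x.
  rewrite /b big_flatten big_map; apply: eq_bigr => x _.
  by rewrite big_nseq; elim: (pole_mult f x) => //= k ->; rewrite exprS.
have prod0 w : w \notin bs -> \prod_(x <- b) (w - x) != 0.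
  move=> wb; rewrite prodf_seq_neq0; apply/allP => x xb /=; rewrite subr_eq0.
  by apply: contraNneq wb => ->; rewrite -inb.
have z0b : z0 \notin bs by apply/negP => /bp.
have Fz0 : F z0 != 0 by rewrite FE // -prodE mulf_neq0 ?prod0.
have [a [G [ar hG FG G0]]] := factor_zeros r0 (fun w wr => hF w (ltW wr)) z0r Fz0.
exists a; exists b; exists G; split => //.
- by move=> z zr; apply: hG; lra.
- by move=> w; rewrite inb => wb; rewrite prodE -FE.
- split=> x; first by rewrite inb; exact: bp.
  by move=> xr px; rewrite inb; apply: pb => //; lra.
- split.
    apply: le_trans bn; rewrite ler_nat /b size_flatten /shape -map_comp sumnE big_map.
    by under eq_bigr do rewrite /= size_nseq.
  move=> x xa; have [xb|xb] := boolP (x \in bs); first by left; exact: bp.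
  right; apply/eqP; have := FE x xb; rewrite FG -prodE => H.
  have : f x * \prod_(x0 <- b) (x - x0) == 0.
    by rewrite -H (big_rem x) //= subrr mul0r mulr0.
  by rewrite mulf_eq0 (negbTE (prod0 x xb)) orbF.
Qed.
End Factorization.

(** * Jensen formula and local growth *)

Section Jensen.
Variable R : realType.
Local Notation C := (Cplx R).
Implicit Types (f G : C -> C) (z w x : C) (r rho : R) (a b s : seq C).

Lemma rcont_lnmod (h : R -> C) : (forall t, exists v, rcdiff h t v) ->
  (forall t, h t != 0) -> rcont (fun t => ln (cmod (h t))).
Proof.
move=> dh h0 t; have [v dv] := dh t.
apply: differentiable_continuous; apply/derivable1_diffP.
by case: (is_derive_lnmod dv (h0 t)).
Qed.

Lemma rcont_sum (I : eqType) (s : seq I) (u : I -> R -> R) :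
  (forall i, i \in s -> rcont (u i)) -> rcont (fun y => \sum_(i <- s) u i y).
Proof.
elim: s => [|i s IH] H.
  by under eq_fun do rewrite big_nil; exact: rcont_cst.
under eq_fun do rewrite big_cons.
apply: rcontD; first by apply: H; rewrite mem_head.
by apply: IH => j js; apply: H; rewrite inE js orbT.
Qed.

Lemma rint_sum (I : eqType) (s : seq I) (u : I -> R -> R) (c d : R) : c <= d ->
  (forall i, i \in s -> rcont (u i)) ->
  rint (fun y => \sum_(i <- s) u i y) c d = \sum_(i <- s) rint (u i) c d.
Proof.
move=> cd; elim: s => [|i s IH] H.
  under eq_fun do rewrite big_nil; by rewrite big_nil rint_cst // mul0r.
under eq_fun do rewrite big_cons.
have Hs j : j \in s -> rcont (u j) by move=> js; apply: H; rewrite inE js orbT.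
by rewrite big_cons rintD ?IH //; [apply: H; rewrite mem_head|exact: rcont_sum].
Qed.

(** The equation is multiplied out and leaves out the points of b, where the value of f may be
    arbitrary. *)
Definition factored f r a b G := [/\ holo r G, forall w, cmod w < r -> G w != 0 &
  forall w, cmod w < r -> w \notin b ->
    f w * \prod_(x <- b) (w - x) = G w * \prod_(x <- a) (w - x)].

Definition lnprod s w := \sum_(x <- s) ln (cmod (w - x)).

Lemma prod_subr_neq0 s w : w \notin s -> \prod_(x <- s) (w - x) != 0.
Proof.
move=> ws; rewrite prodf_seq_neq0; apply/allP => x xs /=; rewrite subr_eq0.
by apply: contraNneq ws => ->.
Qed.

Lemma ln_prod s w : w \notin s -> ln (cmod (\prod_(x <- s) (w - x))) = lnprod s w.
Proof.
elim: s => [|x s IH]; first by rewrite /lnprod !big_nil cmod1 ln1.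
rewrite inE negb_or => /andP[wx ws].
rewrite /lnprod !big_cons cmodM lnM ?posrE ?cmod_gt0 ?subr_eq0 ?prod_subr_neq0 //.
by rewrite IH.
Qed.

Lemma ln_factored f r a b G w : factored f r a b G -> cmod w < r ->
  w \notin a -> w \notin b ->
  f w != 0 /\ ln (cmod (f w)) = ln (cmod (G w)) + lnprod a w - lnprod b w.
Proof.
move=> [hG G0 fE] wr wa wb.
have fw : f w != 0.
  have : f w * \prod_(x <- b) (w - x) != 0.
    by rewrite fE // mulf_neq0 ?G0 ?prod_subr_neq0.
  by rewrite mulf_eq0 negb_or => /andP[].
split => //; apply/eqP; rewrite eq_sym subr_eq -!ln_prod //; apply/eqP.
rewrite -!lnM ?posrE ?cmod_gt0 ?prod_subr_neq0 ?G0 //.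
by rewrite -!cmodM fE.
Qed.

Definition off s rho := forall x, x \in s -> cmod x != rho.

Lemma off_circ s rho y : 0 < rho -> off s rho -> circ rho y \notin s.
Proof.
move=> r0 os; apply/negP => /os; rewrite cmod_circ ?eqxx //; exact: ltW.
Qed.

Lemma rcont_ln_linear x rho : 0 < rho -> cmod x != rho ->
  rcont (fun y => ln (cmod (circ rho y - x))).
Proof.
move=> r0 xr; apply: rcont_lnmod => t.
  by eexists; apply: rcdiffD (rcdiff_circ rho t) (rcdiff_cst (- x) t).
by rewrite subr_eq0; apply: contraNneq xr => <-; rewrite cmod_circ // ltW.
Qed.

Lemma rcont_lnprod s rho : 0 < rho -> off s rho -> rcont (fun y => lnprod s (circ rho y)).
Proof. by move=> r0 os; apply: rcont_sum => x xs; apply: rcont_ln_linear => //; exact: os. Qed.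

Lemma mean_lnprod s rho : 0 < rho -> off s rho ->
  rint (fun y => lnprod s (circ rho y)) 0 1 = \sum_(x <- s) ln (Num.max rho (cmod x)).
Proof.
move=> r0 os; rewrite /lnprod rint_sum //; last first.
  by move=> x xs; apply: rcont_ln_linear => //; exact: os.
rewrite big_seq [RHS]big_seq; apply: eq_bigr => x xs.
by apply: mean_ln_linear => //; exact: os.
Qed.

Definition logmean f rho := rint (fun y => ln (cmod (f (circ rho y)))) 0 1.
(** The proximity function m(rho, f) as a real number, on circles without zeros and poles
    ([nev_proximityE]). *)
Definition logpmean f rho := rint (fun y => Num.max 0 (ln (cmod (f (circ rho y))))) 0 1.

Lemma factored_circ f r a b G rho : factored f r a b G -> 0 < rho -> rho < r ->
  off a rho -> off b rho -> (fun y => ln (cmod (f (circ rho y)))) =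
  (fun y => ln (cmod (G (circ rho y))) + lnprod a (circ rho y) - lnprod b (circ rho y)).
Proof.
move=> fac r0 rr oa ob; apply/funext => y.
have cr : cmod (circ rho y) < r by rewrite cmod_circ // ltW.
by have [_ ->] := ln_factored fac cr (off_circ y r0 oa) (off_circ y r0 ob).
Qed.

Lemma rcont_lnf f r a b G rho : factored f r a b G -> 0 < rho -> rho < r ->
  off a rho -> off b rho -> rcont (fun y => ln (cmod (f (circ rho y)))).
Proof.
move=> fac r0 rr oa ob; rewrite (factored_circ fac) //.
have [hG G0 _] := fac.
apply: rcontB; last exact: rcont_lnprod.
by apply: rcontD; [exact: (rcont_lnG r0 rr)|exact: rcont_lnprod].
Qed.

(** The lists may contain points on either side of the circle, hence the maxima; G(0) appears
    because f may vanish or have a pole at 0. *)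
Lemma jensen f r a b G rho : factored f r a b G -> 0 < rho -> rho < r ->
  off a rho -> off b rho -> logmean f rho = ln (cmod (G 0)) +
  \sum_(x <- a) ln (Num.max rho (cmod x)) - \sum_(x <- b) ln (Num.max rho (cmod x)).
Proof.
move=> fac r0 rr oa ob; rewrite /logmean (factored_circ fac) //.
have [hG G0 _] := fac.
have c1 : rcont (fun y => ln (cmod (G (circ rho y)))) by exact: (rcont_lnG r0 rr).
have c2 := rcont_lnprod r0 oa; have c3 := rcont_lnprod r0 ob.
rewrite rintB //; last exact: rcontD.
by rewrite rintD // !mean_lnprod // (mean_lnG r0 rr hG G0).
Qed.

Lemma rcont_max0 (u : R -> R) : rcont u -> rcont (fun y => Num.max 0 (u y)).
Proof.
move=> cu; have -> : (fun y => Num.max 0 (u y)) = (fun y => (u y + `|u y|) * 2^-1).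
  apply/funext => y; have [h|h] := leP 0 (u y); first by rewrite ger0_norm //; lra.
  by rewrite ltr0_norm //; lra.
by apply: rcontM; [apply: rcontD => //; exact: rcont_norm|exact: rcont_cst].
Qed.

Lemma logmean_le f rho : rcont (fun y => ln (cmod (f (circ rho y)))) ->
  logmean f rho <= logpmean f rho.
Proof.
move=> cf; apply: rint_le => //; first exact: rcont_max0.
by move=> y _; rewrite le_max lexx orbT.
Qed.

Lemma mean_abs (u : R -> R) : rcont u -> rint (fun y => `|u y|) 0 1 =
  2 * rint (fun y => Num.max 0 (u y)) 0 1 - rint u 0 1.
Proof.
move=> cu; have cm := rcont_max0 cu.
rewrite -rintZ // -rintB //; last by apply: rcontM => //; exact: rcont_cst.
apply: rint_eq => y _; have [h|h] := leP 0 (u y); first by rewrite ger0_norm //; lra.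
by rewrite ltr0_norm //; lra.
Qed.

Lemma mean_abs_linear x rho : 1 <= rho -> cmod x < rho ->
  rint (fun y => `|ln (cmod (circ rho y - x))|) 0 1 <= 2 * ln (2 * rho).
Proof.
move=> r1 xr; have r0 : 0 < rho by lra.
have cu : rcont (fun y => ln (cmod (circ rho y - x))).
  by apply: rcont_ln_linear => //; rewrite lt_eqF.
rewrite mean_abs // mean_ln_linear ?lt_eqF // (max_l (ltW xr)).
have lr : 0 <= ln rho by rewrite ln_ge0.
have l2r : 0 <= ln (2 * rho) by rewrite ln_ge0 //; lra.
set I := rint _ 0 1; have : I <= ln (2 * rho) * (1 - 0).
  rewrite -rint_cst //; apply: rint_le; [exact: rcont_max0|exact: rcont_cst|].
  move=> y _; rewrite ge_max l2r /=.
  have h1 : 0 < cmod (circ rho y - x).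
    rewrite cmod_gt0 subr_eq0; apply: contraTneq xr => <-.
    by rewrite cmod_circ ?ltxx // ltW.
  have h2 : 0 < 2 * rho by lra.
  rewrite ler_ln ?posrE //; apply: le_trans (cmodB _ _) _.
  by rewrite cmod_circ ?(ltW r0) //; lra.
lra.
Qed.

Lemma ln_max_diff (r1 r2 c : R) : 0 < r1 -> r1 <= r2 -> 0 <= c ->
  0 <= ln (Num.max r2 c) - ln (Num.max r1 c) <= ln (r2 / r1).
Proof.
move=> r10 r12 c0; have r20 : 0 < r2 by lra.
rewrite ln_div ?posrE //.
have l12 : ln r1 <= ln r2 by rewrite ler_ln ?posrE.
have [cr|rc] := leP c r2; last first.
  by rewrite max_r ?(le_trans r12) ?subrr ?lexx ?subr_ge0 // ltW.
have [cr1|r1c] := leP c r1; first by rewrite subr_ge0 l12 lexx.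
have c0' : 0 < c by exact: lt_trans r1c.
rewrite subr_ge0 ler_ln ?posrE // cr /= lerB // ler_ln ?posrE //; exact: ltW.
Qed.

Lemma sum_le_size (T : eqType) (s : seq T) (E : T -> R) (c : R) :
  (forall x : T, x \in s -> E x <= c) -> \sum_(x <- s) E x <= (size s)%:R * c.
Proof.
elim: s => [|x s IH] H; first by rewrite big_nil mul0r.
rewrite big_cons /= -natr1 mulrDl mul1r addrC; apply: lerD.
  by apply: IH => y ys; apply: H; rewrite inE ys orbT.
by apply: H; rewrite mem_head.
Qed.

(** Subtracting Jensen's formula at two radii eliminates G(0). A zero with |x| <= r2 / 2 contributes
    at least ln 2, as max(r1, |x|) <= r2 / 2; a pole contributes at most ln(r2 / r1). *)
Lemma count_zeros f r a b G (r1 r2 : R) : factored f r a b G ->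
  0 < r1 -> 2 * r1 <= r2 -> r2 < r -> off a r1 -> off b r1 -> off a r2 -> off b r2 ->
  ln 2 * (count (fun x => cmod x <= r2 / 2) a)%:R <=
  logmean f r2 - logmean f r1 + (size b)%:R * ln (r2 / r1).
Proof.
move=> fac r10 r12 r2r oa1 ob1 oa2 ob2.
have r20 : 0 < r2 by lra.
have r1r : r1 < r by lra.
have r12' : r1 <= r2 by lra.
rewrite !(jensen fac) //.
have B : \sum_(x <- b) (ln (Num.max r2 (cmod x)) - ln (Num.max r1 (cmod x))) <=
    (size b)%:R * ln (r2 / r1).
  apply: sum_le_size => x _.
  by have /andP[] := ln_max_diff r10 r12' (cmod_ge0 x).
have A : ln 2 * (count (fun x => cmod x <= r2 / 2) a)%:R <=
    \sum_(x <- a) (ln (Num.max r2 (cmod x)) - ln (Num.max r1 (cmod x))).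
  elim: (a) => [|x s IH]; first by rewrite big_nil mulr0.
  rewrite big_cons /= natrD mulrDr; apply: lerD => //.
  have /andP[h0 _] := ln_max_diff r10 r12' (cmod_ge0 x).
  case: (boolP (cmod x <= r2 / 2)) => [xr|_] /=; last by rewrite mulr0.
  have xr2 : cmod x <= r2 by lra.
  rewrite mulr1 (max_l xr2).
  have m0 : 0 < Num.max r1 (cmod x) by rewrite lt_max r10.
  rewrite -ln_div ?posrE // ler_ln ?posrE ?divr_gt0 // ler_pdivlMr //.
  by rewrite mulrC -ler_pdivlMr // ge_max xr andbT; lra.
rewrite sumrB in A; rewrite sumrB in B.
lra.
Qed.

(** Factors with |x| >= r1 have no zero on |w| < r1 and are absorbed into G. The empty annulus
    leaves all listed points inside the circle of radius rho and makes the new G zero-free slightly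
    beyond it. *)
Lemma factored_filter f r a b G rho r1 : factored f r a b G -> r1 <= r ->
  (forall x, x \in a ++ b -> ~~ (rho <= cmod x < r1)) ->
  exists G', factored f r1 [seq x <- a | cmod x < rho] [seq x <- b | cmod x < rho] G'.
Proof.
move=> [hG G0 fE] r1r gap.
pose far s w := \prod_(x <- s | ~~ (cmod x < rho)) (w - x).
have split_prod s w : \prod_(x <- s) (w - x) = \prod_(x <- [seq x <- s | cmod x < rho]) (w - x) * far s w.
  by rewrite big_filter (bigID (fun x => cmod x < rho)).
have far0 s w : {subset s <= a ++ b} -> cmod w < r1 -> far s w != 0.
  move=> sab wr; rewrite /far prodf_seq_neq0; apply/allP => x xs.
  apply/implyP => xr; rewrite subr_eq0; apply/eqP => E.
  by have := gap x (sab _ xs); rewrite -E wr andbT leNgt E xr.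
have dfar s z : cderivable (far s) z.
  have [d dd] := cderivable_prod s id (fun=> 1%N) (fun x => ~~ (cmod x < rho)) z.
  by exists d; apply: (cdiff_ext (r := 1)) dd.
have suba : {subset a <= a ++ b} by move=> x; rewrite mem_cat => ->.
have subb : {subset b <= a ++ b} by move=> x; rewrite mem_cat orbC => ->.
exists (fun w => G w * far a w / far b w); split.
- move=> z zr; have [d dd] := hG z (lt_le_trans zr r1r).
  have [e de] := dfar a z; have [e' de'] := dfar b z.
  by eexists; exact: cdiffM (cdiffM dd de) (cdiffV (far0 b z subb zr) de').
- move=> w wr; rewrite !mulf_neq0 ?invr_eq0 ?far0 //; apply: G0; lra.
- move=> w wr wb.
  have wb' : w \notin b.
    apply/negP => xb; move: wb; rewrite mem_filter xb andbT -leNgt => xr.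
    by have := gap w (subb _ xb); rewrite xr wr.
  have fb := far0 b w subb wr.
  apply: (mulIf fb); transitivity (f w * \prod_(x <- b) (w - x)).
    by rewrite (split_prod b) mulrA.
  rewrite fE //; last lra.
  by rewrite (split_prod a) [RHS]mulrAC divfK //; ring.
Qed.

(** ln |G| is ln |f| corrected by the logarithms of the factors: |ln |f|| has mean 2 m(rho, f) minus
    the mean of ln |f|, and each factor has mean at most 2 ln(2 rho) in absolute value. *)
Lemma mean_abs_lnG f r a b G rho : factored f r a b G -> 1 <= rho -> rho < r ->
  (forall x, x \in a ++ b -> cmod x < rho) ->
  rint (fun y => `|ln (cmod (G (circ rho y)))|) 0 1 <=
  2 * logpmean f rho - logmean f rho + ((size a)%:R + (size b)%:R) * (2 * ln (2 * rho)).
Proof.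
move=> fac r1 rr lt; have r0 : 0 < rho by lra.
have [hG G0 _] := fac.
have oa : off a rho by move=> x xa; rewrite lt_eqF // lt // mem_cat xa.
have ob : off b rho by move=> x xa; rewrite lt_eqF // lt // mem_cat xa orbT.
have cf := rcont_lnf fac r0 rr oa ob.
have cG : rcont (fun y => ln (cmod (G (circ rho y)))) by exact: (rcont_lnG r0 rr).
have E := factored_circ fac r0 rr oa ob.
pose P s y := \sum_(x <- s) `|ln (cmod (circ rho y - x))|.
have cP s : {subset s <= a ++ b} -> rcont (P s).
  move=> sab; apply: rcont_sum => x xs; apply: rcont_norm; apply: rcont_ln_linear => //.
  by rewrite lt_eqF // lt // sab.
have suba : {subset a <= a ++ b} by move=> x; rewrite mem_cat => ->.
have subb : {subset b <= a ++ b} by move=> x; rewrite mem_cat orbC => ->.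
have mP s : {subset s <= a ++ b} -> rint (P s) 0 1 <= (size s)%:R * (2 * ln (2 * rho)).
  move=> sab; rewrite rint_sum //; last first.
    move=> x xs; apply: rcont_norm; apply: rcont_ln_linear => //.
    by rewrite lt_eqF // lt // sab.
  apply: sum_le_size => x xs; apply: mean_abs_linear => //; exact: lt (sab _ xs).
have Ha := mP a suba; have Hb := mP b subb.
have ca := cP a suba; have cb := cP b subb.
have : rint (fun y => `|ln (cmod (G (circ rho y)))|) 0 1 <=
    rint (fun y => `|ln (cmod (f (circ rho y)))| + P a y + P b y) 0 1.
  have cfn := rcont_norm cf.
  apply: rint_le; first exact: rcont_norm.
    by apply: rcontD => //; exact: rcontD.
  move=> y _; have {E} := congr1 (fun u : R -> R => u y) E => /= ->.
  set g := ln (cmod (G _)).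
  have na : `|lnprod a (circ rho y)| <= P a y by exact: ler_norm_sum.
  have nb : `|lnprod b (circ rho y)| <= P b y by exact: ler_norm_sum.
  have -> : g = (g + lnprod a (circ rho y) - lnprod b (circ rho y)) -
    lnprod a (circ rho y) + lnprod b (circ rho y) by ring.
  apply: le_trans (ler_normD _ _) _; apply: lerD => //.
  apply: le_trans (ler_normB _ _) _; apply: lerD => //.
  rewrite le_eqVlt; apply/orP; left; apply/eqP; congr (`|_|); ring.
have cfn := rcont_norm cf.
rewrite rintD //; last exact: rcontD.
rewrite rintD // (mean_abs cf) -/(logpmean f rho) -/(logmean f rho); lra.
Qed.

Lemma ln_leB1 (p : R) : 0 < p -> ln p <= p - 1.
Proof.
move=> p0; have := @le_ln1Dx R (p - 1); have -> : 1 + (p - 1) = p by ring.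
apply; lra.
Qed.

Lemma ln_ratio_le (p q e : R) : 0 < q -> 0 <= e -> e <= q / 2 -> q - e <= p -> p <= q + e ->
  `|ln p - ln q| <= 2 * (e / q).
Proof.
move=> q0 e0 eq pl pu; have p0 : 0 < p by lra.
rewrite ler_norml -!ln_div ?posrE //; apply/andP; split.
  rewrite lerNl -lnV ?posrE ?divr_gt0 // invf_div.
  have : ln (q / p) <= q / p - 1 by apply: ln_leB1; rewrite divr_gt0.
  move=> /le_trans; apply.
  rewrite lerBlDr ler_pdivrMr // mulrDl mul1r mulrA -lerBlDr.
  have : q - p <= e by lra.
  move=> /le_trans; apply.
  rewrite mulrAC ler_pdivlMr //; nra.
have : ln (p / q) <= p / q - 1 by apply: ln_leB1; rewrite divr_gt0.
move=> /le_trans; apply.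
rewrite lerBlDr ler_pdivrMr // mulrDl mul1r mulrA divfK ?gt_eqF //; lra.
Qed.

(** u serves as the radius of a circle that misses finitely many points, and v gives the empty
    annulus that [factored_filter] needs. *)
Lemma gap_exists (s : seq R) (c d : R) : c < d ->
  exists u v : R, [/\ c < u, u < v, v < d & forall l, l \in s -> ~~ (u <= l < v)].
Proof.
elim: s c d => [|l s IH] c d cd.
  by exists ((2 * c + d) / 3), ((c + 2 * d) / 3); split => //; lra.
have [u [v [cu uv vd H]]] := IH c d cd.
have [lu|ul] := ltP l u.
  exists u, v; split => // m; rewrite inE => /predU1P[->|]; last exact: H.
  by rewrite leNgt lu.
have [vl|lv] := leP v l.
  exists u, v; split => // m; rewrite inE => /predU1P[->|]; last exact: H.
  by rewrite negb_and -leNgt vl orbT.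
exists ((l + v) / 2), v; split => //; try lra.
move=> m; rewrite inE => /predU1P[->|ms]; first by rewrite negb_and -ltNge; apply/orP; left; lra.
by have := H m ms; apply: contra => /andP[h1 ->]; rewrite andbT; lra.
Qed.

(** Two readings of [count_zeros]: bounding the mean at r2 by T limits the number of zeros, and
    dropping the nonnegative count bounds the mean at r2 from below, as the mean of |ln |f||
    requires. *)
Lemma zero_count_bound f r a b G (r1 r2 T D n L : R) : factored f r a b G ->
  0 < r1 -> 2 * r1 <= r2 -> r2 < r -> off a r1 -> off b r1 -> off a r2 -> off b r2 ->
  (size b)%:R <= n -> ln (r2 / r1) <= L -> logpmean f r2 <= T -> - logmean f r1 <= D ->
  ln 2 * (count (fun x => cmod x <= r2 / 2) a)%:R <= T + D + n * L /\
  - logmean f r2 <= D + n * L.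
Proof.
move=> fac r10 r12 r2r oa1 ob1 oa2 ob2 bn lL mT mD.
have r20 : 0 < r2 by lra.
have cnt := count_zeros fac r10 r12 r2r oa1 ob1 oa2 ob2.
have cf := logmean_le (rcont_lnf fac r20 r2r oa2 ob2).
have cnt0 : 0 <= ln (2 : R) * (count (fun x => cmod x <= r2 / 2) a)%:R :> R.
  by apply: mulr_ge0 => //; apply: ln_ge0; rewrite ler1n.
have bL : (size b)%:R * ln (r2 / r1) <= n * L.
  apply: ler_pM => //; apply: ln_ge0; rewrite ler_pdivlMr //; lra.
by split; lra.
Qed.

(** G contributes through its logarithmic derivative, and each factor at most 2 |w - z| / |z - x|,
    since w moves by no more than half the distance from z to x. *)
Lemma filtered_growth f r a b G (rho U : R) : factored f r a b G -> 0 < rho -> rho < r ->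
  rint (fun y => `|ln (cmod (G (circ rho y)))|) 0 1 <= U ->
  forall z w, cmod z <= rho / 2 -> cmod w <= rho / 2 ->
  (forall x, x \in a ++ b -> 0 < cmod (z - x) /\ cmod (w - z) <= cmod (z - x) / 2) ->
  `|ln (cmod (f w)) - ln (cmod (f z))| <= cmod (w - z) *
    (8 / rho * U + 2 * \sum_(x <- a ++ b) (cmod (z - x))^-1).
Proof.
move=> fac r0 rr UG z w zr wr near_s; have [hG G0 _] := fac.
have notin p (s : seq C) : {subset s <= a ++ b} ->
    (forall x, x \in a ++ b -> 0 < cmod (p - x)) -> p \notin s.
  by move=> ss H; apply/negP => /ss/H; rewrite subrr cmod0 ltxx.
have suba : {subset a <= a ++ b} by move=> x; rewrite mem_cat => ->.
have subb : {subset b <= a ++ b} by move=> x; rewrite mem_cat orbC => ->.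
have zx x : x \in a ++ b -> 0 < cmod (z - x) by move=> /near_s[].
have tri x : cmod (z - x) - cmod (w - z) <= cmod (w - x) /\
    cmod (w - x) <= cmod (z - x) + cmod (w - z).
  split.
    have -> : w - x = (z - x) - (z - w) by ring.
    by rewrite (cmodBC w z); exact: cmod_lerB.
  have -> : w - x = (z - x) + (w - z) by ring.
  exact: cmodD.
have wx x : x \in a ++ b -> 0 < cmod (w - x).
  by move=> /near_s[h4 h5]; have [h6 _] := tri x; lra.
have zv : cmod z < r by lra.
have wv : cmod w < r by lra.
have [_ ->] := ln_factored fac wv (notin _ _ suba wx) (notin _ _ subb wx).
have [_ ->] := ln_factored fac zv (notin _ _ suba zx) (notin _ _ subb zx).
have lip := lnG_lip r0 rr hG G0 zr wr.
have prod_lip s : {subset s <= a ++ b} ->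
    `|lnprod s w - lnprod s z| <= cmod (w - z) * (2 * \sum_(x <- s) (cmod (z - x))^-1).
  move=> ss; rewrite /lnprod -sumrB; apply: le_trans (ler_norm_sum _ _ _) _.
  rewrite !mulr_sumr big_seq [leRHS]big_seq; apply: ler_sum => x /ss xs.
  have [h4 h5] := near_s x xs; have [h6 h7] := tri x.
  apply: le_trans (ln_ratio_le h4 (cmod_ge0 _) h5 h6 h7) _.
  by rewrite mulrCA.
have pa := prod_lip a suba; have pb := prod_lip b subb.
have lip' : `|ln (cmod (G w)) - ln (cmod (G z))| <= cmod (w - z) * (8 / rho * U).
  apply: le_trans lip _; rewrite mulrC; apply: ler_wpM2l; first exact: cmod_ge0.
  by apply: ler_wpM2l => //; rewrite divr_ge0 // ltW.
rewrite big_cat /= !mulrDr.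
move: lip' pa pb; clear; set B1 := cmod (w - z) * (_ * U).
set B3 := cmod (w - z) * (2 * \sum_(x <- a) _).
set B4 := cmod (w - z) * (2 * \sum_(x <- b) _).
set gw := ln (cmod (G w)); set gz := ln (cmod (G z)).
move: (lnprod a w) (lnprod a z) (lnprod b w) (lnprod b z) => p q p' q'.
move=> H4 H6 H7.
have -> : gw + p - p' - (gz + q - q') = (gw - gz) + (p - q) - (p' - q') by ring.
apply: le_trans (ler_normB _ _) _; rewrite [leRHS]addrA; apply: lerD => //.
by apply: le_trans (ler_normD _ _) _; exact: lerD.
Qed.

(** f is factored on |w| < 16 X, which by [factorization] needs the pole count at 9 * 16 X = 144 X.
    The fixed circle of radius r1 is compared with two circles of radius comparable to X, and D
    bounds the fixed mean. *)
Lemma local_growth f X n T D r1 z0 : meromorphic f -> 4 <= X -> 0 <= n ->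
  (pole_count f (144 * X) <= n%:E)%E -> cmod z0 < X -> ~ pole f z0 -> f z0 != 0 ->
  1 <= r1 <= 2 -> (forall w, cmod w = r1 -> ~ pole f w /\ f w != 0) ->
  - logmean f r1 <= D ->
  (forall rho, 6 * X <= rho <= 16 * X -> rcont (fun y => ln (cmod (f (circ rho y)))) ->
     (forall y, f (circ rho y) != 0) -> logpmean f rho <= T) ->
  let L := ln (32 * X) in let A := (T + D + n * L) / ln 2 in
  exists s : seq C, [/\ (size s)%:R <= A + n,
    forall x, cmod x < 6 * X -> pole f x \/ f x = 0 -> x \in s &
    forall z w, cmod z <= 3 * X -> cmod w <= 3 * X ->
      (forall x, x \in s -> 0 < cmod (z - x) /\ cmod (w - z) <= cmod (z - x) / 2) ->
      `|ln (cmod (f w)) - ln (cmod (f z))| <= cmod (w - z) *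
        (8 / (6 * X) * (2 * T + D + n * L + (A + n) * (2 * L)) +
         2 * \sum_(x <- s) (cmod (z - x))^-1)].
Proof.
move=> mf X4 n0 pc z0X npz0 fz0 /andP[r11 r12] fr1 JD mT L A.
have num (p v q : R) : 6 * X < p -> p < v -> v < 7 * X -> 14 * X < q -> q < 15 * X ->
  [/\ [/\ 0 < r1, 2 * r1 <= p, 2 * r1 <= q, q < 16 * X & p < 16 * X],
    [/\ 6 * X <= q <= 16 * X, 6 * X <= p <= 16 * X, v <= 16 * X & p <= q / 2],
    [/\ 0 < p, 1 <= p, 0 < q, 3 * X <= p / 2 & 6 * X <= p] &
    [/\ 0 < p / r1, 0 < q / r1, p / r1 <= 32 * X, q / r1 <= 32 * X & 2 * p <= 32 * X]].
  move=> h1 h2 h3 h4 h5.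
  have r10 : 0 < r1 by lra.
  have p0 : 0 < p by lra.
  have q0 : 0 < q by lra.
  split; [by split; lra|by split; lra|by split; lra|split; [exact: divr_gt0|exact: divr_gt0| | |lra]].
    by rewrite ler_pdivrMr //; nra.
  by rewrite ler_pdivrMr //; nra.
have L0 : 0 <= L by rewrite /L; apply: ln_ge0; lra.
have ln20 : 0 < ln (2 : R) by rewrite ln_gt0 // ltr1n.
have X32 : 0 < 32 * X by lra.
have z0r : cmod z0 < 16 * X by lra.
have X16 : 0 < 16 * X by lra.
have X6 : 6 * X < 7 * X by lra.
have X14 : 14 * X < 15 * X by lra.
have x616 x : cmod x < 6 * X -> cmod x < 16 * X by move=> h; lra.
have pc' : (pole_count f (9 * (16 * X)) <= n%:E)%E.
  by have -> : 9 * (16 * X) = 144 * X by ring.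
have [a [b [G [hG G0 fE [bp pb] [bn ap]]]]] := factorization mf X16 pc' z0r npz0 fz0.
have fac : factored f (16 * X) a b G by split => // w _; exact: fE.
have oa1 : off a r1.
  move=> x /ap H; apply/eqP => /fr1[np fx]; case: H => // f0.
  by move: fx; rewrite f0 eqxx.
have ob1 : off b r1 by move=> x /bp px; apply/eqP => /fr1[].
(* The outer circle q counts zeros up to q / 2 > 7 X, hence all those inside the inner circle p < 7
   X; the inner one satisfies p / 2 >= 3 X, so the bound on G'/G covers |z| <= 3 X. *)
have [q [v2 [h1 h2 h3 H2]]] := gap_exists (map (@cmod R) (a ++ b)) X14.
have [p [v [k1 k2 k3 H3]]] := gap_exists (map (@cmod R) (a ++ b)) X6.
have [[r10 rp rq q16 p16] [q616 p616 v16 pq] [p0 p1 q0 X3p X6p]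
  [pr0 qr0 prX qrX p2X]] := num p v q k1 k2 k3 h1 (lt_trans h2 h3).
have mT' u : 6 * X <= u <= 16 * X -> u < 16 * X -> 0 < u -> off a u -> off b u -> logpmean f u <= T.
  move=> uX uX' u0 oa ob; apply: mT => //; first exact: rcont_lnf fac u0 uX' oa ob.
  move=> y; have cr : cmod (circ u y) < 16 * X by rewrite cmod_circ // ltW.
  by have [] := ln_factored fac cr (off_circ y u0 oa) (off_circ y u0 ob).
have offs u (w : R) s : u < w -> {subset s <= a ++ b} ->
    (forall l, l \in map (@cmod R) (a ++ b) -> ~~ (u <= l < w)) -> off s u.
  move=> uw sab H x xs; apply/eqP => xu; have := H (cmod x) (map_f _ (sab _ xs)).
  by rewrite xu lexx uw.
have suba : {subset a <= a ++ b} by move=> x; rewrite mem_cat => ->.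
have subb : {subset b <= a ++ b} by move=> x; rewrite mem_cat orbC => ->.
have oa2 := offs _ _ _ h2 suba H2; have ob2 := offs _ _ _ h2 subb H2.
have oa := offs _ _ _ k2 suba H3; have ob := offs _ _ _ k2 subb H3.
have T2 := mT' q q616 q16 q0 oa2 ob2; have T3 := mT' p p616 p16 p0 oa ob.
have lnp : ln (p / r1) <= L by rewrite /L ler_ln ?posrE.
have lnq : ln (q / r1) <= L by rewrite /L ler_ln ?posrE.
have [cnt _] := zero_count_bound fac r10 rq q16 oa1 ob1 oa2 ob2 bn lnq T2 JD.
have [_ lm] := zero_count_bound fac r10 rp p16 oa1 ob1 oa ob bn lnp T3 JD.
have gap x : x \in a ++ b -> ~~ (p <= cmod x < v) by move=> xs; apply: H3; exact: map_f.
have [G' fac'] := factored_filter fac v16 gap.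
set a' := [seq x <- a | cmod x < p] in fac'.
set b' := [seq x <- b | cmod x < p] in fac'.
have lt' x : x \in a' ++ b' -> cmod x < p.
  by rewrite mem_cat !mem_filter => /orP[] /andP[].
have sa' : (size a')%:R <= A.
  rewrite /A ler_pdivlMr // mulrC; apply: le_trans cnt.
  apply: ler_wpM2l; first exact: ltW.
  rewrite ler_nat size_filter; apply: sub_count => x /= xr.
  by apply: le_trans pq; exact: ltW.
have sb' : (size b')%:R <= n.
  by apply: le_trans bn; rewrite ler_nat size_filter count_size.
have U := mean_abs_lnG fac' p1 k2 lt'.
have U1 : rint (fun y => `|ln (cmod (G' (circ p y)))|) 0 1 <=
    2 * T + D + n * L + (A + n) * (2 * L).
  apply: le_trans U _; apply: lerD.
    by move: T3 lm; clear; lra.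
  have l0 : 0 <= ln (2 * p) by apply: ln_ge0; move: p1; clear; lra.
  apply: ler_pM; [by rewrite addr_ge0|by rewrite mulr_ge0|exact: lerD|].
  by apply: ler_wpM2l => //; rewrite /L ler_ln ?posrE // mulr_gt0.
exists (a' ++ b'); split.
- by rewrite size_cat natrD lerD.
- move=> x x6 px; rewrite mem_cat !mem_filter (lt_le_trans x6 X6p) /=.
  have [xb|xb] := boolP (x \in b); first by rewrite orbT.
  case: px => [px|fx]; first by move: xb; rewrite pb //; exact: x616.
  have := fE x xb; rewrite fx mul0r => /esym/eqP.
  rewrite mulf_eq0 (negbTE (G0 x (x616 x x6))) /= orbF; apply: contraLR => xa.
  exact: prod_subr_neq0.
- move=> z w z3 w3 near_s.
  apply: le_trans (filtered_growth fac' p0 k2 U1 (le_trans z3 X3p) (le_trans w3 X3p) near_s) _.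
  apply: ler_wpM2l; first exact: cmod_ge0.
  rewrite lerD2r; apply: ler_wpM2r.
    by apply: le_trans U1; apply: Rintegral_ge0 => y _; exact: normr_ge0.
  apply: ler_wpM2l => //; rewrite lef_pV2 ?posrE // mulr_gt0 //.
  by move: X4; clear; lra.
Qed.
End Jensen.

(** * Bounds from the order *)

Section Nevanlinna.
Variable R : realType.
Local Notation C := (Cplx R).
Local Notation mu := (@lebesgue_measure R).
Implicit Types (f : C -> C) (r t rho : R).

Lemma rint_FTC_on (F f : R -> R) (a b : R) : a <= b -> rcont f ->
  (forall x : R, a <= x <= b -> is_derive x (1 : R) F (f x)) -> rint f a b = F b - F a.
Proof.
move=> ab cf dF; have [<-|ne] := eqVneq a b.
  by rewrite /rint set_itv1 Rintegral_set1 subrr.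
have altb : a < b by rewrite lt_neqAle ne ab.
have cF x : a <= x <= b -> {for x, continuous (F : R^o -> R^o)}.
  by move=> /dF dx; apply: differentiable_continuous; apply/derivable1_diffP; case: dx.
rewrite /rint /Rintegral (@continuous_FTC2 R f F a b altb) //.
- exact: continuous_subspaceT.
- split.
  + by move=> x; rewrite in_itv /= => /andP[? ?]; case: (dF x _) => //; rewrite !ltW.
  + by apply: cvg_at_right_filter; apply: cF; rewrite lexx.
  + by apply: cvg_at_left_filter; apply: cF; rewrite lexx ab.
- move=> x; rewrite in_itv /= => /andP[? ?]; rewrite derive1E.
  by case: (dF x _) => //; rewrite !ltW.
Qed.

Lemma rint_scale (h : R -> R) (c : R) : 0 < c -> rcont h ->
  rint (fun t => h (t / c)) 0 c = c * rint h 0 1.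
Proof.
(* Starting the primitive at -1 makes it differentiable at the endpoint 0 as well. *)
move=> c0 ch; pose P x := rint h (-1) x.
have dP (x : R) : -1 < x -> is_derive x (1 : R) P (h x).
  move=> x1; have xx : x < x + 1 by rewrite ltrDl.
  have [|dx E] := @continuous_FTC1 R h (BLeft (-1)) x (x + 1) xx
    (rcont_integrable (-1) (x + 1) ch) _ (ch x).
    by rewrite /= lte_fin.
  by split; [exact: dx|rewrite -derive1E; exact: E].
have E1 : rint h 0 1 = P 1 - P 0.
  by apply: rint_FTC_on => // x /andP[x0 _]; apply: dP; lra.
rewrite E1 mulrBr.
have dQ (x : R) : 0 <= x <= c -> is_derive x (1 : R) (fun t => c * P (t / c)) (h (x / c)).
  move=> /andP[x0 _].
  have xc : -1 < x / c by apply: (@lt_le_trans _ _ 0); [lra|rewrite divr_ge0 // ltW].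
  have D : is_derive x (1 : R) (fun t : R => t / c) c^-1.
    have := is_deriveM (is_derive_id x (1:R)) (is_derive_cst (c^-1 : R) x (1:R)).
    by move=> /is_derive_eq; apply; rewrite /GRing.scale /=; ring.
  have := is_deriveZ c (@is_derive1_comp R P (fun t => t / c) x _ _ (dP _ xc) D).
  move=> /is_derive_eq; apply; rewrite /GRing.scale /= mulrCA divff ?mulr1 // gt_eqF //.
have cg : rcont (fun t => h (t / c)).
  by apply: (rcont_comp ch); apply: rcontM; [exact: rcont_id|exact: rcont_cst].
by rewrite (rint_FTC_on (ltW c0) cg dQ) divff ?gt_eqF // mul0r.
Qed.

Lemma logp_ge0 (x : \bar R) : (0 <= logp x)%E.
Proof. by rewrite /logp le_max lexx. Qed.

Lemma logpE (x : R) : 0 < x -> logp x%:E = (Num.max 0 (ln x))%:E.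
Proof. by move=> x0; rewrite /logp lne_EFin // EFin_max. Qed.

Lemma nev_proximity_ge0 f r : (0 <= nev_proximity f r)%E.
Proof.
apply: mule_ge0; first by rewrite lee_fin invr_ge0 mulr_ge0 // pi_ge0.
by apply: integral_ge0 => t _; exact: logp_ge0.
Qed.

Lemma nev_proximityE f rho : rcont (fun y => ln (cmod (f (circ rho y)))) ->
  (forall y, f (circ rho y) != 0) -> nev_proximity f rho = (logpmean f rho)%:E.
Proof.
move=> cf f0; have p0 : (0 : R) < 2 * pi by rewrite mulr_gt0 // pi_gt0.
pose h (y : R) : R := Num.max 0 (ln (cmod (f (circ rho y)))).
have ch : rcont h by exact: rcont_max0.
have cg : rcont (fun t => h (t / (2 * pi))).
  by apply: (rcont_comp ch); apply: rcontM; [exact: rcont_id|exact: rcont_cst].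
rewrite /nev_proximity.
have -> : (\int[mu]_(t in `[0%R, (2 * pi)%R]) logp (cmod (f (circle_pt rho t)))%:E =
    (rint (fun t => h (t / (2 * pi)))%R 0%R (2 * pi)%R)%:E)%E.
  rewrite /rint /Rintegral fineK; last first.
    by apply: integrable_fin_num => //; exact: rcont_integrable.
  apply: eq_integral => t _; rewrite circle_ptE.
  have -> : rc rho * cis t = circ rho (t / (2 * pi)).
    by rewrite /circ /cic mulrC [2 * pi * _]mulrC divfK ?gt_eqF // mulrC.
  by rewrite logpE // cmod_gt0.
by rewrite rint_scale // -EFinM mulrA mulVf ?mul1r ?gt_eqF.
Qed.

(** Immediate from the integral as a supremum over simple functions; in this form it applies
    directly to integrands containing [pole_count]. *)
Lemma le_integral_restrict (D1 D2 : set R) (g1 g2 : R -> \bar R) :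
  (forall x, D1 x -> 0 <= g1 x)%E -> (forall x, D2 x -> 0 <= g2 x)%E ->
  D1 `<=` D2 -> (forall x, D1 x -> g1 x <= g2 x)%E ->
  (\int[mu]_(x in D1) g1 x <= \int[mu]_(x in D2) g2 x)%E.
Proof.
move=> g10 g20 D12 g12; rewrite !ge0_integralE //.
apply: ereal_sup_le => _ [h hg <-]; exists h => // x.
apply: le_trans (hg x) _; rewrite /patch; case: ifPn => [/set_mem xD1|_].
  by rewrite ifT ?g12 //; apply: mem_set; exact: D12.
by case: ifPn => // /set_mem; exact: g20.
Qed.

Lemma pole_count0 f : pole_count f 0 = ((pole_mult f 0)%:R)%:E.
Proof.
rewrite /pole_count; have -> : [set z : C | cmod z <= 0] = [set 0].
  apply/seteqP; split=> z /=; last by move=> ->; rewrite cmod0.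
  by move=> z0; apply/eqP; rewrite -cmod_eq0 eq_le z0 cmod_ge0.
by rewrite esum_set1 // lee_fin.
Qed.

Lemma pole_count_mono f (s t : R) : s <= t -> (pole_count f s <= pole_count f t)%E.
Proof.
move=> st; apply: ereal_sup_le => _ [A [fA As] <-]; exists A => //; split => //.
by move=> z /As /= /le_trans; apply.
Qed.

Lemma pole_count_ge0 f t : (0 <= pole_count f t)%E.
Proof. by apply: esum_ge0 => z _; rewrite lee_fin. Qed.

Lemma counting_integrand_ge0 f t : 0 < t ->
  (0 <= (pole_count f t - pole_count f 0) * (t^-1)%:E)%E.
Proof.
move=> t0; apply: mule_ge0; last by rewrite lee_fin invr_ge0 ltW.
by rewrite pole_count0 sube_ge0 // -pole_count0 pole_count_mono // ltW.
Qed.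

(** On [r, 2 r], of length r, the integrand is at least (n(r) - n(0)) / (2 r). *)
Lemma nev_counting_ge f r : 1 <= r ->
  ((pole_count f r - pole_count f 0) * (2^-1)%:E <= nev_counting f (2 * r))%E.
Proof.
move=> r1; have r0 : 0 < r by lra.
rewrite /nev_counting -[leLHS]adde0; apply: leeD; last first.
  by apply: mule_ge0; rewrite ?pole_count_ge0 // lee_fin ln_ge0 //; lra.
have -> : ((pole_count f r - pole_count f 0) * (2^-1)%:E =
  \int[mu]_(t in `[r, (2 * r)%R]) ((pole_count f r - pole_count f 0%R) * ((2 * r)^-1)%:E))%E.
  rewrite integral_cst //= lebesgue_measure_itv /= lte_fin ifT; last by lra.
  rewrite -EFinB -muleA -EFinM; congr (_ * _%:E)%E; field; exact: lt0r_neq0.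
apply: le_integral_restrict => [x _|x /=|x /=|x /=]; rewrite ?in_itv /=.
- apply: mule_ge0; last by rewrite lee_fin invr_ge0; lra.
  by rewrite pole_count0 sube_ge0 // -pole_count0 pole_count_mono // ltW.
- by move=> /andP[x0 _]; exact: counting_integrand_ge0.
- move=> /andP[rx x2]; apply/andP; split => //; lra.
- move=> /andP[rx x2]; apply: lee_pmul.
  + by rewrite pole_count0 sube_ge0 // -pole_count0 pole_count_mono // ltW.
  + by rewrite lee_fin invr_ge0; lra.
  + by rewrite leeB // pole_count_mono.
  + by rewrite lee_fin lef_pV2 ?posrE //; lra.
Qed.

Lemma nev_counting_ge0 f r : 1 <= r -> (0 <= nev_counting f r)%E.
Proof.
move=> r1; apply: adde_ge0.
  by apply: integral_ge0 => t /=; rewrite in_itv /= => /andP[t0 _]; exact: counting_integrand_ge0.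
by apply: mule_ge0; rewrite ?pole_count_ge0 // lee_fin ln_ge0.
Qed.

Lemma logpmean_le_char f rho (B : R) : 1 <= rho ->
  rcont (fun y => ln (cmod (f (circ rho y)))) -> (forall y, f (circ rho y) != 0) ->
  (nev_char f rho <= B%:E)%E -> logpmean f rho <= B.
Proof.
move=> r1 cf f0 TB; rewrite -lee_fin -nev_proximityE //; apply: le_trans TB.
by rewrite /nev_char leeDl // nev_counting_ge0.
Qed.

Lemma pole_count_le_char f r (B : R) : 1 <= r -> (nev_char f (2 * r) <= B%:E)%E ->
  (pole_count f r <= ((pole_mult f 0)%:R + 2 * B)%:E)%E.
Proof.
move=> r1 TB; have H : ((pole_count f r - pole_count f 0) * (2^-1)%:E <= B%:E)%E.
  apply: le_trans (nev_counting_ge f r1) _; apply: le_trans TB.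
  by rewrite /nev_char leeDr // nev_proximity_ge0.
have {}H : (pole_count f r - pole_count f 0 <= (2 * B)%:E)%E.
  rewrite -(@lee_pmul2r _ (2^-1)%:E) ?lte_fin ?invr_gt0 //.
  by rewrite -EFinM mulrC mulKf ?pnatr_eq0.
have fin : pole_count f 0 \is a fin_num by rewrite pole_count0.
by rewrite EFinD -pole_count0 -leeBlDl.
Qed.

Lemma nev_order_ge0 f (sigma : R) : nev_order f = sigma%:E -> 0 <= sigma.
Proof.
move=> H; rewrite -lee_fin -H; apply: le_ereal_inf_tmp => _ [V Vy <-].
have [x Vx x1] : exists2 x, V x & 1 < x.
  have [A [_ HA]] := Vy; exists (Num.max A 1 + 1).
    by apply: HA; rewrite (@le_lt_trans _ _ (Num.max A 1)) ?le_max ?lexx // ltrDl.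
  by rewrite (@le_lt_trans _ _ (Num.max A 1)) ?le_max ?lexx ?orbT // ltrDl.
apply: (@le_trans _ _ (logp (nev_char f x) * ((ln x)^-1)%:E)%E).
  by apply: mule_ge0; [exact: logp_ge0|rewrite lee_fin invr_ge0 ln_ge0 // ltW].
by apply: ereal_sup_ubound; exists x.
Qed.

Lemma nev_char_le f (sigma s : R) : nev_order f = sigma%:E -> sigma < s ->
  exists2 A : R, 1 < A & forall r, A < r -> (nev_char f r <= (r `^ s)%:E)%E.
Proof.
move=> H ss; have s0 : 0 <= s by rewrite (le_trans (nev_order_ge0 H)) // ltW.
have : (limf_esup (fun r : R => logp (nev_char f r) * ((ln r)^-1)%:E) +oo%R < s%:E)%E.
  by rewrite -/(nev_order f) H lte_fin.
move=> /ereal_inf_lt[_ [V [A [_ HA]] <-] supV].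
exists (Num.max A 1 + 1); first by rewrite (@le_lt_trans _ _ (Num.max A 1)) ?le_max ?lexx ?orbT // ltrDl.
move=> r rA; have mr : Num.max A 1 < r by apply: lt_trans rA; rewrite ltrDl.
have Ar : A < r by apply: le_lt_trans mr; rewrite le_max lexx.
have r1 : 1 < r by apply: le_lt_trans mr; rewrite le_max lexx orbT.
have lr : 0 < ln r by rewrite ln_gt0.
have : (logp (nev_char f r) * ((ln r)^-1)%:E < s%:E)%E.
  by apply: le_lt_trans supV; apply: ereal_sup_ubound; exists r => //; exact: HA.
rewrite lte_pdivrMr // -EFinM.
(* The characteristic is a priori an extended real; the value +oo is excluded because its [logp] is
   +oo. *)
case: (nev_char f r) => [x| |] //= lx; last by rewrite leNye.
  rewrite lee_fin; have [x0|x0] := leP x 0; first by apply: le_trans x0 _; exact: powR_ge0.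
  move: lx; rewrite logpE // lte_fin => lx.
  rewrite /powR gt_eqF ?(lt_trans _ r1) // -ler_ln ?posrE ?expR_gt0 // expRK.
  by apply: ltW; apply: le_lt_trans lx; rewrite le_max lexx orbT.
by move: lx; rewrite /logp /= /Order.max lt0y ltNge leey.
Qed.
End Nevanlinna.

(** * Differences *)

Section Differences.
Variable R : realType.
Local Notation C := (Cplx R).
Implicit Types (f g e : C -> C) (z w eta : C) (k : nat).

Lemma fdiffnS eta k f z :
  fdiffn eta k.+1 f z = fdiffn eta k f (z + eta) - fdiffn eta k f z.
Proof. by []. Qed.

Lemma fdiffn_bound eta k e z (B : R) :
  (forall j, (j <= k)%N -> cmod (e (z + eta *+ j)) <= B) ->
  cmod (fdiffn eta k e z) <= 2 ^+ k * B.
Proof.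
elim: k z => [|k IH] z H.
  by have := H 0%N isT; rewrite mulr0n addr0 expr0 mul1r.
rewrite fdiffnS; apply: le_trans (cmodB _ _) _.
have h1 : cmod (fdiffn eta k e (z + eta)) <= 2 ^+ k * B.
  by apply: IH => j jk; rewrite -addrA -mulrS; exact: H.
have h2 : cmod (fdiffn eta k e z) <= 2 ^+ k * B.
  by apply: IH => j jk; apply: H; exact: leqW.
rewrite exprS -mulrA; lra.
Qed.

Lemma fdiffnD eta k f g z :
  fdiffn eta k (fun w => f w + g w) z = fdiffn eta k f z + fdiffn eta k g z.
Proof.
elim: k z => [//|k IH] z; rewrite !fdiffnS !IH; ring.
Qed.

Lemma fdiffn_shift eta k f z :
  fdiffn eta k (fun w => f (z + w)) 0 = fdiffn eta k f z.
Proof.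
suff H u : fdiffn eta k (fun w => f (z + w)) u = fdiffn eta k f (z + u).
  by rewrite H addr0.
by elim: k u => [//|k IH] u; rewrite !fdiffnS !IH addrA.
Qed.

(** By Taylor's formula for polynomials, only the first-derivative term reaches degree n in p(u +
    eta) - p(u). *)
Lemma fdiff_poly eta (p : {poly C}) n : (size p <= n.+2)%N ->
  exists2 q : {poly C}, (size q <= n.+1)%N /\ q`_n = n.+1%:R * eta * p`_n.+1 &
    forall u, q.[u] = p.[u + eta] - p.[u].
Proof.
move=> sp; exists (\sum_(i < n.+1) eta ^+ i.+1 *: p^`N(i.+1)).
  have cE j : (\sum_(i < n.+1) eta ^+ i.+1 *: p^`N(i.+1))`_j =
      \sum_(i < n.+1) eta ^+ i.+1 * (p`_(i.+1 + j) *+ 'C(i.+1 + j, i.+1)).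
    by rewrite coef_sum; apply: eq_bigr => i _; rewrite coefZ coef_nderivn.
  split.
    apply/leq_sizeP => j nj; rewrite cE big1 // => i _.
    by rewrite nth_default ?mul0rn ?mulr0 // (leq_trans sp) // addSn ltnS (leq_trans nj) ?leq_addl.
  rewrite cE big_ord_recl big1 ?addr0 /=; last first.
    move=> i _; rewrite nth_default ?mul0rn ?mulr0 // (leq_trans sp) // /bump /=.
    by rewrite !addSn add0n !ltnS leq_addl.
  rewrite expr1 add1n bin1 -mulr_natr; ring.
move=> u; have := @nderiv_taylor_wide C n.+2 p u eta (mulrC _ _) sp.
move=> ->; rewrite [X in _ = X - _]big_ord_recl expr0 mulr1 nderivn0 addrC addKr.
rewrite horner_sum; apply: eq_bigr => i _.
by rewrite hornerZ mulrC.
Qed.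

Lemma fdiffn_poly eta k (p : {poly C}) z : (size p <= k.+1)%N ->
  fdiffn eta k (horner p) z = k`!%:R * eta ^+ k * p`_k.
Proof.
elim: k p => [|k IH] p sp.
  have [a ->] : exists a : C, p = a%:P by exists p`_0; exact: size1_polyC.
  by rewrite -[LHS]/(a%:P.[z]) hornerC coefC /= fact0 expr0 !mul1r.
have [q [sq qk] qE] := fdiff_poly eta sp.
have -> : fdiffn eta k.+1 (horner p) z = fdiffn eta k (fdiff eta (horner p)) z.
  by rewrite /fdiffn iterSr.
have -> : fdiff eta (horner p) = horner q by apply/funext => u; rewrite qE.
rewrite IH // qk factS natrM exprS; ring.
Qed.

(** The Taylor polynomial of degree k contributes k! eta^k p_k = eta^k f^(k)(z) exactly, so the
    error is the k-th difference of the remainder at the points z + j eta, all within rho / 2 of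
    z. *)
Lemma difference_estimate eta k f z (rho M : R) : 0 < rho ->
  (forall w, cmod (w - z) <= rho -> cderivable f w) ->
  (forall w, cmod (w - z) <= rho -> cmod (f w) <= M) ->
  k%:R * cmod eta <= rho / 2 ->
  cmod (fdiffn eta k f z - eta ^+ k * derive1n k f z) <=
    2 ^+ k * (2 * M * (k%:R * cmod eta) ^+ k.+1) / rho ^+ k.+1.
Proof.
move=> r0 df fM ke; have [p sp Hp] := taylor k.+1 r0 df fM.
have M0 : 0 <= M.
  by apply: le_trans (fM z _); rewrite ?cmod_ge0 // subrr cmod0 ltW.
have rk : 0 < rho ^+ k.+1 by exact: exprn_gt0.
have B0 : 0 <= 2 * M / rho ^+ k.+1 by rewrite divr_ge0 ?mulr_ge0 // ltW.
have Hp' w : cmod w <= rho / 2 ->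
    cmod (f (z + w) - p.[w]) <= 2 * M / rho ^+ k.+1 * cmod w ^+ k.+1.
  by move=> /Hp /le_trans; apply; rewrite exprMn exprVn mulrA mulrAC.
have r2 : 0 < rho / 2 by rewrite divr_gt0.
have df' w : cmod (w - z) < rho -> cderivable f w by move=> /ltW; exact: df.
rewrite (derive1n_expansion r0 r2 B0 df' Hp').
pose e w := f (z + w) - p.[w].
have -> : fdiffn eta k f z = fdiffn eta k e 0 + k`!%:R * eta ^+ k * p`_k.
  rewrite -(fdiffn_poly eta 0 sp) -fdiffnD -(fdiffn_shift eta k f z).
  by congr (fdiffn eta k _ 0); apply/funext => w; rewrite /e subrK.
have -> : fdiffn eta k e 0 + k`!%:R * eta ^+ k * p`_k - eta ^+ k * (k`!%:R * p`_k) =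
  fdiffn eta k e 0 by ring.
rewrite -mulrA; apply: fdiffn_bound => j jk; rewrite add0r.
have je : cmod (eta *+ j) <= k%:R * cmod eta.
  have -> : eta *+ j = rc j%:R * eta by rewrite /rc rmorph_nat mulr_natl.
  rewrite cmodM cmod_rc ger0_norm //; apply: ler_wpM2r; first exact: cmod_ge0.
  by rewrite ler_nat.
apply: le_trans (Hp' _ (le_trans je ke)) _.
rewrite [leRHS]mulrAC; apply: ler_wpM2l => //.
by apply: lerXn2r => //; rewrite nnegrE ?cmod_ge0 // mulr_ge0 ?cmod_ge0.
Qed.
End Differences.

(** * The exceptional set *)

Section Exceptional.
Variable R : realType.
Local Notation C := (Cplx R).
Local Notation mu := (@lebesgue_measure R).

(** The summand 1 removes the non-integrable singularity of 1 / |r - c|; only moduli enter, so the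
    exceptional set is a set of radii. *)
Definition hat (c r : R) : R := (1 + `|r - c|)^-1.

Lemma hat_gt0 c r : 0 < hat c r.
Proof. by rewrite invr_gt0 ltr_wpDr. Qed.

Lemma rcont_hat c : rcont (hat c).
Proof.
have cn : rcont (fun r => 1 + `|r - c|).
  apply: rcontD; first exact: rcont_cst.
  by apply: rcont_norm; apply: rcontB; [exact: rcont_id|exact: rcont_cst].
move=> r; apply: (@continuousV _ _ (fun r : R^o => 1 + `|r - c| : R^o)); last exact: cn.
by rewrite gt_eqF // ltr_wpDr.
Qed.

Lemma is_derive_ln_affine (p q x : R) : 0 < p + q * x ->
  is_derive x (1 : R) (fun t => ln (p + q * t)) (q / (p + q * x)).
Proof.
move=> h; have D : is_derive x (1 : R) (fun t : R => p + q * t) q.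
  have := is_deriveD (is_derive_cst p x (1:R))
    (is_deriveM (is_derive_cst q x (1:R)) (is_derive_id x (1:R))).
  by move=> /is_derive_eq; apply; rewrite /GRing.scale /=; ring.
have := @is_derive1_comp R (@ln R) (fun t => p + q * t) x _ _ (is_derive1_ln h) D.
by move=> /is_derive_eq; apply; rewrite mulrC.
Qed.

Lemma int_hat_inside (a b c : R) : a <= c -> c <= b ->
  rint (hat c) a b <= 2 * ln (1 + (b - a)).
Proof.
move=> ac cb; rewrite (rint_cat (@rcont_hat c) ac cb).
have d1 (x : R) : a <= x <= c ->
    is_derive x (1 : R) (fun t => - ln (1 + c + -1 * t)) (hat c x).
  move=> /andP[ax xc]; have h : 0 < 1 + c + -1 * x by lra.
  have := is_deriveN (is_derive_ln_affine h); move=> /is_derive_eq; apply.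
  rewrite /hat ler0_norm; last by lra.
  have -> : 1 + c + -1 * x = 1 - (x - c) by ring.
  by rewrite mulN1r opprK.
have d2 (x : R) : c <= x <= b ->
    is_derive x (1 : R) (fun t => ln (1 - c + 1 * t)) (hat c x).
  move=> /andP[cx xb]; have h : 0 < 1 - c + 1 * x by lra.
  have := is_derive_ln_affine h; move=> /is_derive_eq; apply.
  rewrite /hat ger0_norm; last by lra.
  have -> : 1 - c + 1 * x = 1 + (x - c) by ring.
  by rewrite mul1r.
rewrite (rint_FTC_on ac (@rcont_hat c) d1) (rint_FTC_on cb (@rcont_hat c) d2).
have -> : 1 + c + -1 * c = 1 by ring.
have -> : 1 - c + 1 * c = 1 by ring.
have -> : 1 + c + -1 * a = 1 + (c - a) by ring.
have -> : 1 - c + 1 * b = 1 + (b - c) by ring.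
rewrite ln1.
have h1 : ln (1 + (c - a)) <= ln (1 + (b - a)) by rewrite ler_ln ?posrE; lra.
have h2 : ln (1 + (b - c)) <= ln (1 + (b - a)) by rewrite ler_ln ?posrE; lra.
lra.
Qed.

(** Moving c to the nearest point of [a, b] brings it closer to every x in the segment and so
    increases the integrand. *)
Lemma int_hat (a b c : R) : a <= b -> rint (hat c) a b <= 2 * ln (1 + (b - a)).
Proof.
move=> ab; pose c' := Num.max a (Num.min c b).
have ac : a <= c' by rewrite le_max lexx.
have cb : c' <= b by rewrite ge_max ab ge_min lexx orbT.
apply: le_trans (int_hat_inside ac cb); apply: rint_le; try exact: rcont_hat.
move=> x /andP[ax xb]; rewrite lef_pV2 ?posrE ?ltr_wpDr // lerD2l /c'.
have [h|h] := leP c b; have [h'|h'] := leP a _ => //.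
- by rewrite !ger0_norm; lra.
- by rewrite !ler0_norm; lra.
- lra.
Qed.

Lemma finite_log_measure_dyadic (E : nat -> set R) (K q : R) : 0 <= K -> 0 <= q < 1 ->
  (forall n, measurable (E n : set (measurableTypeR R))) ->
  (forall n, E n `<=` `]2 ^+ n, 2 ^+ n.+1]) ->
  (forall n, (\int[mu]_(r in E n) (r^-1)%:E <= (K * q ^+ n)%:E)%E) ->
  finite_log_measure (\bigcup_n E n) /\ \bigcup_n E n `<=` `]1, +oo[.
Proof.
move=> K0 /andP[q0 q1] mE sE iE; split; last first.
  move=> r [n _ /sE]; rewrite /= !in_itv /= andbT => /andP[h _].
  by apply: le_lt_trans h; rewrite exprn_ege1 // ler1n.
split; first exact: bigcup_measurable.
have tE : trivIset setT E.
  apply: ltn_trivIset => n m nm; rewrite -subset0 => r [/sE + /sE].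
  rewrite /= !in_itv /= => /andP[_ h1] /andP[h2 _].
  have : (2 : R) ^+ m.+1 <= 2 ^+ n by rewrite ler_eXn2l // ltr1n.
  by move=> /(le_trans h1) /(lt_le_trans h2); rewrite ltxx.
rewrite ge0_integral_bigcup //; last 2 first.
- apply/measurable_EFinP; apply: subspace_continuous_measurable_fun.
    by apply: bigcup_measurable => n _; exact: mE.
  apply: continuous_in_subspaceT => r /set_mem[n _ /sE]; rewrite /= in_itv /= => /andP[h _].
  apply: inv_continuous; rewrite gt_eqF //.
  by apply: le_lt_trans h; rewrite exprn_ge0.
- by move=> r [n _ /sE]; rewrite /= in_itv /= => /andP[h _]; rewrite lee_fin invr_ge0 (le_trans _ (ltW h)) // exprn_ge0.
apply: (@le_lt_trans _ _ (K / (1 - q))%:E); last exact: ltry.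
have iE0 n : (0 <= \int[mu]_(r in E n) (r^-1)%:E)%E.
  apply: integral_ge0 => r /sE; rewrite /= in_itv /= => /andP[h _].
  by rewrite lee_fin invr_ge0 (le_trans _ (ltW h)) // exprn_ge0.
apply: lime_le; first by apply: is_cvg_nneseries => n _ _; exact: iE0.
near=> n; apply: (@le_trans _ _ (\sum_(0 <= i < n) (K * q ^+ i)%:E)%E).
  by apply: lee_sum => i _; exact: iE.
rewrite sumEFin lee_fin ler_pdivlMr ?subr_gt0 // -mulr_sumr -mulrA.
apply: ler_piMr => //.
have -> : (\sum_(0 <= i < n) q ^+ i) * (1 - q) = 1 - q ^+ n.
  elim: (n) => [|m IH]; first by rewrite big_geq // mul0r expr0 subrr.
  by rewrite big_nat_recr //= mulrDl IH exprS; ring.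
by rewrite gerBl exprn_ge0.
Unshelve. all: by end_near.
Qed.

Lemma level_set_integral (s : seq C) (X la : R) : 1 <= X -> 0 < la ->
  let S r := \sum_(x <- s) hat (cmod x) r in
  let E := [set r : R | X < r <= 2 * X /\ la <= S r] in
  measurable (E : set (measurableTypeR R)) /\
  (\int[mu]_(r in E) (r^-1)%:E <=
    ((size s)%:R * (2 * ln (1 + X)) / (la * X))%:E)%E.
Proof.
move=> X1 la0 S E; have X0 : 0 < X by lra.
have cS : rcont S by apply: rcont_sum => x _; exact: rcont_hat.
have S0 r : 0 <= S r by apply: sumr_ge0 => x _; rewrite ltW // hat_gt0.
split.
  have -> : E = `]X, 2 * X] `&` [set r | la <= S r].
    by apply/seteqP; split=> r /=; rewrite in_itv.
  apply: measurableI; first exact: measurable_itv.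
  rewrite -[X in measurable X]setTI; apply: (measurable_fun_le (D := setT)) => //.
  exact: continuous_measurable_fun.
(* On E one has S r / la >= 1 and 1 / r <= 1 / X, so [g] dominates 1 / r there. *)
pose g r := S r * (la * X)^-1.
have cg : rcont g by apply: rcontM => //; exact: rcont_cst.
apply: (@le_trans _ _ (\int[mu]_(r in `[X, (2 * X)%R]) (g r)%:E)%E).
  apply: le_integral_restrict => [r [/andP[h _] _]|r _|r [/andP[h h'] _]|r [/andP[h _] hS]].
  - by rewrite lee_fin invr_ge0; lra.
  - by rewrite lee_fin mulr_ge0 ?invr_ge0 ?mulr_ge0 // ltW.
  - by rewrite /= in_itv /= h' (ltW h).
  - rewrite lee_fin /g ler_pdivlMr ?mulr_gt0 // mulrC ler_pdivrMr; last by lra.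
    by apply: ler_pM => //; [exact: ltW|exact: ltW|exact: ltW].
have -> : (\int[mu]_(r in `[X, (2 * X)%R]) (g r)%:E = (rint g X (2 * X))%:E)%E.
  by rewrite /rint /Rintegral fineK //; apply: integrable_fin_num => //; exact: rcont_integrable.
rewrite lee_fin /g.
have -> : rint (fun r => S r * (la * X)^-1) X (2 * X) = (la * X)^-1 * rint S X (2 * X).
  by rewrite -rintZ //; congr rint; apply/funext => r; rewrite mulrC.
rewrite mulrC; apply: ler_wpM2r; first by rewrite invr_ge0 mulr_ge0 // ltW.
rewrite rint_sum //; [|lra|by move=> x _; exact: rcont_hat].
apply: sum_le_size => x _; have XX : X <= 2 * X by lra.
apply: le_trans (int_hat _ XX) _.
by have -> : 2 * X - X = X by ring.
Qed.
End Exceptional.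

(** * Bounds at a given scale *)

Section Scale.
Variable R : realType.
Local Notation C := (Cplx R).
Implicit Types (f : C -> C) (z w x : C).

Lemma ln_le_powR (y t : R) : 0 < y -> 0 < t -> ln y <= y `^ t / t.
Proof.
move=> y0 t0; rewrite ler_pdivlMr // mulrC -ln_powR.
by apply: le_trans (ln_leB1 _) _; [exact: powR_gt0|rewrite gerBl].
Qed.

Lemma powRM_pos (x p q : R) : 0 < x -> x `^ (p + q) = x `^ p * x `^ q.
Proof. by move=> x0; apply: powRD; apply/implyP => _; rewrite gt_eqF. Qed.

(** Supplies the inner circle for Jensen's formula, chosen once for f; its mean of ln |f| stands in
    for ln |f(0)|. *)
Lemma good_circle f (r n : R) z0 : meromorphic f -> 2 < r ->
  (pole_count f (9 * r) <= n%:E)%E -> cmod z0 < r -> ~ pole f z0 -> f z0 != 0 ->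
  exists2 u : R, 1 <= u <= 2 & forall w, cmod w = u -> ~ pole f w /\ f w != 0.
Proof.
move=> mf r2 cn z0r np fz0; have r0 : 0 < r by lra.
have [a [b [G [_ G0 fE [_ pb] _]]]] := factorization mf r0 cn z0r np fz0.
have h12 : (1 : R) < 2 by lra.
have [u [v [u1 uv v2 H]]] := gap_exists (map (@cmod R) (a ++ b)) h12.
exists u; first by rewrite !ltW // (lt_trans uv).
move=> w wu; have wr : cmod w < r by lra.
have nab x : x \in a ++ b -> w != x.
  move=> xab; apply/eqP => wx; have := H (cmod w).
  by rewrite wu lexx uv -wu wx => /(_ (map_f _ xab)).
have wb : w \notin b.
  by apply/negP => wb; have := nab w; rewrite mem_cat wb orbT eqxx => /(_ isT).
have wa : w \notin a.
  by apply/negP => wa; have := nab w; rewrite mem_cat wa eqxx => /(_ isT).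
split; first by move=> pw; move: wb; rewrite (pb w).
have : f w * \prod_(x <- b) (w - x) != 0.
  by rewrite fE // mulf_neq0 ?G0 ?prod_subr_neq0.
by rewrite mulf_eq0 negb_or => /andP[].
Qed.

(** Y stands for X^(sigma + theta), the size of T and n, and Z for X^theta, which absorbs a
    logarithm L. The count then has size Y Z and the mean of |ln |G|| has size Y Z^2. *)
Lemma scale_numeric (Y Z T D n L k1 k2 k3 l : R) : 1 <= Y -> 1 <= Z ->
  0 <= T <= k1 * Y -> 0 <= D -> 0 <= n <= k2 * Y -> 0 <= L <= k3 * Z -> 0 < l ->
  let A := (T + D + n * L) / l in
  let k4 := (k1 + D + k2 * k3) / l + k2 in
  A + n <= k4 * (Y * Z) /\
  2 * T + D + n * L + (A + n) * (2 * L) <=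
    (2 * k1 + D + k2 * k3 + k4 * (2 * k3)) * (Y * Z * Z).
Proof.
move=> Y1 Z1 /andP[T0 Tk] D0 /andP[n0 nk] /andP[L0 Lk] l0 A k4.
have Y0 : 0 <= Y by lra.
have Z0 : 0 <= Z by lra.
have YZ : Y <= Y * Z by rewrite ler_peMr.
have YZ1 : 1 <= Y * Z by apply: le_trans YZ.
have YZ0 : 0 <= Y * Z by rewrite mulr_ge0.
have YZZ : Y * Z <= Y * Z * Z by rewrite ler_peMr.
have k10 : 0 <= k1 by move: (le_trans T0 Tk); rewrite pmulr_lge0 //; lra.
have k20 : 0 <= k2 by move: (le_trans n0 nk); rewrite pmulr_lge0 //; lra.
have k30 : 0 <= k3 by move: (le_trans L0 Lk); rewrite pmulr_lge0 //; lra.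
have nL : n * L <= k2 * k3 * (Y * Z).
  by apply: le_trans (ler_pM n0 L0 nk Lk) _; rewrite le_eqVlt; apply/orP; left; apply/eqP; ring.
have T' : T <= k1 * (Y * Z) by apply: le_trans Tk _; exact: ler_wpM2l.
have n' : n <= k2 * (Y * Z) by apply: le_trans nk _; exact: ler_wpM2l.
have D' : D <= D * (Y * Z) by rewrite ler_peMr.
have h1 : A + n <= k4 * (Y * Z).
  rewrite /k4 mulrDl; apply: lerD => //.
  rewrite mulrAC ler_pM2r ?invr_gt0 // !mulrDl.
  by apply: lerD => //; exact: lerD.
split => //.
have A0 : 0 <= A + n.
  apply: addr_ge0 => //; apply: divr_ge0; last exact: ltW.
  by rewrite !addr_ge0 // mulr_ge0.
have h2 : (A + n) * (2 * L) <= k4 * (Y * Z) * (2 * (k3 * Z)).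
  by apply: ler_pM => //; [rewrite mulr_ge0|rewrite ler_pM2l].
have e1 : k1 * (Y * Z) <= k1 * (Y * Z * Z) by exact: ler_wpM2l.
have e2 : D * (Y * Z) <= D * (Y * Z * Z) by exact: ler_wpM2l.
have e3 : k2 * k3 * (Y * Z) <= k2 * k3 * (Y * Z * Z) by apply: ler_wpM2l => //; rewrite mulr_ge0.
have -> : (2 * k1 + D + k2 * k3 + k4 * (2 * k3)) * (Y * Z * Z) =
  2 * (k1 * (Y * Z * Z)) + D * (Y * Z * Z) + k2 * k3 * (Y * Z * Z) +
  k4 * (Y * Z) * (2 * (k3 * Z)) by ring.
move: T' nL D' h2 e1 e2 e3; clear; move: (k4 * _ * _) ((A + n) * _) (k1 * (Y * Z))
  (k1 * (Y * Z * Z)) (D * (Y * Z)) (D * (Y * Z * Z)) (n * L) => *; lra.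
Qed.

Lemma bounds_at_scale f (sigma theta : R) z0 : meromorphic f ->
  ~ pole f z0 -> f z0 != 0 -> nev_order f = sigma%:E -> 0 < theta ->
  exists K X0 : R, [/\ 0 <= K, 1 <= X0 & forall X, X0 <= X ->
    exists s : seq C, [/\ (size s)%:R <= K * X `^ (sigma + 2 * theta),
      forall x, cmod x < 6 * X -> pole f x \/ f x = 0 -> x \in s &
      forall z w, cmod z <= 3 * X -> cmod w <= 3 * X ->
        (forall x, x \in s -> 0 < cmod (z - x) /\ cmod (w - z) <= cmod (z - x) / 2) ->
        `|ln (cmod (f w)) - ln (cmod (f z))| <= cmod (w - z) *
          (K * X `^ (sigma - 1 + 3 * theta) + 2 * \sum_(x <- s) (cmod (z - x))^-1)]].
Proof.
move=> mf np fz0 fo t0; have s0 := nev_order_ge0 fo.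
have st : sigma < sigma + theta by lra.
have [A0 A1 TA] := nev_char_le fo st.
set s := sigma + theta in st TA; have sp : 0 <= s by rewrite /s; lra.
have pc r : 1 <= r -> A0 < 2 * r ->
    (pole_count f r <= ((pole_mult f 0)%:R + 2 * (2 * r) `^ s)%:E)%E.
  by move=> r1 rA; apply: pole_count_le_char => //; exact: TA.
set m0 : R := (pole_mult f 0)%:R in pc; have m00 : 0 <= m0 by rewrite ler0n.
have c0 := cmod_ge0 z0.
have [u u12 fu] : exists2 u : R, 1 <= u <= 2 & forall w, cmod w = u -> ~ pole f w /\ f w != 0.
  pose r := A0 + cmod z0 + 2.
  have h1 : 2 < r by rewrite /r; lra.
  have h2 : cmod z0 < r by rewrite /r; lra.
  apply: (good_circle mf h1 (pc (9 * r) _ _) h2 np fz0); rewrite /r; lra.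
set D := `|logmean f u|; have D0 : 0 <= D by exact: normr_ge0.
have JD : - logmean f u <= D by rewrite /D; have := ler_norm (- logmean f u); rewrite normrN.
(* The pole count at 144 X is bounded through the characteristic at 288 X, and the same power also
   covers the circles of radius at most 16 X. *)
pose k1 : R := 288 `^ s; have k10 : 0 <= k1 by exact: powR_ge0.
pose k2 := m0 + 2 * k1; have k20 : 0 <= k2 by rewrite /k2; lra.
pose k3 : R := 32 `^ theta / theta; have k30 : 0 <= k3 by rewrite divr_ge0 ?powR_ge0 // ltW.
have l20 : 0 < ln (2 : R) by rewrite ln_gt0 // ltr1n.
pose k4 := (k1 + D + k2 * k3) / ln 2 + k2.
have k40 : 0 <= k4.
  apply: addr_ge0 => //; apply: divr_ge0; last exact: ltW.
  by rewrite !addr_ge0 // mulr_ge0.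
pose k5 := 2 * k1 + D + k2 * k3 + k4 * (2 * k3).
have k50 : 0 <= k5.
  have q1 : 0 <= k2 * k3 by exact: mulr_ge0.
  have q2 : 0 <= k4 * (2 * k3) := mulr_ge0 k40 (mulr_ge0 (ler0n _ 2) k30).
  apply: addr_ge0 => //; apply: addr_ge0 => //; apply: addr_ge0 => //.
  by rewrite mulr_ge0.
exists (k4 + 2 * k5), (A0 + cmod z0 + 4); split; [lra|lra|] => X XX.
have X4 : 4 <= X by lra.
have X0 : 0 < X by lra.
have X1 : 1 <= X by lra.
have XA : A0 < X by lra.
have Xz : cmod z0 < X by lra.
have T288 : (288 * X) `^ s = k1 * X `^ s by exact: (powRM _ (ler0n _ 288) (ltW X0)).
set Y := X `^ s in T288.
have Y1 : 1 <= Y by rewrite -(powRr0 X) ler_powR.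
pose Z := X `^ theta.
have Z1 : 1 <= Z by rewrite -(powRr0 X) ler_powR // ltW.
set T := (288 * X) `^ s in T288.
have T0 : 0 <= T <= k1 * Y by rewrite powR_ge0 T288 lexx.
pose n := m0 + 2 * T.
have n0 : 0 <= n <= k2 * Y.
  have mY : m0 <= m0 * Y by rewrite ler_peMr.
  by apply/andP; split; rewrite /n /k2 T288; [move: T0 => /andP[]; rewrite T288; lra|rewrite mulrDl; lra].
set L := ln (32 * X).
have X32 : 0 < 32 * X by lra.
have L0 : 0 <= L <= k3 * Z.
  rewrite ln_ge0; last by lra.
  apply: le_trans (ln_le_powR X32 t0) _.
  by rewrite powRM ?(ltW X0) // /k3 -/Z mulrAC.
have [N1 N2] := scale_numeric Y1 Z1 T0 D0 n0 L0 l20.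
have pcX : (pole_count f (144 * X) <= n%:E)%E.
  have h1 : 1 <= 144 * X by lra.
  have h2 : A0 < 2 * (144 * X) by lra.
  have := pc _ h1 h2; have -> : 2 * (144 * X) = 288 * X by ring.
  by [].
have mT rho : 6 * X <= rho <= 16 * X -> rcont (fun y => ln (cmod (f (circ rho y)))) ->
   (forall y, f (circ rho y) != 0) -> logpmean f rho <= T.
  move=> /andP[h1 h2] cf f0; have rA : A0 < rho by lra.
  have r1 : 1 <= rho by lra.
  apply: (logpmean_le_char r1 cf f0); apply: le_trans (TA _ rA) _.
  have r0 : 0 <= rho by lra.
  have X288 : 0 <= 288 * X by lra.
  have rX : rho <= 288 * X by lra.
  by rewrite lee_fin /T; exact: (ge0_ler_powR sp).
have nn : 0 <= n by case/andP: n0.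
have [S [sS inS gS]] := local_growth mf X4 nn pcX Xz np fz0 u12 fu JD mT.
rewrite -/L -/k4 in N1 N2 sS gS.
have YZ : Y * Z = X `^ (sigma + 2 * theta).
  by rewrite -powRM_pos //; congr (_ `^ _); rewrite /s; ring.
have YZZ : Y * Z * Z / X = X `^ (sigma - 1 + 3 * theta).
  rewrite -(powR_inv1 (ltW X0)) -!powRM_pos //; congr (_ `^ _); rewrite /s; ring.
exists S; split => //.
  apply: le_trans sS _; apply: le_trans N1 _; rewrite YZ.
  by apply: ler_wpM2r; [exact: powR_ge0|lra].
move=> z w z3 w3 H; apply: le_trans (gS z w z3 w3 H) _.
apply: ler_wpM2l; first exact: cmod_ge0.
rewrite lerD2r; rewrite -/k5 in N2.
have X6 : 0 <= 8 / (6 * X) := divr_ge0 (ler0n _ 8) (mulr_ge0 (ler0n _ 6) (ltW X0)).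
apply: le_trans (ler_wpM2l X6 N2) _; rewrite -YZZ.
have -> : 8 / (6 * X) * (k5 * (Y * Z * Z)) = (8 / 6 * k5) * (Y * Z * Z / X).
  by field; exact: lt0r_neq0.
apply: ler_wpM2r; last by lra.
by rewrite YZZ powR_ge0.
Qed.
End Scale.

(** * Logarithmic derivatives and conclusion *)

Section Main.
Variable R : realType.
Local Notation C := (Cplx R).
Local Notation mu := (@lebesgue_measure R).
Implicit Types (f : C -> C) (z w x eta : C).

Lemma dyadic_interval (r : R) : 1 < r -> exists n, 2 ^+ n < r <= 2 ^+ n.+1.
Proof.
move=> r1; have ex : exists n, r <= 2 ^+ n.+1.
  exists (Num.truncn r).+1; apply/ltW/(lt_trans (truncnS_gt r)).
  by rewrite -natrX ltr_nat (leq_ltn_trans _ (ltn_expl _ (ltnSn 1))).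
exists (ex_minn ex); case: ex_minnP => m rm min_m; rewrite rm andbT.
case: m rm min_m => [|m] _ min_m; first by rewrite expr0.
by rewrite ltNge; apply/negP => /min_m; rewrite ltnn.
Qed.

Lemma pow2_large (Y : R) : exists J, forall n, (J <= n)%N -> Y <= 2 ^+ n.
Proof.
exists (Num.truncn Y).+1 => n Jn; apply/ltW/(lt_le_trans (truncnS_gt Y)).
rewrite -natrX ler_nat; apply: leq_trans Jn _; apply/ltnW; exact: ltn_expl.
Qed.

Lemma pow2_powR (n : nat) (t : R) : (2 ^+ n : R) `^ t = (2 `^ t) ^+ n.
Proof.
rewrite -(powR_mulrn n (ler0n R 2)) -(powR_mulrn n (powR_ge0 2 t)).
exact: powRAC.
Qed.

Lemma dyadic_shell_integral (X : R) : 0 < X ->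
  (\int[mu]_(r in `]X, (2 * X)%R]) (r^-1)%:E <= 1)%E.
Proof.
move=> X0; have -> : (1 = \int[mu]_(r in `[X, (2 * X)%R]) (X^-1)%:E)%E.
  rewrite integral_cst //= lebesgue_measure_itv /= lte_fin ifT; last by lra.
  rewrite -EFinB -EFinM; congr (_%:E); field; exact: lt0r_neq0.
apply: le_integral_restrict => [r|r _|r|r]; rewrite /= ?in_itv /=.
- by move=> /andP[h _]; rewrite lee_fin invr_ge0; lra.
- by rewrite lee_fin invr_ge0 ltW.
- by move=> /andP[h ->]; rewrite (ltW h).
- by move=> /andP[h _]; rewrite lee_fin lef_pV2 ?posrE ?ltW //; lra.
Qed.

Section Point.
Variables (f : C -> C) (s : seq C) (X la K : R) (z : C).

(** Every hat is below la <= 1/2, so ||z| - |x|| >= 1, which gives 1/|z - x| <= 2 hat and |z - x| >=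
    1 / (2 la). The radius 1 / (4 la) is half that distance, and at most X, so w stays in |w| <= 3
    X. The change of ln |f| is at most (K la + 4 la) / (4 la) = (K + 4) / 4. *)
Lemma point_estimate : meromorphic f -> 1 <= X -> X < cmod z <= 2 * X ->
  0 < la -> la <= 2^-1 -> 1 <= 4 * la * X -> 0 <= K ->
  \sum_(x <- s) hat (cmod x) (cmod z) < la ->
  (forall x, cmod x < 6 * X -> pole f x \/ f x = 0 -> x \in s) ->
  (forall z w, cmod z <= 3 * X -> cmod w <= 3 * X ->
      (forall x, x \in s -> 0 < cmod (z - x) /\ cmod (w - z) <= cmod (z - x) / 2) ->
      `|ln (cmod (f w)) - ln (cmod (f z))| <= cmod (w - z) *
        (K * la + 2 * \sum_(x <- s) (cmod (z - x))^-1)) ->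
  forall w, cmod (w - z) <= (4 * la)^-1 ->
    [/\ ~ pole f w, f w != 0, cderivable f w &
      cmod (f w) <= expR ((K + 4) / 4) * cmod (f z)].
Proof.
move=> mf X1 /andP[zX z2X] la0 la2 laX K0 Sla inS gS w wz.
have la4 : 0 < 4 * la by lra.
have rX : (4 * la)^-1 <= X.
  by rewrite -(ler_pM2l la4) divff ?gt_eqF.
have far x : x \in s -> [/\ 0 < cmod (z - x), (2 * la)^-1 <= cmod (z - x) &
    (cmod (z - x))^-1 <= 2 * hat (cmod x) (cmod z)].
  move=> xs; have hl : hat (cmod x) (cmod z) < la.
    apply: le_lt_trans Sla; rewrite (big_rem x) //= lerDl.
    by apply: sumr_ge0 => y _; rewrite ltW // hat_gt0.
  have d0 : 0 < 1 + `|cmod z - cmod x| by rewrite ltr_wpDr.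
  have h1 : la^-1 < 1 + `|cmod z - cmod x|.
    by rewrite -[ltRHS]invrK ltf_pV2 ?posrE ?invr_gt0.
  have h2 : 2 <= la^-1 by rewrite -[leLHS]invrK lef_pV2 ?posrE // invr_gt0.
  have h3 : `|cmod z - cmod x| <= cmod (z - x).
    rewrite ler_norml lerNl opprB cmod_lerB andbT cmodBC; exact: cmod_lerB.
  have h4 : 1 <= `|cmod z - cmod x| by lra.
  have h5 : 0 < cmod (z - x) by lra.
  split => //.
    rewrite invfM; lra.
  rewrite /hat -[leRHS]invrK lef_pV2 ?posrE ?invr_gt0 ?mulr_gt0 ?invr_gt0 //.
  rewrite invfM invrK; lra.
have near_s v : cmod (v - z) <= (4 * la)^-1 ->
    forall x, x \in s -> 0 < cmod (z - x) /\ cmod (v - z) <= cmod (z - x) / 2.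
  move=> vz x /far[h1 h2 _]; split => //; apply: le_trans vz _.
  have -> : (4 * la)^-1 = (2 * la)^-1 / 2.
    by rewrite -invfM; congr (_^-1); ring.
  lra.
have clear v : cmod (v - z) <= (4 * la)^-1 -> cmod v <= 3 * X /\ v \notin s.
  move=> vz; split; first by have := cmod_lerB v z; lra.
  apply/negP => vs; have [h1 h2] := near_s v vz v vs.
  by move: h2; rewrite (cmodBC v z); lra.
have ok v : cmod (v - z) <= (4 * la)^-1 -> ~ pole f v /\ f v != 0.
  move=> vz; have [v3 vs] := clear v vz; have v6 : cmod v < 6 * X by lra.
  split; first by move=> pv; move: vs; rewrite inS //; left.
  by apply/eqP => fv; move: vs; rewrite inS //; right.
have zz : cmod (z - z) <= (4 * la)^-1 by rewrite subrr cmod0 invr_ge0 ltW.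
have [np fw] := ok w wz; have [_ fz] := ok z zz.
split => //.
  have [/holomorphic_atP[r r0 dr]|//] := mf w.
  by apply: dr; rewrite subrr cmod0.
have [w3 _] := clear w wz; have [z3 _] := clear z zz.
have H := gS z w z3 w3 (near_s w wz).
have sum2 : \sum_(x <- s) (cmod (z - x))^-1 <= 2 * la.
  apply: (@le_trans _ _ (2 * \sum_(x <- s) hat (cmod x) (cmod z))); last lra.
  by rewrite mulr_sumr big_seq [leRHS]big_seq; apply: ler_sum => x /far[].
have B0 : 0 <= K * la + 2 * \sum_(x <- s) (cmod (z - x))^-1.
  rewrite addr_ge0 ?mulr_ge0 ?(ltW la0) //; apply: sumr_ge0 => x _.
  by rewrite invr_ge0 cmod_ge0.
have {}H : ln (cmod (f w)) - ln (cmod (f z)) <= (K + 4) / 4.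
  apply: le_trans (ler_norm _) _; apply: le_trans H _.
  apply: (@le_trans _ _ ((4 * la)^-1 * ((K + 4) * la))).
    apply: ler_pM => //; first exact: cmod_ge0.
    lra.
  rewrite le_eqVlt; apply/orP; left; apply/eqP; field; exact: lt0r_neq0.
have w0 : 0 < cmod (f w) by rewrite cmod_gt0.
have z0 : 0 < cmod (f z) by rewrite cmod_gt0.
rewrite -[leLHS]lnK ?posrE // -[X in _ <= _ * X]lnK ?posrE // -expRD ler_expR; lra.
Qed.
End Point.

Lemma quotient_estimate eta k f z (la M : R) : 0 < la -> f z != 0 ->
  (forall w, cmod (w - z) <= (4 * la)^-1 ->
    cderivable f w /\ cmod (f w) <= M * cmod (f z)) ->
  k%:R * cmod eta <= (4 * la)^-1 / 2 ->
  cmod (fdiffn eta k f z / f z - eta ^+ k * (derive1n k f z / f z)) <=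
    2 ^+ k * (2 * M * (k%:R * cmod eta) ^+ k.+1) * 4 ^+ k.+1 * la ^+ k.+1.
Proof.
move=> la0 fz H ke; have r0 : 0 < (4 * la)^-1 by rewrite invr_gt0 mulr_gt0.
have := @difference_estimate R eta k f z (4 * la)^-1 (M * cmod (f z)) r0
  (fun w wz => (H w wz).1) (fun w wz => (H w wz).2) ke.
have z0 : 0 < cmod (f z) by rewrite cmod_gt0.
move=> D; have -> : fdiffn eta k f z / f z - eta ^+ k * (derive1n k f z / f z) =
  (fdiffn eta k f z - eta ^+ k * derive1n k f z) / f z by ring.
rewrite cmodM cmodV ler_pdivrMr //; apply: le_trans D _.
rewrite le_eqVlt; apply/orP; left; apply/eqP.
by rewrite exprVn invrK [(4 * la) ^+ _]exprMn; ring.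
Qed.

(** For la = X^(sigma - 1 + delta): the disc radius 1 / (4 la) is at most X, the rate of the
    zero-free factor is at most la, and the exceptional part of the shell at scale X has size
    X^(-theta). *)
Lemma exponent_bounds (sigma delta theta X : R) : 0 <= sigma -> sigma + delta <= 1 ->
  theta = delta / 4 -> 0 < delta -> 1 <= X ->
  [/\ 1 <= 4 * X `^ (sigma - 1 + delta) * X,
    X `^ (sigma - 1 + 3 * theta) <= X `^ (sigma - 1 + delta) &
    X `^ (sigma + 2 * theta) * X `^ theta / (X `^ (sigma - 1 + delta) * X) = X `^ (- theta)].
Proof.
move=> s0 sd -> d0 X1; have X0 : 0 < X by lra.
have lX : X `^ (sigma - 1 + delta) * X = X `^ (sigma + delta).
  rewrite -{2}(powRr1 (ltW X0)) -powRM_pos //; congr (_ `^ _); ring.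
split.
- rewrite -mulrA lX; have : 1 <= X `^ (sigma + delta).
    by rewrite -(powRr0 X) ler_powR //; lra.
  lra.
- by rewrite ler_powR //; lra.
- by rewrite lX -powRN -!powRM_pos //; congr (_ `^ _); field.
Qed.
End Main.

Theorem theorem5p2 (R : realType) (f : Cplx R -> Cplx R) (sigma : R)
    (eta : Cplx R)
    (f_mero : meromorphic f)
    (f_neq0 : exists z : Cplx R, ~ pole f z /\ f z != 0)
    (f_order : nev_order f = sigma%:E)
    (sigma_lt1 : sigma < 1)
    (eta_neq0 : eta != 0)
    (eps : R) (eps_gt0 : 0 < eps)
    (k : nat) (k_gt0 : (0 < k)%N) :
  exists E : set R,
    [/\ E `<=` `]1, +oo[,
        finite_log_measure E,
        forall z : Cplx R, ~ (E `|` `[0, 1]) (cmod z) ->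
          quotients_defined eta k f z &
        bigO_off E
          (fun z => fdiffn eta k f z / f z
                    - eta ^+ k * (derive1n k f z / f z))
          (fun r => r `^ (k.+1%:R * (sigma - 1) + eps))].
Proof.
have [z0 [np0 fz0]] := f_neq0; have s0 := nev_order_ge0 f_order.
(* The first bound keeps the loss (k + 1) delta below eps; the second keeps sigma + delta < 1, so
   that la tends to 0 and the discs grow. *)
pose delta : R := Num.min (eps / k.+1%:R) ((1 - sigma) / 2).
have k1 : 0 < k.+1%:R :> R by rewrite ltr0n.
have d0 : 0 < delta by rewrite lt_min !divr_gt0 // subr_gt0.
have de : k.+1%:R * delta <= eps by rewrite mulrC -ler_pdivlMr // ge_min lexx.
have ds : delta <= (1 - sigma) / 2 by rewrite ge_min lexx orbT.
pose theta := delta / 4; have t0 : 0 < theta by rewrite divr_gt0.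
have [K [X0 [K0 X01 HX]]] := bounds_at_scale f_mero np0 fz0 f_order t0.
pose a := 1 - sigma - delta.
have a0 : 0 < a by rewrite /a; lra.
have aE : - a = sigma - 1 + delta by rewrite /a; ring.
(* la <= c0 gives la <= 1/2 for [point_estimate] and k |eta| <= 1 / (8 la), half the radius of the
   disc. *)
pose c0 : R := Num.min 2^-1 (8 * (k%:R * cmod eta + 1))^-1.
have ke0 : 0 <= k%:R * cmod eta by rewrite mulr_ge0 ?cmod_ge0.
have ke1 : 0 < 8 * (k%:R * cmod eta + 1) by lra.
have c00 : 0 < c0 by rewrite lt_min !invr_gt0 ke1 ltr0n.
(* Since la = X^(-a), the condition la <= c0 means X >= c0^(-1/a). *)
have [J HJ] := pow2_large (Num.max X0 (c0 `^ (- a^-1))).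
pose X n : R := 2 ^+ n; pose la n := X n `^ (sigma - 1 + delta).
have X1 n : 1 <= X n by rewrite exprn_ege1 // ler1n.
have Xp n : 0 < X n by apply: lt_le_trans (X1 n).
have la0 n : 0 < la n by exact: powR_gt0.
have JX n : (J <= n)%N -> X0 <= X n /\ la n <= c0.
  move=> /HJ; rewrite ge_max => /andP[-> h]; split => //.
  rewrite /la -aE powRN -[leRHS]invrK lef_pV2 ?posrE ?powR_gt0 ?invr_gt0 //.
  have -> : c0^-1 = (c0 `^ (- a^-1)) `^ a.
    by rewrite -powRrM mulNr mulVf ?gt_eqF // powR_inv1 // ltW.
  by apply: ge0_ler_powR => //; rewrite ?nnegrE ?powR_ge0 // ltW.
have /choice[S HS] : forall n, exists s : seq (Cplx R), (J <= n)%N ->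
  [/\ (size s)%:R <= K * X n `^ (sigma + 2 * theta),
      forall x, cmod x < 6 * X n -> pole f x \/ f x = 0 -> x \in s &
      forall z w, cmod z <= 3 * X n -> cmod w <= 3 * X n ->
        (forall x, x \in s -> 0 < cmod (z - x) /\ cmod (w - z) <= cmod (z - x) / 2) ->
        `|ln (cmod (f w)) - ln (cmod (f z))| <= cmod (w - z) *
          (K * X n `^ (sigma - 1 + 3 * theta) + 2 * \sum_(x <- s) (cmod (z - x))^-1)].
  move=> n; have [Jn|] := boolP (J <= n)%N; last by exists [::].
  by have [s Hs] := HX (X n) (JX n Jn).1; exists s.
(* The finitely many shells below the threshold J are discarded whole, so that any z outside the
   union with |z| > 1 lies in a shell where the estimates hold. *)
pose E n : set R := if (n < J)%N then [set` `]X n, 2 * X n]] else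
  [set r | X n < r <= 2 * X n /\ la n <= \sum_(x <- S n) hat (cmod x) r].
pose q : R := 2 `^ (- theta).
have q0 : 0 < q by exact: powR_gt0.
have q1 : q < 1.
  rewrite /q powRN invf_lt1 ?powR_gt0 //.
  have : (1 : R) `^ theta < 2 `^ theta by apply: gt0_ltr_powR; rewrite ?nnegrE // ltr1n.
  by rewrite powR1.
pose k3 : R := 2 * (2 `^ theta / theta).
have k30 : 0 <= k3 by rewrite mulr_ge0 // divr_ge0 ?powR_ge0 // ltW.
have sd : sigma + delta <= 1 by lra.
have XE n := exponent_bounds s0 sd erefl d0 (X1 n).
have EX n : E n `<=` `]2 ^+ n, 2 ^+ n.+1].
  rewrite exprS -/(X n) /E; case: ifP => _ //= r [h _].
  by rewrite /= in_itv.
have mE n : measurable (E n : set (measurableTypeR R)).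
  rewrite /E; case: ifP => _; first exact: measurable_itv.
  by have [] := level_set_integral (S n) (X1 n) (la0 n).
(* A discarded shell has logarithmic measure at most 1 <= q^-J q^n for n < J; the other shells
   contribute the term K k3. *)
have iE n : (\int[lebesgue_measure]_(r in E n) (r^-1)%:E <=
    ((K * k3 + q ^- J) * q ^+ n)%:E)%E.
  rewrite /E; case: ltnP => nJ.
    apply: le_trans (dyadic_shell_integral (Xp n)) _.
    rewrite lee_fin mulrDl; apply: ler_wpDl.
      exact: mulr_ge0 (mulr_ge0 K0 k30) (exprn_ge0 n (ltW q0)).
    rewrite mulrC ler_pdivlMr ?exprn_gt0 // mul1r.
    apply: ler_wiXn2l; [exact: ltW|exact: ltW|exact: ltnW].
  have [_ h] := level_set_integral (S n) (X1 n) (la0 n).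
  apply: le_trans h _; rewrite lee_fin.
  have [sn _ _] := HS n nJ; have [_ _ e3] := XE n.
  have ln1X : 2 * ln (1 + X n) <= k3 * X n `^ theta.
    rewrite /k3 -mulrA; apply: ler_wpM2l => //.
    have x2 : 0 < 2 * X n by rewrite mulr_gt0.
    apply: (@le_trans _ _ (ln (2 * X n))).
      by have := X1 n; rewrite ler_ln ?posrE //; lra.
    apply: le_trans (ln_le_powR x2 t0) _.
    by rewrite powRM ?(ltW (Xp n)) // mulrAC.
  have D0 : 0 < la n * X n by rewrite mulr_gt0.
  apply: (@le_trans _ _ (K * k3 * (X n `^ (sigma + 2 * theta) * X n `^ theta / (la n * X n)))).
    rewrite [leRHS]mulrA; apply: ler_wpM2r; first by rewrite invr_ge0 ltW.
    have -> : K * k3 * (X n `^ (sigma + 2 * theta) * X n `^ theta) =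
      (K * X n `^ (sigma + 2 * theta)) * (k3 * X n `^ theta) by ring.
    apply: ler_pM => //; rewrite mulr_ge0 // ln_ge0 //.
    by have := X1 n; lra.
  rewrite [_ / _]e3 pow2_powR -/q; apply: ler_wpM2r; first by rewrite exprn_ge0 // ltW.
  by rewrite lerDl invr_ge0 exprn_ge0 // ltW.
have KK0 : 0 <= K * k3 + q ^- J.
  apply: addr_ge0; first exact: mulr_ge0.
  by rewrite invr_ge0 exprn_ge0 // ltW.
have q01 : 0 <= q < 1 by rewrite (ltW q0).
have [flE subE] := finite_log_measure_dyadic KK0 q01 mE EX iE.
pose M := expR ((K + 4) / 4).
have main z : ~ (\bigcup_n E n `|` `[0, 1]) (cmod z) -> exists n,
    [/\ (J <= n)%N, X n < cmod z <= 2 * X n & forall w, cmod (w - z) <= (4 * la n)^-1 ->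
    [/\ ~ pole f w, f w != 0, cderivable f w & cmod (f w) <= M * cmod (f z)]].
  move=> /not_orP[zE z01]; have r1 : 1 < cmod z.
    rewrite ltNge; apply/negP => h; apply: z01.
    by rewrite /= in_itv /= cmod_ge0.
  have [n zn] := dyadic_interval r1; rewrite exprS -/(X n) in zn.
  have nE : ~ E n (cmod z) by move=> h; apply: zE; exists n.
  have Jn : (J <= n)%N.
    by rewrite leqNgt; apply/negP => h; apply: nE; rewrite /E h /= in_itv.
  exists n; split => //.
  have Sl : \sum_(x <- S n) hat (cmod x) (cmod z) < la n.
    rewrite ltNge; apply/negP => h; apply: nE.
    by rewrite /E ltnNge Jn.
  have [sn inS gS] := HS n Jn; have [_ lac] := JX n Jn; have [e1 e2 _] := XE n.
  have la2 : la n <= 2^-1 by apply: le_trans lac _; rewrite ge_min lexx.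
  apply: (point_estimate f_mero (X1 n) zn (la0 n) la2 e1 K0 Sl inS).
  move=> z' w z3 w3 H; apply: le_trans (gS z' w z3 w3 H) _.
  apply: ler_wpM2l; first exact: cmod_ge0.
  by rewrite lerD2r; apply: ler_wpM2l.
have kl n : (J <= n)%N -> k%:R * cmod eta <= (4 * la n)^-1 / 2.
  move=> Jn; have [_ lac] := JX n Jn.
  have l8 : la n <= (8 * (k%:R * cmod eta + 1))^-1.
    by apply: le_trans lac _; rewrite ge_min lexx orbT.
  have l4 : 0 < 4 * la n by rewrite mulr_gt0.
  rewrite ler_pdivlMr // -(ler_pM2r l4) mulVf ?gt_eqF //.
  by move: l8; rewrite -[leRHS]mul1r ler_pdivlMr //; have := la0 n; clear; lra.
exists (\bigcup_n E n); split => //.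
- move=> z /main[n [Jn _ H]]; have l4 : 0 < (4 * la n)^-1 by rewrite invr_gt0 mulr_gt0.
  have [|_ fz _ _] := H z; first by rewrite subrr cmod0 ltW.
  split => // j jk; have [|//] := H (z + eta *+ j).
  (* The shifted points z + j eta lie in the disc on which f has neither zeros nor poles. *)
  rewrite addrC addKr; apply: (@le_trans _ _ (k%:R * cmod eta)); last first.
    by apply: le_trans (kl n Jn) _; lra.
  have -> : eta *+ j = rc j%:R * eta by rewrite /rc rmorph_nat mulr_natl.
  rewrite cmodM cmod_rc ger0_norm //; apply: ler_wpM2r; first exact: cmod_ge0.
  by rewrite ler_nat.
- pose C0 := 2 ^+ k * (2 * M * (k%:R * cmod eta) ^+ k.+1) * 4 ^+ k.+1.
  have C00 : 0 <= C0 by rewrite !mulr_ge0 ?exprn_ge0 // ?mulr_ge0 ?expR_ge0.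
  (* la is defined by the scale X_n >= r / 2 rather than by r; [c2] pays for this factor 2 in
     la^(k+1). *)
  pose c2 : R := (2^-1 `^ (- a)) ^+ k.+1.
  have c20 : 0 <= c2 by rewrite exprn_ge0 // powR_ge0.
  exists 1, (C0 * c2 + 1); split => //; first by rewrite ltr_wpDl // mulr_ge0.
  move=> z z1 /main[n [Jn /andP[Xz zX] H]].
  have l4 : 0 < (4 * la n)^-1 by rewrite invr_gt0 mulr_gt0.
  have [|_ fz _ _] := H z; first by rewrite subrr cmod0 ltW.
  have Hq w : cmod (w - z) <= (4 * la n)^-1 -> cderivable f w /\ cmod (f w) <= M * cmod (f z).
    by move=> /H[].
  apply: le_trans (quotient_estimate (la0 n) fz Hq (kl n Jn)) _; rewrite -/C0.
  set r := cmod z in z1 Xz zX *; have r0 : 0 < r by lra.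
  have lr : la n <= r `^ (- a) * 2^-1 `^ (- a).
    rewrite -powRM ?(ltW r0) ?invr_ge0 // /la -aE !powRN lef_pV2 ?posrE ?powR_gt0 ?mulr_gt0 ?invr_gt0 //.
    by apply: ge0_ler_powR; rewrite ?nnegrE ?mulr_ge0 ?invr_ge0 ?(ltW a0) ?(ltW r0) ?(ltW (Xp n)) //; lra.
  have lk : la n ^+ k.+1 <= r `^ (k.+1%:R * (sigma - 1) + eps) * c2.
    apply: (@le_trans _ _ ((r `^ (- a) * 2^-1 `^ (- a)) ^+ k.+1)).
      by apply: lerXn2r => //; rewrite nnegrE ?mulr_ge0 ?powR_ge0 // ltW.
    rewrite exprMn -/c2; apply: ler_wpM2r => //.
    rewrite -(powR_mulrn _ (powR_ge0 r (- a))) -powRrM; apply: ler_powR; first exact: ltW.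
    rewrite aE; lra.
  apply: le_trans (ler_wpM2l C00 lk) _; rewrite mulrCA mulrC.
  apply: ler_wpM2r; first exact: powR_ge0.
  by rewrite lerDl.
Qed.
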